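(* For each $N$, let $\mathcal{A}_{1,N},\dots,\mathcal{A}_{s,N}\subseteq M_N(\mathcal{L}^{\infty-})$ be unital symmetric subalgebras, $\mathcal{A}_{j,N}$ generated by a tuple $X^{(j)}_N=(X^{(j)}_{1,N},\dots,X^{(j)}_{k_j,N})$ and transposes, such that the entries of matrices from different subalgebras form independent sets. Suppose that all, or all but one, of the families $\{\mathcal{A}_{j,N}\}_N$ are orthogonally invariant, and that each family satisfies (P1), (P2), (P3). Then the subalgebras are asymptotically real infinitesimally free: for every noncommutative polynomial $p$ in all generators $x^{(j)}_i$ and their transposes, the limits $\tau(p)=\lim_N\mathbb{E}(\mathrm{tr}(p(X_N)))$ and $\tau'(p)=\lim_N N\big(\mathbb{E}(\mathrm{tr}(p(X_N)))-\tau(p)\big)$ exist, and in the real infinitesimal probability space $(\mathbb{C}\langle x,x^t\rangle,\tau,\tau',t)$ the unital symmetric subalgebras $\mathcal{B}_j$ generated by $x^{(j)}_1,\dots,x^{(j)}_{k_j}$ and their transposes ($1\le j\le s$) are real infinitesimally free.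
   Context: $\mathcal{L}^{\infty-}$ is the algebra of complex random variables with all moments finite; $\mathrm{Tr}$ is the trace on $M_N(\mathcal{L}^{\infty-})$, $\mathrm{tr}=\frac1N\mathrm{Tr}$, $t$ the transpose. $X_N$ denotes the joint tuple of all generators; $p(X_N)$ the evaluation of a polynomial in variables $x,x^t$. A family is orthogonally invariant if for every deterministic real orthogonal $O$, $(OX^{(j)}_{i,N}O^t)_i$ has the same joint distribution as $(X^{(j)}_{i,N})_i$. A family with generators $Y_N$ satisfies (P1) if there are linear functionals $\tau,\tau'$ with $\mathbb{E}(\mathrm{tr}(p(Y_N)))=\tau(p)+N^{-1}\tau'(p)+o(N^{-1})$ for every polynomial $p$ in $y,y^t$; (P2) if $k_2(\mathrm{Tr}(p_1(Y_N)),\mathrm{Tr}(p_2(Y_N)))$ converges for all $p_1,p_2$; (P3) if $N^{r-3}k_r(\mathrm{Tr}(p_1(Y_N)),\dots,\mathrm{Tr}(p_r(Y_N)))=o(1)$ for $r\ge3$ ($k_r$ classical cumulants). The involution $t$ on $\mathbb{C}\langle x,x^t\rangle$ reverses words and exchanges $x\leftrightarrow x^t$. A real infinitesimal probability space $(\mathcal{A},\tau,\tau',t)$: unital algebra with involution $t$, linear $\tau$ with $\tau(1)=1$, $\tau(a^t)=\tau(a)$, and linear $\tau'$ with $\tau'(1)=0$. Symmetric unital subalgebras $\mathcal{B}_1,\dots,\mathcal{B}_s$ are real infinitesimally free if whenever $a_i\in\mathcal{B}_{j_i}$, $\tau(a_i)=0$, $j_1\ne j_2,\dots,j_{n-1}\ne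 j_n$: (1) $\tau(a_1\cdots a_n)=0$; (2) for $n=2$, $\tau'(a_1a_2)=0$; (3) for $n=2k-1\ge3$, $\tau'(a_1\cdots a_n)=\tau(a_1a_n)\tau'(a_2\cdots a_{n-1})+\tau(a_1a_k^ta_n)\tau(a_2a_{k+1}^t)\cdots\tau(a_{k-1}a_{n-1}^t)$; (4) for $n=2k\ge4$, $\tau'(a_1\cdots a_n)=\tau(a_1a_n)\tau'(a_2\cdots a_{n-1})+\tau(a_1a_{k+1}^t)\cdots\tau(a_ka_n^t)$. *)

(* Defs.v *)
From HB Require Import structures.
From mathcomp Require Import all_boot all_order all_algebra.
From mathcomp Require Import all_classical all_reals all_analysis.
From mathcomp Require Import complex.
Set Implicit Arguments. Unset Strict Implicit. Unset Printing Implicit Defensive.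
Import Order.TTheory GRing.Theory Num.Theory.
Import numFieldNormedType.Exports.
Local Open Scope ring_scope.
Local Open Scope classical_set_scope.

(* Elements of C<x, x^t> are represented by syntax trees; all functionals
   below are evaluated on trees. *)
Inductive ncpoly (R : realType) (V : Type) : Type :=
| NCconst of R[i]
| NCvar of V
| NCvarT of V
| NCadd of ncpoly R V & ncpoly R V
| NCmul of ncpoly R V & ncpoly R V.
Arguments NCconst {R V}.
Arguments NCvar {R V}.
Arguments NCvarT {R V}.
Arguments NCadd {R V}.
Arguments NCmul {R V}.

Fixpoint ncev (R : realType) (V : Type) (N : nat) (f : V -> 'M[R[i]]_N)
  (p : ncpoly R V) : 'M[R[i]]_N :=
  match p with
  | NCconst c => c%:M
  | NCvar v => f v
  | NCvarT v => (f v)^T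
  | NCadd a b => ncev f a + ncev f b
  | NCmul a b => ncev f a *m ncev f b
  end.

Fixpoint nct (R : realType) (V : Type) (p : ncpoly R V) : ncpoly R V :=
  match p with
  | NCconst c => NCconst c
  | NCvar v => NCvarT v
  | NCvarT v => NCvar v
  | NCadd a b => NCadd (nct a) (nct b)
  | NCmul a b => NCmul (nct b) (nct a)
  end.

(* all variables occurring in p satisfy Q  (membership in the unital symmetric
   subalgebra generated by the x_v, v in Q, and their transposes) *)
Fixpoint nc_over (R : realType) (V : Type) (Q : V -> bool) (p : ncpoly R V) : Prop :=
  match p with
  | NCconst _ => True
  | NCvar v => Q v
  | NCvarT v => Q v
  | NCadd a b => nc_over Q a /\ nc_over Q b
  | NCmul a b => nc_over Q a /\ nc_over Q b
  end.

Fixpoint ncprod (R : realType) (V : Type) (s : seq (ncpoly R V)) : ncpoly R V :=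
  match s with
  | [::] => NCconst 1
  | [:: a] => a
  | a :: t => NCmul a (ncprod t)
  end.

Definition ncprodr (R : realType) (V : Type) (a : nat -> ncpoly R V) (l m : nat) :=
  ncprod (map a (iota l (m.+1 - l)%N)).

Definition cmod (R : realType) (z : R[i]) : R := Num.sqrt (complex.Re z ^+ 2 + complex.Im z ^+ 2).

Definition Linfm (R : realType) d (T : measurableType d) (P : probability T R)
  (Z : T -> R[i]) : Prop :=
  measurable_fun setT (fun w => complex.Re (Z w)) /\ measurable_fun setT (fun w => complex.Im (Z w)) /\
  forall n : nat, P.-integrable setT (fun w => ((cmod (Z w)) ^+ n)%:E).

Definition EC (R : realType) d (T : measurableType d) (P : probability T R)
  (Z : T -> R[i]) : R[i] :=
  Complex (fine 'E_P[fun w => complex.Re (Z w)]) (fine 'E_P[fun w => complex.Im (Z w)]).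

Definition cvgC (R : realType) (u : nat -> R[i]) (l : R[i]) : Prop :=
  (fun n => complex.Re (u n)) @ \oo --> complex.Re l /\ (fun n => complex.Im (u n)) @ \oo --> complex.Im l.

Definition cumulant (R : realType) d (T : measurableType d) (P : probability T R)
  (r : nat) (Z : 'I_r -> T -> R[i]) : R[i] :=
  \sum_(pi : {set {set 'I_r}} | finset.partition pi [set: 'I_r]%SET)
     ((-1) ^+ (#|pi|.-1) * ((#|pi|.-1)`!)%:R *
      \prod_(B : {set 'I_r} | B \in pi) EC P (fun w => \prod_(i : 'I_r | i \in B) Z i w)).

Definition ntr (R : realType) (N : nat) (A : 'M[R[i]]_N) : R[i] := (N%:R)^-1 * \tr A.

Definition entry_rv (R : realType) (T I : Type) (N : nat) (Y : I -> T -> 'M[R[i]]_N)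
  (e : I * 'I_N * 'I_N * bool) : T -> R :=
  fun w => let: (i, a, b, re) := e in
           if re then complex.Re (Y i w a b) else complex.Im (Y i w a b).

Definition rect_event (R : realType) (T J : Type) (f : J -> T -> R) (A : J -> set R)
  : set T := \bigcap_(e : J) (f e @^-1` A e).

(* two finite families of real random variables have the same joint law
   (equality on the generating pi-system of measurable rectangles) *)
Definition same_law (R : realType) d (T : measurableType d) (P : probability T R)
  (J : Type) (f g : J -> T -> R) : Prop :=
  forall A : J -> set R, (forall e, measurable (A e)) ->
    P (rect_event f A) = P (rect_event g A).

Definition orth_invariant (R : realType) d (T : measurableType d) (P : probability T R)
  (N m : nat) (Y : 'I_m -> T -> 'M[R[i]]_N) : Prop :=
  forall O : 'M[R]_N, O *m O^T = 1%:M ->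
    let Oc := map_mx (fun x : R => Complex x 0) O in
    same_law P (entry_rv (fun i w => Oc *m Y i w *m Oc^T)) (entry_rv Y).

Definition indep_families (R : realType) d (T : measurableType d) (P : probability T R)
  (s : nat) (J : 'I_s -> Type) (F : forall j, J j -> T -> R) : Prop :=
  forall A : forall j, J j -> set R, (forall j e, measurable (A j e)) ->
    P (\bigcap_(j : 'I_s) rect_event (F j) (A j)) =
    (\prod_(j < s) P (rect_event (F j) (A j)))%E.

Definition is_lin (R : realType) (V : Type) (f : ncpoly R V -> R[i]) : Prop :=
  (forall a b, f (NCadd a b) = f a + f b) /\
  (forall c a, f (NCmul (NCconst c) a) = c * f a).

Definition TrRV (R : realType) (T W : Type) (N : nat) (Y : W -> T -> 'M[R[i]]_N)
  (p : ncpoly R W) : T -> R[i] := fun w => \tr (ncev (fun v => Y v w) p).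

Definition trRV (R : realType) (T W : Type) (N : nat) (Y : W -> T -> 'M[R[i]]_N)
  (p : ncpoly R W) : T -> R[i] := fun w => ntr (ncev (fun v => Y v w) p).

Definition propP1 (R : realType) d (T : measurableType d) (P : probability T R)
  (W : Type) (Y : forall N : nat, W -> T -> 'M[R[i]]_N) : Prop :=
  exists tau tau' : ncpoly R W -> R[i], is_lin tau /\ is_lin tau' /\
    forall p, cvgC (fun N => N%:R * (EC P (trRV (Y N) p) - tau p - (N%:R)^-1 * tau' p)) 0.

Definition propP2 (R : realType) d (T : measurableType d) (P : probability T R)
  (W : Type) (Y : forall N : nat, W -> T -> 'M[R[i]]_N) : Prop :=
  forall ps : 'I_2 -> ncpoly R W,
    exists l, cvgC (fun N => cumulant P (fun i => TrRV (Y N) (ps i))) l.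

Definition propP3 (R : realType) d (T : measurableType d) (P : probability T R)
  (W : Type) (Y : forall N : nat, W -> T -> 'M[R[i]]_N) : Prop :=
  forall r : nat, (3 <= r)%N -> forall ps : 'I_r -> ncpoly R W,
    cvgC (fun N => (N%:R) ^+ (r - 3)%N * cumulant P (fun i => TrRV (Y N) (ps i))) 0.

Definition real_inf_space (R : realType) (V : Type) (tau tau' : ncpoly R V -> R[i]) : Prop :=
  is_lin tau /\ tau (NCconst 1) = 1 /\ (forall a, tau (nct a) = tau a) /\
  is_lin tau' /\ tau' (NCconst 1) = 0.

(* the subalgebras (inB j), j < s, are real infinitesimally free; the
   elements a_1, ..., a_n are indexed from 1 as in the paper *)
Definition real_inf_free (R : realType) (V : Type) (tau tau' : ncpoly R V -> R[i])
  (s : nat) (inB : 'I_s -> ncpoly R V -> Prop) : Prop :=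
  forall (n : nat) (a : nat -> ncpoly R V) (j : nat -> 'I_s),
    (1 <= n)%N ->
    (forall i, (1 <= i <= n)%N -> inB (j i) (a i)) ->
    (forall i, (1 <= i <= n)%N -> tau (a i) = 0) ->
    (forall i, (1 <= i < n)%N -> j i != j i.+1) ->
    [/\ tau (ncprodr a 1%N n) = 0,
        n = 2%N -> tau' (NCmul (a 1%N) (a 2%N)) = 0,
        forall k, n = (2 * k)%N.-1 -> (3 <= n)%N ->
          tau' (ncprodr a 1%N n) =
          tau (NCmul (a 1%N) (a n)) * tau' (ncprodr a 2%N n.-1) +
          tau (ncprod [:: a 1%N; nct (a k); a n]) *
            \prod_(2%N <= i < k) tau (NCmul (a i) (nct (a (i + k - 1)%N)))
      & forall k, n = (2 * k)%N -> (4 <= n)%N ->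
          tau' (ncprodr a 1%N n) =
          tau (NCmul (a 1%N) (a n)) * tau' (ncprodr a 2%N n.-1) +
          \prod_(1%N <= i < k.+1) tau (NCmul (a i) (nct (a (i + k)%N)))].

(* Main.v *)
Require Import Defs.
From HB Require Import structures.
From mathcomp Require Import all_boot all_order all_algebra.
From mathcomp Require Import all_classical all_reals all_analysis.
From mathcomp Require Import finmap measurable_realfun complex.
From mathcomp Require Import ring lra zify.
Set Implicit Arguments. Unset Strict Implicit. Unset Printing Implicit Defensive.
Import Order.TTheory GRing.Theory Num.Theory.
Import numFieldNormedType.Exports.
Local Open Scope ring_scope.
Local Open Scope classical_set_scope.

(** Invariance of an independent family under an infinitesimal rotation in the plane (a, b), applied
    to the (a, b) entry of a word times a product of traces and summed over a and b, gives an exact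
    loop equation.  In normalized traces it expresses the expectation of a word through products of
    two shorter words, a term of order 1/N containing transposes, and terms of order 1/N^2.  For a
    fixed total length these equations form a linear system that is triangular up to O(1/N).  Hence
    all mixed moments are bounded, then multiplicative up to o(1/N), and then have a first-order
    expansion; for words in a single family this is (P1)-(P3).

    In the limit, tau annihilates the free difference quotient in the variables of each family
    under l (x) r |-> tau(l) tau(r), and the next order is the same statement for
    tau'(l) tau(r) + tau(l) tau'(r) - tau(l r^t).  On a cyclically alternating product of centred
    elements the only surviving terms are tau(a_1 ... a_i a_n^t ... a_(i+1)^t); by freeness these
    vanish unless n = 2i, which is where the products of tau(a_i a_(i+k)^t) come from.  If a_1 and
    a_n lie in the same subalgebra, a_n a_1 is first merged and centred. *)

(** * Moments from joint laws on rectangles *)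

(** The hypotheses give laws only on measurable rectangles, whereas invariance is used on
    polynomials in the entries; hence the passage from rectangle probabilities to moments. Only
    plane rotations enter, never Haar measure, and independence is what allows one family to be
    rotated while the others stay fixed.

    A loop equation determines a mixed moment only if the uncut word survives in it. A cyclic shift
    arranges this by making the word start in the invariant family and end outside it: at leading
    order the uncut word then appears once, with coefficient 1. Every other leading term has one
    word more, and with the total length fixed the number of words cannot grow forever. The terms of
    order 1/N and 1/N^2 do not increase the number of words, so this induction alone does not close;
    boundedness comes from the whole finite system at once. After that, each pass of the induction
    may use, for terms with a factor 1/N, what the previous pass proved one order lower; two passes
    reach precision o(1/N). *)

Lemma normrD_exp_le (R : realDomainType) (x y : R) n :
  `|x + y| ^+ n <= 2 ^+ n * (`|x| ^+ n + `|y| ^+ n).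
Proof.
wlog xy : x y / `|x| <= `|y|.
  move=> H; have [|/ltW] := leP `|x| `|y|; first exact: H.
  by move=> /H; rewrite addrC [in leRHS]addrC.
apply: (@le_trans _ _ ((2 * `|y|) ^+ n)).
  rewrite lerXn2r ?nnegrE ?mulr_ge0 ?addr_ge0// (le_trans (ler_normD _ _))//.
  by rewrite mulr_natl mulr2n lerD2r.
by rewrite exprMn ler_wpM2l ?exprn_ge0// lerDr exprn_ge0.
Qed.

Section all_moments.
Import HBSimple HBNNSimple.
Context {R : realType} {d : measure_display} {T : measurableType d}.
Variable P : probability T R.
Implicit Types f g u : T -> R.

(** This class is closed under products, so integrability need not be checked anew for each
    polynomial in the entries. *)
Definition all_moments f :=
  measurable_fun setT f /\ forall n, P.-integrable setT (fun w => (`|f w| ^+ n)%:E).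

Lemma all_moments_le f g : measurable_fun setT f ->
  (forall w, `|f w| <= `|g w|) -> all_moments g -> all_moments f.
Proof.
move=> mf fg [mg ig]; split=> // n.
apply: le_integrable (ig n) => //.
  by apply/measurable_EFinP; apply: measurable_funX; apply: measurableT_comp.
by move=> w _ /=; rewrite lee_fin !normrX !normr_id lerXn2r ?nnegrE.
Qed.

Lemma all_moments_integrable f : all_moments f -> P.-integrable setT (EFin \o f).
Proof.
move=> [mf /(_ 1%N)]; apply: le_integrable => //; first exact/measurable_EFinP.
by move=> w _ /=; rewrite expr1 normr_id.
Qed.

Lemma all_moments_cst c : all_moments (cst c).
Proof.
split; first exact: measurable_cst.
by move=> n; apply: (@finite_measure_integrable_cst _ _ _ P _ (`|c| ^+ n)).
Qed.

Lemma all_moments_add f g : all_moments f -> all_moments g -> all_moments (f \+ g).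
Proof.
move=> [mf if_] [mg ig]; split=> [|n]; first exact: measurable_funD.
have := integrableZl (measurableT : measurable setT) (2 ^+ n)
  (integrableD (measurableT : measurable setT) (if_ n) (ig n)).
apply: le_integrable => //.
  apply/measurable_EFinP; apply: measurable_funX; apply: measurableT_comp => //.
  exact: measurable_funD.
move=> w _ /=; rewrite lee_fin [leRHS]ger0_norm; last first.
  by rewrite mulr_ge0 ?exprn_ge0// addr_ge0 ?exprn_ge0.
rewrite ger0_norm ?exprn_ge0//.
exact: normrD_exp_le.
Qed.

Lemma all_moments_mul f g : all_moments f -> all_moments g -> all_moments (f \* g).
Proof.
move=> [mf if_] [mg ig]; split=> [|n]; first exact: measurable_funM.
have := integrableD (measurableT : measurable setT) (if_ (n * 2)%N) (ig (n * 2)%N).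
apply: le_integrable => //.
  apply/measurable_EFinP; apply: measurable_funX; apply: measurableT_comp => //.
  exact: measurable_funM.
move=> w _ /=; rewrite lee_fin ger0_norm ?exprn_ge0// [leRHS]ger0_norm; last first.
  by rewrite addr_ge0 ?exprn_ge0.
rewrite normrM exprMn !exprM.
have := sqr_ge0 (`|f w| ^+ n - `|g w| ^+ n).
have : 0 <= `|f w| ^+ n by [].
have : 0 <= `|g w| ^+ n by [].
by nra.
Qed.

Lemma all_moments_prod (I : Type) (r : seq I) (p : pred I) (F : I -> T -> R) :
  (forall i, all_moments (F i)) ->
  all_moments (fun w => \prod_(i <- r | p i) F i w).
Proof.
move=> H; rewrite (_ : (fun w => _) = \big[(fun f g => f \* g)/cst 1]_(i <- r | p i) F i).
  elim/big_ind : _ => //; [exact: all_moments_cst|exact: all_moments_mul].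
apply/funext => w; elim/big_rec2 : _ => // i y1 y2 _ -> //.
Qed.

Lemma all_moments_exp f n : all_moments f -> all_moments (fun w => f w ^+ n).
Proof.
move=> mf; elim: n => [|n ih].
  rewrite (_ : (fun w => _) = cst 1); first exact: all_moments_cst.
  by apply/funext => w; rewrite expr0.
rewrite (_ : (fun w => _) = f \* (fun w => f w ^+ n)); first exact: all_moments_mul.
by apply/funext => w /=; rewrite exprS.
Qed.

Lemma all_moments_indic f (A : set R) : measurable_fun setT f -> measurable A ->
  all_moments (fun w => \1_A (f w)).
Proof.
move=> mf mA; apply: (@all_moments_le _ (cst 1)); last exact: all_moments_cst.
  by apply: (measurableT_comp (f := \1_A : R -> R)).
by move=> w /=; rewrite /indic; case: (_ \in _); rewrite ?normr1// normr0.
Qed.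

Definition Er f : R := fine 'E_P[f].

Lemma ErE f : Er f = (\int[P]_w f w)%R.
Proof. by rewrite /Er unlock. Qed.

Lemma Er_cst c : Er (cst c) = c.
Proof. by rewrite /Er expectation_cst. Qed.

Lemma Er_add f g : all_moments f -> all_moments g -> Er (f \+ g) = Er f + Er g.
Proof.
by move=> mf mg; rewrite !ErE -RintegralD//; exact: all_moments_integrable.
Qed.

Lemma Er_scale c f : all_moments f -> Er (fun w => c * f w) = c * Er f.
Proof.
by move=> mf; rewrite !ErE RintegralZl//; exact: all_moments_integrable.
Qed.

Lemma Er_scaler c f : all_moments f -> Er (fun w => f w * c) = Er f * c.
Proof.
move=> mf; rewrite mulrC -Er_scale//; congr (Er _); apply/funext => w.
exact: mulrC.
Qed.

Lemma Er_sum (I : Type) (r : seq I) (p : pred I) (F : I -> T -> R) :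
  (forall i, all_moments (F i)) ->
  all_moments (fun w => \sum_(i <- r | p i) F i w) /\
  Er (fun w => \sum_(i <- r | p i) F i w) = \sum_(i <- r | p i) Er (F i).
Proof.
move=> H; elim: r => [|x r [ih1 ih2]].
  have -> : (fun w => \sum_(i <- [::] | p i) F i w) = cst 0.
    by apply/funext => w; rewrite big_nil.
  by rewrite big_nil; split; [exact: all_moments_cst|exact: Er_cst].
rewrite big_cons; case: ifP => px; last first.
  by under eq_fun do rewrite big_cons px.
under eq_fun do rewrite big_cons px.
by split; [exact: all_moments_add|rewrite Er_add// ih2].
Qed.

Lemma Er_indic (A : set T) : measurable A -> Er (\1_A) = fine (P A).
Proof. by move=> mA; rewrite /Er expectation_indic. Qed.

Lemma Er_sfun f u (h : {sfun R >-> R}) : all_moments f -> all_moments u ->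
  Er (fun w => h (f w) * u w) =
  \sum_(x <- fset_set (range h)) x * Er (fun w => \1_(h @^-1` [set x]) (f w) * u w).
Proof.
move=> mf mu.
have mi x : all_moments (fun w => \1_(h @^-1` [set x]) (f w) * u w).
  by apply: all_moments_mul => //; apply: all_moments_indic => //; case: mf.
rewrite (_ : (fun w => _) = (fun w => \sum_(x <- fset_set (range h))
   x * (\1_(h @^-1` [set x]) (f w) * u w))); last first.
  apply/funext => w; rewrite (fimfunE h) fsbig_finite//= big_distrl/=.
  by apply: eq_bigr => x _; rewrite mulrA.
have [|_ ->] := @Er_sum _ (fset_set (range h)) xpredT
    (fun x w => x * (\1_(h @^-1` [set x]) (f w) * u w)).
  by move=> x; apply: (@all_moments_mul (cst x)) => //; exact: all_moments_cst.
by apply: eq_bigr => x _; rewrite Er_scale.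
Qed.

(* The non-negative function is approximated from below by simple functions, and the limit is
   taken by dominated convergence. *)
Lemma Er_transfer_ge0 f g u v (h : R -> R) : measurable_fun setT h ->
  (forall x, 0 <= h x) ->
  all_moments f -> all_moments g -> all_moments u -> all_moments v ->
  all_moments (h \o f) -> all_moments (h \o g) ->
  (forall A, measurable A ->
     Er (fun w => \1_A (f w) * u w) = Er (fun w => \1_A (g w) * v w)) ->
  Er (fun w => h (f w) * u w) = Er (fun w => h (g w) * v w).
Proof.
move=> mh h0 mf mg mu mv mhf mhg H.
have meh : measurable_fun setT (EFin \o h) by exact/measurable_EFinP.
have h0E x : setT x -> (0%:E <= (EFin \o h) x)%E by move=> _; rewrite /= lee_fin.
have [s [nds cvs]] := approximation (measurableT : measurable [set: R]) meh h0E.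
have cvs' x : (fun n => (s n x : R)) @ \oo --> h x.
  by have /fine_cvgP[_] := cvs x Logic.I.
have sle n x : s n x <= h x.
  have cs : cvgn (fun n => s n x) by apply/cvg_ex; exists (h x).
  have nd : nondecreasing_seq (fun n => s n x).
    by move=> a b ab; have /lefP/(_ x) := nds _ _ ab.
  by have := nondecreasing_cvgn_le nd cs n; rewrite (cvg_lim _ (cvs' x)).
have key f0 u0 : all_moments f0 -> all_moments u0 -> all_moments (h \o f0) ->
    (\int[P]_w (s n (f0 w) * u0 w)%:E)%E @[n --> \oo] --> (\int[P]_w (h (f0 w) * u0 w)%:E)%E.
  move=> m1 m2 m3.
  have mhu : all_moments (fun w => h (f0 w) * u0 w) by exact: (all_moments_mul m3 m2).
  apply: (@dominated_cvg _ _ _ P setT measurableT _ _ (fun w => (`|h (f0 w) * u0 w|)%:E)) => //.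
  - move=> n; apply/measurable_EFinP; apply: measurable_funM; last by case: m2.
    by apply: measurableT_comp => //; case: m1.
  - move=> w _; apply: cvg_EFin; first by near=> n.
    by apply: cvgM; [exact: cvs'|exact: cvg_cst].
  - by have := mhu.2 1%N; under eq_fun do rewrite expr1.
  - move=> n w _ /=; rewrite lee_fin !normrM ler_wpM2r//.
    by rewrite !ger0_norm//; exact: fun_ge0.
have c1 := key _ _ mf mu mhf; have c2 := key _ _ mg mv mhg.
rewrite !ErE /Rintegral; congr fine.
apply: (cvg_unique _ c1) => //; move: c2; apply: cvg_trans.
apply: near_eq_cvg; near=> n.
have ifin f0 u0 : all_moments f0 -> all_moments u0 -> all_moments (h \o f0) ->
   (\int[P]_w (s n (f0 w) * u0 w)%:E)%E = (Er (fun w => s n (f0 w) * u0 w))%:E.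
  move=> m1 m2 m3; rewrite ErE /Rintegral fineK//.
  apply: integrable_fin_num => //; apply: all_moments_integrable.
  apply: all_moments_mul => //; apply: all_moments_le m3.
    by apply: measurableT_comp => //; case: m1.
  by move=> w /=; rewrite !ger0_norm//; exact: fun_ge0.
rewrite !ifin// !Er_sfun//; congr EFin; apply: eq_bigr => x _; rewrite H//.
Unshelve. all: by end_near.
Qed.

(** Simple functions approximate only non-negative functions from below, and [x ^+ n] changes sign
    for odd n; hence the positive and negative parts [hp] and [hn]. *)
Lemma Er_transfer_exp f g u v n :
  all_moments f -> all_moments g -> all_moments u -> all_moments v ->
  (forall A, measurable A ->
     Er (fun w => \1_A (f w) * u w) = Er (fun w => \1_A (g w) * v w)) ->
  Er (fun w => f w ^+ n * u w) = Er (fun w => g w ^+ n * v w).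
Proof.
move=> mf mg mu mv H.
pose hp (x : R) := Num.max (x ^+ n) 0; pose hn (x : R) := Num.max (- x ^+ n) 0.
have mX : measurable_fun setT (fun x : R => x ^+ n) by exact: measurable_funX.
have mhp : measurable_fun setT hp by apply: measurable_maxr.
have mhn : measurable_fun setT hn.
  by apply: measurable_maxr => //; exact: measurableT_comp.
have ap (h : R -> R) f0 : measurable_fun setT h -> (forall x, `|h x| <= `|x ^+ n|) ->
    all_moments f0 -> all_moments (h \o f0).
  move=> mh hle m0; apply: all_moments_le (all_moments_exp n m0).
    by apply: measurableT_comp => //; case: m0.
  by move=> w; exact: hle.
have lep x : `|hp x| <= `|x ^+ n|.
  by rewrite /hp; case: (leP (x ^+ n) 0) => ?; rewrite ?normr0.
have len x : `|hn x| <= `|x ^+ n|.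
  by rewrite /hn; case: (leP (- x ^+ n) 0) => ?; rewrite ?normr0// normrN.
have E0 f0 u0 : all_moments f0 -> all_moments u0 ->
    Er (fun w => f0 w ^+ n * u0 w) =
    Er (fun w => hp (f0 w) * u0 w) + (-1) * Er (fun w => hn (f0 w) * u0 w).
  move=> m1 m2.
  have a1 := all_moments_mul (ap _ _ mhp lep m1) m2.
  have a2 := all_moments_mul (ap _ _ mhn len m1) m2.
  rewrite -Er_scale// -Er_add//; last by apply: (@all_moments_mul (cst (-1))) => //; exact: all_moments_cst.
  congr (Er _); apply/funext => w /=; rewrite mulrA -mulrDl; congr (_ * _).
  rewrite /hp /hn; set y := f0 w ^+ n.
  by case: (leP y 0) => ?; case: (leP (- y) 0) => ?; lra.
rewrite !E0//; congr (_ + _ * _); apply: Er_transfer_ge0 => //.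
- by move=> x; rewrite /hp le_max lexx orbT.
- exact: ap.
- exact: ap.
- by move=> x; rewrite /hn le_max lexx orbT.
- exact: ap.
- exact: ap.
Qed.

(** Indicators become powers one coordinate at a time, all other coordinates being absorbed into the
    weights. Two different weights [u] and [v] are allowed because independence compares a random
    factor with a constant. *)
Lemma Er_transfer_prod (J : finType) (f g : J -> T -> R) (u v : T -> R) (n : J -> nat) :
  (forall e, all_moments (f e)) -> (forall e, all_moments (g e)) ->
  all_moments u -> all_moments v ->
  (forall A : J -> set R, (forall e, measurable (A e)) ->
    Er (fun w => (\prod_e \1_(A e) (f e w)) * u w) =
    Er (fun w => (\prod_e \1_(A e) (g e w)) * v w)) ->
  Er (fun w => (\prod_e f e w ^+ n e) * u w) = Er (fun w => (\prod_e g e w ^+ n e) * v w).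
Proof.
move=> mf mg mu mv H.
pose h (r : seq J) (A : J -> set R) e (x : R) := if e \in r then x ^+ n e else \1_(A e) x.
have mh r A e f0 : (forall e, measurable (A e)) -> all_moments f0 ->
    all_moments (fun w => h r A e (f0 w)).
  move=> mA m0; rewrite /h; case: (e \in r); first exact: all_moments_exp.
  by apply: all_moments_indic => //; case: m0.
suff key r : forall A, (forall e, measurable (A e)) ->
    Er (fun w => (\prod_e h r A e (f e w)) * u w) =
    Er (fun w => (\prod_e h r A e (g e w)) * v w).
  have := key (enum J) (fun=> setT) (fun=> measurableT).
  have E k z : (fun w => (\prod_e h (enum J) (fun=> setT) e (k e w)) * z w) =
      (fun w => (\prod_e k e w ^+ n e) * z w).
    by apply/funext => w; congr (_ * _); apply: eq_bigr => e _; rewrite /h mem_enum inE.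
  by rewrite !E.
elim: r => [|e0 r ih] A mA.
  have E k z : (fun w => (\prod_e h [::] A e (k e w)) * z w) =
      (fun w => (\prod_e \1_(A e) (k e w)) * z w).
    by apply/funext => w; congr (_ * _); apply: eq_bigr => e _; rewrite /h in_nil.
  by rewrite !E; exact: H.
have [er|ner] := boolP (e0 \in r).
  have E k z : (fun w => (\prod_e h (e0 :: r) A e (k e w)) * z w) =
      (fun w => (\prod_e h r A e (k e w)) * z w).
    apply/funext => w; congr (_ * _); apply: eq_bigr => e _.
    by rewrite /h inE; case: eqP => // ->; rewrite er.
  by rewrite !E; exact: ih.
(* Only B = A is used below; the second disjunct disposes of every other B. *)
have E (k : J -> T -> R) (z : T -> R) B : 
    (fun w => (\prod_e h (e0 :: r) B e (k e w)) * z w) =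
    (fun w => k e0 w ^+ n e0 * ((\prod_(e | e != e0) h r A e (k e w)) * z w)) \/ B <> A.
  have [->|] := pselect (B = A); [left|by right].
  apply/funext => w; rewrite (bigD1 e0)//= mulrA; congr (_ * _ * _).
    by rewrite /h inE eqxx.
  by apply: eq_bigr => e /negbTE ne; rewrite /h inE ne.
have [->|//] := E f u A; have [->|//] := E g v A.
apply: Er_transfer_exp => //.
- by apply: all_moments_mul => //; apply: all_moments_prod => e; exact: mh.
- by apply: all_moments_mul => //; apply: all_moments_prod => e; exact: mh.
move=> B mB.
(* As [e0] is not in [r], its factor is still an indicator, so its set can be changed to the
   arbitrary B of the transfer lemma. *)
have := ih (fun e => if e == e0 then B else A e).
have E2 (k : J -> T -> R) (z : T -> R) :
  (fun w => (\prod_e h r (fun e => if e == e0 then B else A e) e (k e w)) * z w) =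
  (fun w => \1_B (k e0 w) * ((\prod_(e | e != e0) h r A e (k e w)) * z w)).
  apply/funext => w; rewrite (bigD1 e0)//= mulrA; congr (_ * _ * _).
    by rewrite /h (negbTE ner) eqxx.
  by apply: eq_bigr => e /negbTE ne; rewrite /h ne.
rewrite !E2; apply=> e; by case: ifP.
Qed.

Lemma Er_rect (J : finType) (f : J -> T -> R) (A : J -> set R) :
  (forall e, measurable_fun setT (f e)) -> (forall e, measurable (A e)) ->
  measurable (rect_event f A) /\
  Er (fun w => \prod_e \1_(A e) (f e w)) = fine (P (rect_event f A)).
Proof.
move=> mf mA.
have mr : measurable (rect_event f A).
  rewrite /rect_event; apply: fin_bigcap_measurable => [|e _].
    exact: finite_finset.
  by rewrite -[X in measurable X]setTI; exact: mf.
split=> //; rewrite -Er_indic//; congr (Er _); apply/funext => w.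
rewrite /indic; case: (boolP (w \in rect_event f A)) => [/set_mem H|H].
  rewrite big1// => e _; rewrite mem_set//; exact: (H e).
have /existsP[e He] : [exists e, f e w \notin A e].
  apply: contraNT H => /existsPn H; apply/mem_set => e _.
  by have := H e; rewrite negbK => /set_mem.
by rewrite (bigD1 e)//= (negbTE He) mul0r.
Qed.

Lemma same_law_moments (J : finType) (f g : J -> T -> R) (n : J -> nat) :
  (forall e, all_moments (f e)) -> (forall e, all_moments (g e)) ->
  same_law P f g ->
  Er (fun w => \prod_e f e w ^+ n e) = Er (fun w => \prod_e g e w ^+ n e).
Proof.
move=> mf mg H.
have := @Er_transfer_prod J f g (cst 1) (cst 1) n mf mg (all_moments_cst 1) (all_moments_cst 1).
have E (k : T -> R) : (fun w => k w * (cst 1 : T -> R) w) = k.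
  by apply/funext => w /=; rewrite mulr1.
rewrite !E; apply=> A mA; rewrite !E.
by rewrite (Er_rect _ mA).2 ?(Er_rect _ mA).2 ?H// => e; [case: (mg e)|case: (mf e)].
Qed.

(** For indicators this is the definition. Block [j0] is then turned into powers by
    [Er_transfer_prod] with [F j0] on both sides: the weight is the product of the other blocks on
    the left and the constant product of their expectations on the right. *)
Lemma indep_moments (s : nat) (J : 'I_s -> finType) (F : forall j, J j -> T -> R)
    (n : forall j, J j -> nat) :
  (forall j e, all_moments (F j e)) -> indep_families P F ->
  Er (fun w => \prod_j \prod_e F j e w ^+ n j e) =
  \prod_j Er (fun w => \prod_e F j e w ^+ n j e).
Proof.
move=> mF ind.
pose h (r : seq 'I_s) (A : forall j, J j -> set R) j w :=
  if j \in r then \prod_e F j e w ^+ n j e else \prod_e \1_(A j e) (F j e w).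
have mh r A j : (forall j e, measurable (A j e)) -> all_moments (h r A j).
  move=> mA; rewrite /h; case: (j \in r); apply: all_moments_prod => e.
    exact: all_moments_exp.
  by apply: all_moments_indic => //; case: (mF j e).
suff key r : forall A, (forall j e, measurable (A j e)) ->
    Er (fun w => \prod_j h r A j w) = \prod_j Er (h r A j).
  have := key (enum 'I_s) (fun=> fun=> setT) (fun=> fun=> measurableT).
  have E j : h (enum 'I_s) (fun=> fun=> setT) j = (fun w => \prod_e F j e w ^+ n j e).
    by apply/funext => w; rewrite /h mem_enum inE.
  under eq_fun do (under eq_bigr do rewrite E).
  by under [in X in _ = X -> _]eq_bigr do rewrite E.
elim: r => [|j0 r ih] A mA.
  have hE j : h [::] A j = fun w => \prod_e \1_(A j e) (F j e w).
    by apply/funext => w; rewrite /h in_nil.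
  under [RHS]eq_bigr => j _.
    rewrite hE (Er_rect _ (mA j)).2; last by move=> e; case: (mF j e).
    over.
  have mrect j : measurable (rect_event (F j) (A j)).
    by apply: (Er_rect _ (mA j)).1 => e; case: (mF j e).
  transitivity (fine (P (\bigcap_(j : 'I_s) rect_event (F j) (A j)))).
    rewrite -Er_indic//; last by apply: fin_bigcap_measurable => //; exact: finite_finset.
    congr (Er _); apply/funext => w; rewrite /indic.
    under eq_bigr do rewrite hE.
    case: (boolP (w \in _)) => [/set_mem H|H].
      rewrite big1// => j _; rewrite big1// => e _; rewrite /indic mem_set//.
      exact: (H j Logic.I e Logic.I).
    have /existsP[j Hj] : [exists j, w \notin rect_event (F j) (A j)].
      apply: contraNT H => /existsPn H; apply/mem_set => j _.
      by have := H j; rewrite negbK => /set_mem.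
    have /existsP[e He] : [exists e, F j e w \notin A j e].
      apply: contraNT Hj => /existsPn Hj; apply/mem_set => e _.
      by have := Hj e; rewrite negbK => /set_mem.
    by rewrite (bigD1 j)//= (bigD1 e)//= /indic (negbTE He) !mul0r.
  rewrite ind// (eq_bigr (fun j => (fine (P (rect_event (F j) (A j))))%:E)).
    by rewrite prodEFin.
  by move=> j _; rewrite fineK// fin_num_measure.
have [jr|njr] := boolP (j0 \in r).
  have E j : h (j0 :: r) A j = h r A j.
    by apply/funext => w; rewrite /h inE; case: eqP => // ->; rewrite jr.
  by have := ih A mA; under eq_fun do (under eq_bigr do rewrite -E);
    under [in X in _ = X -> _]eq_bigr do rewrite -E.
have E1 : (fun w => \prod_j h (j0 :: r) A j w) =
    (fun w => (\prod_e F j0 e w ^+ n j0 e) * \prod_(j | j != j0) h r A j w).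
  apply/funext => w; rewrite (bigD1 j0)//=; congr (_ * _).
    by rewrite /h inE eqxx.
  by apply: eq_bigr => j /negbTE nj; rewrite /h inE nj.
have E2 : \prod_j Er (h (j0 :: r) A j) =
    Er (fun w => (\prod_e F j0 e w ^+ n j0 e) * \prod_(j | j != j0) Er (h r A j)).
  rewrite (bigD1 j0)//= Er_scaler; last first.
    by apply: all_moments_prod => e; exact: all_moments_exp.
  congr (_ * _).
    by congr (Er _); apply/funext => w; rewrite /h inE eqxx.
  apply: eq_bigr => j /negbTE nj; congr (Er _); apply/funext => w.
  by rewrite /h inE nj.
rewrite E1 E2.
apply: (@Er_transfer_prod (J j0) _ _ _ (cst (\prod_(j | j != j0) Er (h r A j)))) => //.
- by apply: all_moments_prod => j; exact: mh.
- exact: all_moments_cst.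
move=> B mB.
(* Only the sets of block [j0] change; the index type depends on the block, hence [dfwith]. *)
pose AB := @dfwith 'I_s (fun j => J j -> set R) A j0 B.
have mB' j : forall e, measurable (AB j e) by rewrite /AB; case: dfwithP.
have := ih AB mB'.
have hE w j : j != j0 -> h r AB j w = h r A j w.
  by move=> nj; rewrite /h /AB dfwithout// eq_sym.
have hE0 w : h r AB j0 w = \prod_e \1_(B e) (F j0 e w).
  by rewrite /h (negbTE njr) /AB dfwithin.
under eq_fun do rewrite (bigD1 j0)//= hE0 (eq_bigr _ (hE _)).
move=> ->; rewrite (bigD1 j0)//= Er_scaler; last first.
  by apply: all_moments_prod => e; apply: all_moments_indic => //; case: (mF j0 e).
congr (_ * _).
  by congr (Er _); apply/funext => w; exact: hE0.
by apply: eq_bigr => j nj; congr (Er _); apply/funext => w; exact: hE.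
Qed.

End all_moments.

(** * Expectations of complex random variables *)

Lemma ReD (R : realType) (x y : R[i]) : complex.Re (x + y) = complex.Re x + complex.Re y.
Proof. by case: x; case: y. Qed.

Lemma ImD (R : realType) (x y : R[i]) : complex.Im (x + y) = complex.Im x + complex.Im y.
Proof. by case: x; case: y. Qed.

Lemma ReM (R : realType) (x y : R[i]) :
  complex.Re (x * y) = complex.Re x * complex.Re y - complex.Im x * complex.Im y.
Proof. by case: x; case: y. Qed.

Lemma ImM (R : realType) (x y : R[i]) :
  complex.Im (x * y) = complex.Re x * complex.Im y + complex.Im x * complex.Re y.
Proof. by case: x => a b; case: y => c e /=. Qed.

Section complex_expectation.
Context {R : realType} {d : measure_display} {T : measurableType d}.
Variable P : probability T R.
Local Notation C := R[i].
Implicit Types Z U : T -> C.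

Definition all_momentsC Z :=
  all_moments P (fun w => complex.Re (Z w)) /\ all_moments P (fun w => complex.Im (Z w)).

Lemma Linfm_all_momentsC Z : Linfm P Z -> all_momentsC Z.
Proof.
move=> [mr [mi H]].
have am : all_moments P (fun w => cmod (Z w)).
  split.
    rewrite /cmod; apply: (@measurableT_comp _ _ _ _ _ _ (@Num.sqrt R)).
      by apply: continuous_measurable_fun; exact: sqrt_continuous.
    by apply: measurable_funD; apply: measurable_funX.
  by move=> n; have := H n; under eq_fun do rewrite -[cmod _]ger0_norm ?sqrtr_ge0//.
split; apply: all_moments_le am => // w; rewrite /cmod [leRHS]ger0_norm ?sqrtr_ge0//.
  by rewrite -sqrtr_sqr ler_sqrt ?addr_ge0 ?sqr_ge0// lerDl sqr_ge0.
by rewrite -sqrtr_sqr ler_sqrt ?addr_ge0 ?sqr_ge0// lerDr sqr_ge0.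
Qed.

Lemma all_momentsC_cst c : all_momentsC (cst c).
Proof. by split; exact: all_moments_cst. Qed.

Lemma all_momentsC_real (f : T -> R) :
  all_moments P f -> all_momentsC (fun w => real_complex R (f w)).
Proof. by move=> mf; split=> //=; exact: all_moments_cst. Qed.

Lemma all_momentsC_add Z U : all_momentsC Z -> all_momentsC U ->
  all_momentsC (fun w => Z w + U w).
Proof.
move=> [z1 z2] [u1 u2]; split.
  by under eq_fun do rewrite ReD; exact: (all_moments_add z1 u1).
by under eq_fun do rewrite ImD; exact: (all_moments_add z2 u2).
Qed.

Lemma all_moments_opp f : all_moments P f -> all_moments P (fun w => - f w).
Proof.
move=> mf; rewrite (_ : (fun w => _) = (cst (-1) \* f)).
  by apply: all_moments_mul => //; exact: all_moments_cst.
by apply/funext => w /=; rewrite mulN1r.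
Qed.

Lemma all_momentsC_mul Z U : all_momentsC Z -> all_momentsC U ->
  all_momentsC (fun w => Z w * U w).
Proof.
move=> [z1 z2] [u1 u2]; split.
  under eq_fun do rewrite ReM.
  apply: (all_moments_add (all_moments_mul z1 u1)).
  exact/all_moments_opp/(all_moments_mul z2 u2).
under eq_fun do rewrite ImM.
exact: (all_moments_add (all_moments_mul z1 u2) (all_moments_mul z2 u1)).
Qed.

Lemma all_momentsC_sum (I : Type) (r : seq I) (p : pred I) (F : I -> T -> C) :
  (forall i, all_momentsC (F i)) ->
  all_momentsC (fun w => \sum_(i <- r | p i) F i w).
Proof.
move=> H; elim: r => [|x r ih].
  by under eq_fun do rewrite big_nil; exact: all_momentsC_cst.
case px : (p x); last by under eq_fun do rewrite big_cons px.
by under eq_fun do rewrite big_cons px; exact: all_momentsC_add.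
Qed.

Lemma all_momentsC_prod (I : Type) (r : seq I) (p : pred I) (F : I -> T -> C) :
  (forall i, all_momentsC (F i)) ->
  all_momentsC (fun w => \prod_(i <- r | p i) F i w).
Proof.
move=> H; elim: r => [|x r ih].
  by under eq_fun do rewrite big_nil; exact: all_momentsC_cst.
case px : (p x); last by under eq_fun do rewrite big_cons px.
by under eq_fun do rewrite big_cons px; exact: all_momentsC_mul.
Qed.

Lemma ECE Z : EC P Z =
  Complex (Er P (fun w => complex.Re (Z w))) (Er P (fun w => complex.Im (Z w))).
Proof. by []. Qed.

Lemma EC_cst c : EC P (fun=> c) = c.
Proof. by rewrite ECE !Er_cst; case: c. Qed.

Lemma EC_real (f : T -> R) : EC P (fun w => real_complex R (f w)) = real_complex R (Er P f).
Proof. by rewrite ECE /= Er_cst. Qed.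

Lemma EC_add Z U : all_momentsC Z -> all_momentsC U ->
  EC P (fun w => Z w + U w) = EC P Z + EC P U.
Proof.
move=> [z1 z2] [u1 u2]; rewrite !ECE.
have -> : Er P (fun w => complex.Re (Z w + U w)) =
    Er P (fun w => complex.Re (Z w)) + Er P (fun w => complex.Re (U w)).
  by rewrite -Er_add//; congr (Er _ _); apply/funext => w; rewrite ReD.
have -> // : Er P (fun w => complex.Im (Z w + U w)) =
    Er P (fun w => complex.Im (Z w)) + Er P (fun w => complex.Im (U w)).
by rewrite -Er_add//; congr (Er _ _); apply/funext => w; rewrite ImD.
Qed.

Lemma EC_scale c Z : all_momentsC Z -> EC P (fun w => c * Z w) = c * EC P Z.
Proof.
move=> [z1 z2]; rewrite !ECE; case: c => a b.
have sc e f : all_moments P f -> all_moments P (fun w => e * f w).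
  by move=> mf; apply: (@all_moments_mul _ _ _ P (cst e)) => //; exact: all_moments_cst.
apply/eqP; rewrite eq_complex; apply/andP; split; apply/eqP.
  rewrite [RHS]/= -mulNr -!Er_scale// -Er_add; [|exact: sc|exact: sc].
  by congr (Er _ _); apply/funext => w; rewrite ReM /= mulNr.
rewrite [RHS]/= -!Er_scale// -Er_add; [|exact: sc|exact: sc].
by congr (Er _ _); apply/funext => w; rewrite ImM.
Qed.

Lemma EC_opp Z : all_momentsC Z -> EC P (fun w => - Z w) = - EC P Z.
Proof.
move=> mZ; rewrite -mulN1r -EC_scale//; congr (EC _ _).
by apply/funext => w; rewrite mulN1r.
Qed.

Lemma EC_sum (I : Type) (r : seq I) (p : pred I) (F : I -> T -> C) :
  (forall i, all_momentsC (F i)) ->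
  EC P (fun w => \sum_(i <- r | p i) F i w) = \sum_(i <- r | p i) EC P (F i).
Proof.
move=> H; elim: r => [|x r ih].
  by rewrite big_nil -[RHS]EC_cst; congr (EC _ _); apply/funext => w; rewrite big_nil.
rewrite big_cons; case px : (p x); last by under eq_fun do rewrite big_cons px.
under eq_fun do rewrite big_cons px.
by rewrite EC_add ?ih//; exact: all_momentsC_sum.
Qed.

End complex_expectation.

(** * Polynomials in the entries *)

Section monomial_span.
Context {R : realType} {T : Type} {J : finType}.
Local Notation C := R[i].
Implicit Types (F G : J -> T -> R) (Z U : T -> C).

Definition monom F (n : J -> nat) (w : T) : C := real_complex R (\prod_e F e w ^+ n e).

(* The pair (Z, U) consists of the values of one polynomial on the families F and G. *)
Definition pspan F G Z U := exists s : seq (C * (J -> nat)),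
  Z = (fun w => \sum_(x <- s) x.1 * monom F x.2 w) /\
  U = (fun w => \sum_(x <- s) x.1 * monom G x.2 w).

Lemma pspan_monom F G n : pspan F G (monom F n) (monom G n).
Proof.
by exists [:: (1, n)]; split; apply/funext => w; rewrite big_seq1 mul1r.
Qed.

Lemma pspan_cst F G c : pspan F G (fun=> c) (fun=> c).
Proof.
exists [:: (c, fun=> 0%N)]; split; apply/funext => w;
  by rewrite big_seq1 /= /monom big1 ?mulr1// => e _; rewrite expr0.
Qed.

Lemma pspan_var F G e :
  pspan F G (fun w => real_complex R (F e w)) (fun w => real_complex R (G e w)).
Proof.
exists [:: (1, fun e' => nat_of_bool (e' == e))]; split; apply/funext => w;
  by rewrite big_seq1 /= mul1r /monom (bigD1 e)//= eqxx expr1 big1 ?mulr1// =>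
    e' /negbTE ->; rewrite expr0.
Qed.

Lemma pspan_add F G Z U Z' U' : pspan F G Z U -> pspan F G Z' U' ->
  pspan F G (fun w => Z w + Z' w) (fun w => U w + U' w).
Proof.
by move=> [s [-> ->]] [s' [-> ->]]; exists (s ++ s'); split; apply/funext => w;
  rewrite big_cat.
Qed.

Lemma pspan_mul F G Z U Z' U' : pspan F G Z U -> pspan F G Z' U' ->
  pspan F G (fun w => Z w * Z' w) (fun w => U w * U' w).
Proof.
move=> [s [-> ->]] [s' [-> ->]].
exists [seq (x.1 * y.1, fun e => (x.2 e + y.2 e)%N) | x <- s, y <- s'].
have E H w : (\sum_(x <- s) x.1 * monom H x.2 w) * (\sum_(x <- s') x.1 * monom H x.2 w) =
  \sum_(x <- [seq (x.1 * y.1, fun e => (x.2 e + y.2 e)%N) | x <- s, y <- s'])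
     x.1 * monom H x.2 w.
  rewrite big_allpairs_dep/= big_distrl/=; apply: eq_bigr => x _.
  rewrite big_distrr/=; apply: eq_bigr => y _.
  rewrite mulrACA; congr (_ * _); rewrite /monom -rmorphM -big_split/=.
  by congr (real_complex R _); apply: eq_bigr => e _; rewrite exprD.
by split; apply/funext => w; rewrite E.
Qed.

Lemma pspan_sum F G (I : Type) (r : seq I) (p : pred I) (Z U : I -> T -> C) :
  (forall i, pspan F G (Z i) (U i)) ->
  pspan F G (fun w => \sum_(i <- r | p i) Z i w) (fun w => \sum_(i <- r | p i) U i w).
Proof.
move=> H; elim: r => [|x r ih].
  under eq_fun do rewrite big_nil; under [in X in pspan _ _ _ X]eq_fun do rewrite big_nil.
  exact: pspan_cst.
have [px|px] := boolP (p x).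
  under eq_fun do rewrite big_cons px.
  under [in X in pspan _ _ _ X]eq_fun do rewrite big_cons px.
  exact: pspan_add.
under eq_fun do rewrite big_cons (negbTE px).
by under [in X in pspan _ _ _ X]eq_fun do rewrite big_cons (negbTE px).
Qed.

Lemma pspan_prod F G (I : Type) (r : seq I) (p : pred I) (Z U : I -> T -> C) :
  (forall i, p i -> pspan F G (Z i) (U i)) ->
  pspan F G (fun w => \prod_(i <- r | p i) Z i w) (fun w => \prod_(i <- r | p i) U i w).
Proof.
move=> H; elim: r => [|x r ih].
  under eq_fun do rewrite big_nil; under [in X in pspan _ _ _ X]eq_fun do rewrite big_nil.
  exact: pspan_cst.
have [px|px] := boolP (p x).
  under eq_fun do rewrite big_cons px.
  under [in X in pspan _ _ _ X]eq_fun do rewrite big_cons px.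
  by apply: pspan_mul => //; exact: H.
under eq_fun do rewrite big_cons (negbTE px).
by under [in X in pspan _ _ _ X]eq_fun do rewrite big_cons (negbTE px).
Qed.

End monomial_span.

Section polynomial_expectations.
Context {R : realType} {d : measure_display} {T : measurableType d}.
Variable P : probability T R.
Local Notation C := R[i].

Lemma all_momentsC_monom (J : finType) (F : J -> T -> R) n :
  (forall e, all_moments P (F e)) -> all_momentsC P (monom F n).
Proof.
move=> mF; apply: all_momentsC_real; apply: all_moments_prod => e.
exact: all_moments_exp.
Qed.

Lemma all_momentsC_pspan (J : finType) (F G : J -> T -> R) Z U :
  (forall e, all_moments P (F e)) -> pspan F G Z U -> all_momentsC P Z.
Proof.
move=> mF [s [-> _]]; apply: all_momentsC_sum => x.
apply: (@all_momentsC_mul _ _ _ P (cst x.1)); first exact: all_momentsC_cst.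
exact: all_momentsC_monom.
Qed.

Lemma EC_pspan (J : finType) (F G : J -> T -> R) Z U :
  (forall e, all_moments P (F e)) -> (forall e, all_moments P (G e)) ->
  (forall n, EC P (monom F n) = EC P (monom G n)) ->
  pspan F G Z U -> EC P Z = EC P U.
Proof.
move=> mF mG H [s [-> ->]].
have am (x : C * (J -> nat)) (K : J -> T -> R) : (forall e, all_moments P (K e)) ->
    all_momentsC P (fun w => x.1 * monom K x.2 w).
  move=> mK; apply: (@all_momentsC_mul _ _ _ P (cst x.1)); first exact: all_momentsC_cst.
  exact: all_momentsC_monom.
rewrite !EC_sum; [|by move=> i; exact: am..].
apply: eq_bigr => x _; rewrite !EC_scale ?H//; exact: all_momentsC_monom.
Qed.

(** The hypothesis on [Z j] says that it is a polynomial in the block [F j]. Both sides are linear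
    in each [Z j], so the blocks pass from monomials to polynomials one at a time. *)
Lemma EC_indep (s : nat) (J : 'I_s -> finType) (F : forall j, J j -> T -> R)
    (Z : 'I_s -> T -> C) :
  (forall j e, all_moments P (F j e)) -> indep_families P F ->
  (forall j, pspan (F j) (F j) (Z j) (Z j)) ->
  EC P (fun w => \prod_j Z j w) = \prod_j EC P (Z j).
Proof.
move=> mF ind sZ.
pose h (r : seq 'I_s) (n : forall j, J j -> nat) j : T -> C :=
  if j \in r then Z j else monom (F j) (n j).
have mh r n j : all_momentsC P (h r n j).
  rewrite /h; case: (j \in r); first exact: (all_momentsC_pspan (mF j) (sZ j)).
  exact: all_momentsC_monom.
suff key r : forall n, EC P (fun w => \prod_j h r n j w) = \prod_j EC P (h r n j).
  have := key (enum 'I_s) (fun=> fun=> 0%N).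
  have E j : h (enum 'I_s) (fun=> fun=> 0%N) j = Z j by rewrite /h mem_enum inE.
  under eq_fun do (under eq_bigr do rewrite E).
  by under [in X in _ = X -> _]eq_bigr do rewrite E.
elim: r => [|j0 r ih] n.
  have E j : h [::] n j = monom (F j) (n j) by rewrite /h in_nil.
  under eq_fun do (under eq_bigr do rewrite E).
  under [in RHS]eq_bigr do rewrite E.
  under [in RHS]eq_bigr do rewrite /monom EC_real.
  rewrite /monom; under eq_fun do rewrite -rmorph_prod.
  by rewrite EC_real indep_moments// rmorph_prod.
have [jr|njr] := boolP (j0 \in r).
  have E j : h (j0 :: r) n j = h r n j.
    by rewrite /h inE; case: eqP => // ->; rewrite jr.
  under eq_fun do (under eq_bigr do rewrite E).
  by under [in RHS]eq_bigr do rewrite E; exact: ih.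
have hE j : j != j0 -> h (j0 :: r) n j = h r n j by rewrite /h inE => /negbTE ->.
have hE0 : h (j0 :: r) n j0 = Z j0 by rewrite /h inE eqxx.
rewrite (bigD1 j0)//= hE0.
under [X in _ = _ * X]eq_bigr => j nj do rewrite hE//.
have [q [Zq _]] := sZ j0.
pose W w := \prod_(j | j != j0) h r n j w.
have mW : all_momentsC P W by apply: all_momentsC_prod.
have -> : (fun w => \prod_j h (j0 :: r) n j w) =
    (fun w => \sum_(x <- q) x.1 * (monom (F j0) x.2 w * W w)).
  apply/funext => w; rewrite (bigD1 j0)//= hE0 Zq big_distrl/=.
  apply: eq_bigr => x _; rewrite mulrA; congr (_ * _).
  by apply: eq_bigr => j nj; rewrite hE.
have mq (x : C * (J j0 -> nat)) : all_momentsC P (fun w => monom (F j0) x.2 w * W w).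
  by apply: all_momentsC_mul => //; exact: all_momentsC_monom.
have sc (c : C) U : all_momentsC P U -> all_momentsC P (fun w => c * U w).
  by move=> mU; apply: (@all_momentsC_mul _ _ _ P (cst c)) => //; exact: all_momentsC_cst.
rewrite EC_sum; last by move=> x; exact: sc.
rewrite Zq EC_sum; last by move=> x; apply: sc; exact: all_momentsC_monom.
rewrite big_distrl/=; apply: eq_bigr => x _.
rewrite !EC_scale//; last exact: all_momentsC_monom.
rewrite -mulrA; congr (_ * _).
pose n' := @dfwith 'I_s (fun j => J j -> nat) n j0 x.2.
have := ih n'; rewrite [in X in _ = X -> _](bigD1 j0)//=.
have E0 : h r n' j0 = monom (F j0) x.2.
  by rewrite /h (negbTE njr) /n' dfwithin.
have E1 j : j != j0 -> h r n' j = h r n j.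
  by move=> nj; rewrite /h /n' dfwithout// eq_sym.
rewrite E0; under [X in _ = _ * X -> _]eq_bigr => j nj do rewrite E1//.
move=> <-; congr (EC _ _); apply/funext => w; rewrite (bigD1 j0)//= E0; congr (_ * _).
by apply: eq_bigr => j nj; rewrite E1.
Qed.

Definition tagfam (s : nat) (J : 'I_s -> finType) (F : forall j, J j -> T -> R)
  (e : {j : 'I_s & J j}) := F (tag e) (tagged e).

(** Independence of the families [G j] is not established on events. Their entries are polynomials
    in [F j], so their mixed moments factor by [EC_indep] applied to F. *)
Lemma EC_pspan_same_law (s : nat) (J : 'I_s -> finType) (F G : forall j, J j -> T -> R) Z U :
  (forall j e, all_moments P (F j e)) -> indep_families P F ->
  (forall j, same_law P (G j) (F j)) ->
  (forall j e, let g w := real_complex R (G j e w) in pspan (F j) (F j) g g) ->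
  pspan (tagfam F) (tagfam G) Z U -> EC P Z = EC P U.
Proof.
move=> mF ind sl spG.
have mG j e : all_moments P (G j e) by have [] := all_momentsC_pspan (mF j) (spG j e).
apply: EC_pspan => [e|e|n]; [exact: mF|exact: mG|].
have E H : monom (tagfam H) n =
    (fun w => \prod_j monom (H j) (fun e => n (Tagged J e)) w).
  apply/funext => w; rewrite /monom -rmorph_prod; congr (real_complex R _).
  rewrite (sig_big_dep (fun=> true) (fun _ _ => true)
    (fun j e => H j e w ^+ n (Tagged J e)))/=.
  by apply: eq_bigr => -[j e] _.
have spm j m : pspan (F j) (F j) (monom (G j) m) (monom (G j) m).
  have -> : monom (G j) m = (fun w => \prod_e \prod_(i < m e) real_complex R (G j e w)).
    apply/funext => w; rewrite /monom rmorph_prod; apply: eq_bigr => e _.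
    by rewrite rmorphXn prodr_const card_ord.
  by apply: pspan_prod => e _; apply: pspan_prod => i _; exact: spG.
rewrite !E (EC_indep mF)//; last by move=> j; exact: pspan_monom.
rewrite (EC_indep mF)//; apply: eq_bigr => j _.
rewrite /monom !EC_real; congr (real_complex R _); apply/esym.
by apply: same_law_moments => //; exact: sl.
Qed.

End polynomial_expectations.

(** * Loop equations *)

Section cut.
Context {R : realType} {V : Type}.
Implicit Types (l p r : ncpoly R V) (Q : V -> bool).

(* Sum of g(l', x r') - g(l' x, r') over the factorizations l p r = l' x r' at the letters x of p
   selected by Q: the image under g of the free difference quotient of p in the variables of Q. *)
Fixpoint cut (A : zmodType) Q (g : ncpoly R V -> ncpoly R V -> A) l p r : A :=
  match p with
  | NCconst _ => 0
  | NCvar v => if Q v then g l (NCmul (NCvar v) r) - g (NCmul l (NCvar v)) r else 0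
  | NCvarT v => if Q v then g l (NCmul (NCvarT v) r) - g (NCmul l (NCvarT v)) r else 0
  | NCadd a b => cut Q g l a r + cut Q g l b r
  | NCmul a b => cut Q g l a (NCmul b r) + cut Q g (NCmul l a) b r
  end.

Lemma ncev_nct N (f : V -> 'M[R[i]]_N) p : ncev f (nct p) = (ncev f p)^T.
Proof.
elim: p => //= [c|v|a -> b ->|a -> b ->]; rewrite ?tr_scalar_mx ?trmxK//.
  by rewrite raddfD.
by rewrite trmx_mul.
Qed.

(** Derivative at 0 of the evaluation when the letters selected by Q are conjugated by exp(tH).
    Transposed letters obey the same commutator rule because the H of interest are antisymmetric. *)
Fixpoint ncder N Q (H : 'M[R[i]]_N) (f : V -> 'M[R[i]]_N) p : 'M[R[i]]_N :=
  match p with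
  | NCconst _ => 0
  | NCvar v => if Q v then H *m f v - f v *m H else 0
  | NCvarT v => if Q v then H *m (f v)^T - (f v)^T *m H else 0
  | NCadd a b => ncder Q H f a + ncder Q H f b
  | NCmul a b => ncder Q H f a *m ncev f b + ncev f a *m ncder Q H f b
  end.

(** By the Leibniz rule each selected letter x contributes H x - x H, that is, H inserted just
    before x minus H inserted just after it: these are the two terms of [cut]. The functionals
    [phi i] will read off an entry or a trace. *)
Lemma cut_ncder N Q (f : V -> 'M[R[i]]_N) (I : finType) (H : I -> 'M[R[i]]_N)
    (phi : I -> 'M[R[i]]_N -> R[i]) l p r :
  (forall i, {morph phi i : A B / A - B}) ->
  \sum_i phi i (ncev f l *m ncder Q (H i) f p *m ncev f r) =
  cut Q (fun l r => \sum_i phi i (ncev f l *m H i *m ncev f r)) l p r.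
Proof.
move=> phiB.
have phi0 i : phi i 0 = 0 by rewrite -[0 in LHS](subr0 0) phiB subrr.
have phiD i A B : phi i (A + B) = phi i A + phi i B.
  by rewrite -[B in LHS]opprK -[- B]sub0r !phiB phi0 sub0r opprK.
elim: p l r => [c|v|v|a iha b ihb|a iha b ihb] l r /=.
- by rewrite big1// => i _; rewrite mulmx0 mul0mx phi0.
- case: ifP => _; last by rewrite big1// => i _; rewrite mulmx0 mul0mx phi0.
  rewrite -sumrB; apply: eq_bigr => i _; rewrite -phiB; congr (phi i _).
  by rewrite mulmxBr mulmxBl !mulmxA.
- case: ifP => _; last by rewrite big1// => i _; rewrite mulmx0 mul0mx phi0.
  rewrite -sumrB; apply: eq_bigr => i _; rewrite -phiB; congr (phi i _).
  by rewrite mulmxBr mulmxBl !mulmxA.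
- rewrite -iha -ihb -big_split/=; apply: eq_bigr => i _.
  by rewrite -phiD; congr (phi i _); rewrite mulmxDr mulmxDl.
- rewrite -iha -ihb -big_split/=; apply: eq_bigr => i _.
  by rewrite -phiD; congr (phi i _); rewrite mulmxDr mulmxDl !mulmxA.
Qed.

Lemma eq_cut (A : zmodType) Q (g g' : ncpoly R V -> ncpoly R V -> A) l p r :
  (forall l r, g l r = g' l r) -> cut Q g l p r = cut Q g' l p r.
Proof.
move=> H; elim: p l r => //= [v|v|a iha b ihb|a iha b ihb] l r.
- by rewrite !H.
- by rewrite !H.
- by rewrite iha ihb.
- by rewrite iha ihb.
Qed.

End cut.

(** * Plane rotations and their generators *)

Section rotation_generators.
Context {R : realType} {N : nat}.
Local Notation C := R[i].

Definition rotgen (ab : 'I_N * 'I_N) : 'M[C]_N := delta_mx ab.1 ab.2 - delta_mx ab.2 ab.1.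

Lemma mul_delta_mx_entry (A B : 'M[C]_N) a b c e :
  (A *m delta_mx a b *m B) c e = A c a * B b e.
Proof.
rewrite mxE (bigD1 b)//= big1 ?addr0 => [|i ib]; rewrite mxE (bigD1 a)//= big1 ?addr0.
- by rewrite mxE !eqxx mulr1.
- by move=> j /negbTE ja; rewrite mxE ja mulr0.
- by rewrite mxE (negbTE ib) andbF mulr0 mul0r.
- by move=> j /negbTE ja; rewrite mxE ja mulr0.
Qed.

(** Of the two matrix units in a generator, the one at (a, b) separates the word into two traces and
    the one at (b, a) glues [A] to the transpose of [B]. Since the generator is 0 for a = b, the sum
    may run over all pairs. *)
Lemma sum_rotgen_entry (A B : 'M[C]_N) :
  \sum_ab (A *m rotgen ab *m B) ab.1 ab.2 = \tr A * \tr B - \tr (A *m B^T).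
Proof.
transitivity (\sum_ab (A ab.1 ab.1 * B ab.2 ab.2 - A ab.1 ab.2 * B ab.1 ab.2)).
  apply: eq_bigr => -[a b] _ /=; rewrite /rotgen/= mulmxBr mulmxBl.
  by rewrite [LHS]mxE [in X in _ + X]mxE !mul_delta_mx_entry.
rewrite -(pair_bigA _ (fun a b => A a a * B b b - A a b * B a b))/=.
under eq_bigr do rewrite sumrB; rewrite sumrB; congr (_ - _).
  by rewrite /mxtrace big_distrl; apply: eq_bigr => a _; rewrite big_distrr.
by rewrite /mxtrace; apply: eq_bigr => a _; rewrite mxE; apply: eq_bigr => b _; rewrite mxE.
Qed.

(** Here the generator sits inside another trace, and summation merges that trace with [M]. This
    leaves two traces fewer than a splitting, whence the order 1/N^2 after normalization. *)
Lemma sum_rotgen_trace (M A B : 'M[C]_N) :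
  \sum_ab M ab.1 ab.2 * \tr (A *m rotgen ab *m B) =
  \tr (M *m (B *m A)) - \tr (M *m (B *m A)^T).
Proof.
have tD a b : \tr (A *m delta_mx a b *m B) = (B *m A) b a.
  rewrite mxE /mxtrace; apply: eq_bigr => c _; rewrite mul_delta_mx_entry mulrC//.
transitivity (\sum_ab (M ab.1 ab.2 * (B *m A) ab.2 ab.1 - M ab.1 ab.2 * (B *m A) ab.1 ab.2)).
  apply: eq_bigr => -[a b] _ /=.
  by rewrite /rotgen/= mulmxBr mulmxBl raddfB/= !tD mulrBr.
rewrite -(pair_bigA _ (fun a b => M a b * (B *m A) b a - M a b * (B *m A) a b))/=.
under eq_bigr do rewrite sumrB; rewrite sumrB; congr (_ - _).
  by rewrite /mxtrace; apply: eq_bigr => a _; rewrite mxE.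
by rewrite /mxtrace; apply: eq_bigr => a _; rewrite mxE;
  apply: eq_bigr => b _; rewrite [X in _ = _ * X]mxE.
Qed.

End rotation_generators.

Section plane_rotation.
Context {R : realType} {N : nat}.
Variables (a b : 'I_N).
Hypothesis ab : a != b.

Let K : 'M[R]_N := delta_mx a a + delta_mx b b.
Let H : 'M[R]_N := delta_mx a b - delta_mx b a.

(* Rational parametrization of the rotations of the plane (a, b), with unit speed at t = 0. *)
Definition plane_rot (t : R) : 'M[R]_N :=
  1%:M + (- 2 * t ^+ 2 / (4 + t ^+ 2)) *: K + (4 * t / (4 + t ^+ 2)) *: H.

Lemma plane_rot_orth t : plane_rot t *m (plane_rot t)^T = 1%:M.
Proof.
have nab : (a == b) = false by exact: negbTE.
have nba : (b == a) = false by rewrite eq_sym.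
have KK : K *m K = K.
  rewrite /K !(mulmxDl, mulmxDr) !mul_delta_mx_cond !eqxx nab nba /=.
  by rewrite !mulr1n !mulr0n addr0 add0r.
have HH : H *m H = - K.
  rewrite /K /H !(mulmxBl, mulmxBr) !mul_delta_mx_cond !eqxx nab nba /=.
  by rewrite !mulr1n !mulr0n !subr0 sub0r opprD addrC.
have KH : K *m H = H.
  rewrite /K /H !(mulmxDl, mulmxBr) !mul_delta_mx_cond !eqxx nab nba /=.
  by rewrite !mulr1n !mulr0n subr0 sub0r.
have HK : H *m K = H.
  rewrite /K /H !(mulmxBl, mulmxDr) !mul_delta_mx_cond !eqxx nab nba /=.
  by rewrite !mulr1n !mulr0n subr0 sub0r addrC.
have tK : K^T = K by rewrite /K raddfD/= !trmx_delta.
have tH : H^T = - H by rewrite /H raddfB/= !trmx_delta opprB.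
rewrite /plane_rot; set u := (X in X *: K); set s := (X in X *: H).
(* For the angle 2 arctan(t/2), [1 + u] is the cosine and [s] the sine; this is cos^2 + sin^2 =
   1. *)
have us : 2 * u + u ^+ 2 + s ^+ 2 = 0.
  have ne : 4 + t ^+ 2 != 0 by apply/lt0r_neq0; rewrite ltr_pwDl// sqr_ge0.
  by rewrite /u /s; field; exact: ne.
(* Only the multiplication table of K and H matters from here on, so both are generalized. *)
move: (K) (H) KK HH KH HK tK tH => K' H' KK HH KH HK tK tH.
rewrite !linearD/= tr_scalar_mx !linearZ/= tK tH.
rewrite mulmx1 mulmxN !mulmxDl !mul1mx -!scalemxAl KK HH KH HK.
transitivity (1%:M + (2 * u + u ^+ 2 + s ^+ 2) *: K'); last by rewrite us scale0r addr0.
by apply/matrixP => i j; rewrite !mxE; ring.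
Qed.

Lemma plane_rot_expansion t : plane_rot t =
  1%:M + t *: H + t ^+ 2 *: ((- 2 / (4 + t ^+ 2)) *: K + (- t / (4 + t ^+ 2)) *: H).
Proof.
have ne : 4 + t ^+ 2 != 0 by apply/lt0r_neq0; rewrite ltr_pwDl// sqr_ge0.
apply/matrixP => i j; rewrite !mxE; field; exact: ne.
Qed.

End plane_rotation.

(** * Differentiating expectations along curves *)

Section curves.
Context {R : realType} {d : measure_display} {T : measurableType d}.
Variable P : probability T R.
Local Notation C := R[i].
Local Notation rc := (real_complex R).
Local Notation L := (all_momentsC P).

(* Closed under products, with expectations bounded in t: no domination argument is needed to
   differentiate under the expectation. *)
Inductive remainder : (R -> T -> C) -> Prop :=
| remainder_one (r : R -> C) (U : T -> C) :
    (exists K, forall t, `|t| <= 1 -> ComplexField.Normc.normc (r t) <= K) -> L U ->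
    remainder (fun t w => r t * U w)
| remainder_add Z Z' : remainder Z -> remainder Z' ->
    remainder (fun t w => Z t w + Z' t w).

Lemma remainder_mul Z Z' : remainder Z -> remainder Z' ->
  remainder (fun t w => Z t w * Z' t w).
Proof.
elim=> [r U [K rK] LU|Z1 Z2 _ ih1 _ ih2] rem'; last first.
  have -> : (fun t w => (Z1 t w + Z2 t w) * Z' t w) =
      (fun t w => Z1 t w * Z' t w + Z2 t w * Z' t w).
    by apply/funext => t; apply/funext => w; rewrite mulrDl.
  by apply: remainder_add; [exact: ih1|exact: ih2].
elim: rem' => [r' U' [K' rK'] LU'|Z1 Z2 _ ih1 _ ih2]; last first.
  have -> : (fun t w => r t * U w * (Z1 t w + Z2 t w)) =
      (fun t w => r t * U w * Z1 t w + r t * U w * Z2 t w).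
    by apply/funext => t; apply/funext => w; rewrite mulrDr.
  exact: remainder_add.
have -> : (fun t w => r t * U w * (r' t * U' w)) =
    (fun t w => (r t * r' t) * (U w * U' w)).
  by apply/funext => t; apply/funext => w; rewrite mulrACA.
apply: remainder_one; last exact: all_momentsC_mul.
exists (K * K') => t t1; rewrite ComplexField.Normc.normcM.
by apply: ler_pM; rewrite ?sqrtr_ge0 ?rK ?rK'//; case: (r t) => *; case: (r' t) => *; exact: sqrtr_ge0.
Qed.

Lemma remainder_rv U : L U -> remainder (fun _ w => U w).
Proof.
move=> LU; have -> : (fun (_ : R) w => U w) = (fun t w => (fun=> 1) t * U w).
  by apply/funext => t; apply/funext => w; rewrite mul1r.
by apply: remainder_one => //; exists 1 => t _; rewrite ComplexField.Normc.normc1.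
Qed.

Lemma normc_rc (x : R) : ComplexField.Normc.normc (rc x) = `|x|.
Proof. by rewrite /= expr0n addr0 sqrtr_sqr. Qed.

Lemma remainder_scalar (r : R -> R) : (exists K, forall t, `|t| <= 1 -> `|r t| <= K) ->
  remainder (fun t _ => rc (r t)).
Proof.
move=> [K rK]; have -> : (fun t (_ : T) => rc (r t)) = (fun t w => rc (r t) * cst 1 w).
  by apply/funext => t; apply/funext => w; rewrite mulr1.
apply: remainder_one; last exact: all_momentsC_cst.
by exists K => t t1; rewrite normc_rc rK.
Qed.

Lemma remainder_EC Z : remainder Z ->
  (forall t, L (Z t)) /\
  exists K, forall t, `|t| <= 1 -> ComplexField.Normc.normc (EC P (Z t)) <= K.
Proof.
elim=> [r U [K rK] LU|Z1 Z2 _ [ih1 [K1 b1]] _ [ih2 [K2 b2]]].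
  split=> [t|].
    by apply: (@all_momentsC_mul _ _ _ P (cst (r t))) => //; exact: all_momentsC_cst.
  exists (K * ComplexField.Normc.normc (EC P U)) => t t1.
  rewrite EC_scale// ComplexField.Normc.normcM ler_wpM2r ?rK//.
  by case: (EC P U) => *; exact: sqrtr_ge0.
split=> [t|]; first exact: all_momentsC_add.
exists (K1 + K2) => t t1; rewrite EC_add//.
by apply: (le_trans (le_normcD _ _)); rewrite lerD ?b1 ?b2.
Qed.

(** A Taylor expansion at t = 0 that is exact for every t and at every point; estimates are needed
    only for the expectation of the remainder, on |t| <= 1. *)
Definition expands (Z : R -> T -> C) (Z0 Z1 : T -> C) :=
  [/\ L Z0, L Z1 & exists2 S, remainder S &
      forall t w, Z t w = Z0 w + rc t * Z1 w + rc (t ^+ 2) * S t w].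

Lemma expands_rv U : L U -> expands (fun _ w => U w) U (fun=> 0).
Proof.
move=> LU; split=> //; first exact: all_momentsC_cst.
exists (fun _ _ => 0); first by apply: (@remainder_rv (fun=> 0)); exact: all_momentsC_cst.
by move=> t w; rewrite !mulr0 !addr0.
Qed.

Lemma expands_add Z Z0 Z1 U U0 U1 : expands Z Z0 Z1 -> expands U U0 U1 ->
  expands (fun t w => Z t w + U t w) (fun w => Z0 w + U0 w) (fun w => Z1 w + U1 w).
Proof.
move=> [lz0 lz1 [S rS ZS]] [lu0 lu1 [S' rS' US]]; split; [exact: all_momentsC_add..|].
exists (fun t w => S t w + S' t w); first exact: remainder_add.
by move=> t w; rewrite ZS US; ring.
Qed.

Lemma expands_mul Z Z0 Z1 U U0 U1 : expands Z Z0 Z1 -> expands U U0 U1 ->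
  expands (fun t w => Z t w * U t w) (fun w => Z0 w * U0 w)
          (fun w => Z1 w * U0 w + Z0 w * U1 w).
Proof.
move=> [lz0 lz1 [S rS ZS]] [lu0 lu1 [S' rS' US]]; split.
- exact: all_momentsC_mul.
- by apply: all_momentsC_add; exact: all_momentsC_mul.
have rt : remainder (fun t _ => rc t) by apply: remainder_scalar; exists 1.
exists (fun t w => Z0 w * S' t w + (S t w * U0 w + (Z1 w * U1 w +
   (rc t * (Z1 w * S' t w + S t w * U1 w) + rc t * rc t * (S t w * S' t w))))).
  have [r0 r1] := (remainder_rv lz0, remainder_rv lz1).
  have [r2 r3] := (remainder_rv lu0, remainder_rv lu1).
  by repeat first [apply: remainder_add | apply: remainder_mul | assumption].
by move=> t w; rewrite ZS US rmorphXn; ring.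
Qed.

Lemma expands_sum (I : Type) (r : seq I) (Z : I -> R -> T -> C) Z0 Z1 :
  (forall i, expands (Z i) (Z0 i) (Z1 i)) ->
  expands (fun t w => \sum_(i <- r) Z i t w) (fun w => \sum_(i <- r) Z0 i w)
     (fun w => \sum_(i <- r) Z1 i w).
Proof.
move=> H; elim: r => [|x r ih].
  have E : (fun w => \sum_(i <- [::]) Z0 i w) = (fun=> 0).
    by apply/funext => w; rewrite big_nil.
  have E1 : (fun w => \sum_(i <- [::]) Z1 i w) = (fun=> 0).
    by apply/funext => w; rewrite big_nil.
  have E2 : (fun t w => \sum_(i <- [::]) Z i t w) = (fun _ _ => 0).
    by apply/funext => t; apply/funext => w; rewrite big_nil.
  by rewrite E E1 E2; apply: (@expands_rv (fun=> 0)); exact: all_momentsC_cst.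
have E (W : I -> T -> C) : (fun w => \sum_(i <- x :: r) W i w) =
    (fun w => W x w + \sum_(i <- r) W i w).
  by apply/funext => w; rewrite big_cons.
have E2 : (fun t w => \sum_(i <- x :: r) Z i t w) =
    (fun t w => Z x t w + \sum_(i <- r) Z i t w).
  by apply/funext => t; apply/funext => w; rewrite big_cons.
by rewrite !E E2; exact: expands_add.
Qed.

(** Constancy gives t E(Z1) + t^2 E(S t) = 0, hence E(Z1) = - t E(S t) for t <> 0, and this tends to
    0 with t. *)
Lemma EC_expands_const Z Z0 Z1 : expands Z Z0 Z1 ->
  (forall t, EC P Z0 = EC P (Z t)) -> EC P Z1 = 0.
Proof.
move=> [l0 l1 [S rS ZS]] H; have [lS [K bK]] := remainder_EC rS.
have sc c U : L U -> L (fun w => c * U w).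
  by move=> LU; apply: (@all_momentsC_mul _ _ _ P (cst c)) => //; exact: all_momentsC_cst.
have eq t : t != 0 -> EC P Z1 = - (rc t * EC P (S t)).
  move=> t0; have := H t.
  have -> : Z t = (fun w => Z0 w + (rc t * Z1 w + rc (t ^+ 2) * S t w)).
    by apply/funext => w; rewrite ZS addrA.
  rewrite EC_add//; last by apply: all_momentsC_add; exact: sc.
  rewrite EC_add; [|exact: sc|exact: sc].
  rewrite !EC_scale// -[X in X = _ -> _]addr0 => /addrI /esym/eqP.
  rewrite rmorphXn expr2 -mulrA -mulrDr mulf_eq0 -(rmorph0 rc).
  rewrite (inj_eq (@complexI R)) (negbTE t0)/= rmorph0 addr_eq0 => /eqP; exact.
apply: ComplexField.Normc.eq0_normc; apply/eqP; rewrite eq_le; apply/andP; split; last first.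
  by case: (EC P Z1) => *; exact: sqrtr_ge0.
have K0 : 0 <= K.
  apply: le_trans (bK 0 _); last by rewrite normr0.
  by case: (EC P _) => *; exact: sqrtr_ge0.
apply/ler_addgt0Pl => e e0; rewrite addr0.
(* This t lies in the range where K bounds E(S t) and makes t K at most e; the summand 1 covers K =
   0. *)
pose t := Num.min 1 (e / (K + 1)).
have t0 : 0 < t by rewrite /t lt_min ltr01 divr_gt0// ltr_wpDl.
have t1 : `|t| <= 1 by rewrite gtr0_norm// /t ge_min lexx.
rewrite (eq t (lt0r_neq0 t0)) normcN ComplexField.Normc.normcM normc_rc gtr0_norm//.
apply: (@le_trans _ _ (t * K)); first by rewrite ler_wpM2l ?bK// ltW.
apply: (@le_trans _ _ (e / (K + 1) * K)).
  by rewrite ler_wpM2r// /t ge_min lexx orbT.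
rewrite -mulrA ler_piMr ?(ltW e0)// mulrC ler_pdivrMr ?ltr_wpDl// mul1r lerDl//.
Qed.

Definition expands_mx m n (A : R -> T -> 'M[C]_(m, n)) (A0 A1 : T -> 'M[C]_(m, n)) :=
  forall i j, expands (fun t w => A t w i j) (fun w => A0 w i j) (fun w => A1 w i j).

Lemma expands_mx_add m n A A0 A1 B B0 B1 :
  @expands_mx m n A A0 A1 -> expands_mx B B0 B1 ->
  expands_mx (fun t w => A t w + B t w) (fun w => A0 w + B0 w) (fun w => A1 w + B1 w).
Proof.
move=> HA HB i j; have := expands_add (HA i j) (HB i j).
by congr expands; do ?[apply/funext => ?]; rewrite mxE.
Qed.

Lemma expands_mx_mul m n p A A0 A1 B B0 B1 :
  @expands_mx m n A A0 A1 -> @expands_mx n p B B0 B1 ->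
  expands_mx (fun t w => A t w *m B t w) (fun w => A0 w *m B0 w)
    (fun w => A1 w *m B0 w + A0 w *m B1 w).
Proof.
move=> HA HB i j.
have := expands_sum (index_enum 'I_n) (fun k => expands_mul (HA i k) (HB k j)).
congr expands; apply/funext => t; last by rewrite !mxE -big_split.
  by apply/funext => w; rewrite mxE.
by rewrite mxE.
Qed.

Lemma expands_mx_tr m n A A0 A1 : @expands_mx m n A A0 A1 ->
  expands_mx (fun t w => (A t w)^T) (fun w => (A0 w)^T) (fun w => (A1 w)^T).
Proof.
move=> HA i j; have := HA j i.
by congr expands; do ?[apply/funext => ?]; rewrite mxE.
Qed.

Lemma expands_mx_rv m n (A : T -> 'M[C]_(m, n)) : (forall i j, L (fun w => A w i j)) ->
  expands_mx (fun _ w => A w) A (fun=> 0).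
Proof.
move=> LA i j; have := expands_rv (LA i j).
by congr expands; do ?[apply/funext => ?]; rewrite mxE.
Qed.

Lemma expands_tr n A A0 A1 : @expands_mx n n A A0 A1 ->
  expands (fun t w => \tr (A t w)) (fun w => \tr (A0 w)) (fun w => \tr (A1 w)).
Proof. by move=> HA; apply: expands_sum => i; exact: HA. Qed.

End curves.

(** * Exact loop equations at finite size *)

Lemma Re_sum (R : realType) (I : Type) (r : seq I) (F : I -> R[i]) :
  complex.Re (\sum_(i <- r) F i) = \sum_(i <- r) complex.Re (F i).
Proof. exact: (big_morph _ (@ReD R) erefl). Qed.

Lemma Im_sum (R : realType) (I : Type) (r : seq I) (F : I -> R[i]) :
  complex.Im (\sum_(i <- r) F i) = \sum_(i <- r) complex.Im (F i).
Proof. exact: (big_morph _ (@ImD R) erefl). Qed.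

Section loop_equation.
Context {R : realType} {d : measure_display} {T : measurableType d}.
Variable P : probability T R.
Context {s : nat} {k : 'I_s -> nat} {N : nat}.
Variable X : forall j : 'I_s, 'I_(k j) -> T -> 'M[R[i]]_N.
Arguments X : clear implicits.
Local Notation C := R[i].
Local Notation rc := (real_complex R).
Local Notation V := {j : 'I_s & 'I_(k j)}.
Local Notation L := (all_momentsC P).
Hypothesis LX : forall j i a b, L (fun w => X j i w a b).
Hypothesis indX : indep_families P (fun j => entry_rv (X j)).

Definition joint (Y : forall j : 'I_s, 'I_(k j) -> T -> 'M[C]_N) (w : T) (v : V) :=
  Y (tag v) (tagged v) w.

Local Notation J := (fun j : 'I_s => ('I_(k j) * 'I_N * 'I_N * bool)%type : finType).
Local Notation ent Y := (fun j => entry_rv (Y j) : J j -> T -> R).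

Lemma all_moments_entry j e : all_moments P (entry_rv (X j) e).
Proof. by case: e => [[[i a] b] []]; case: (LX i a b). Qed.

Lemma pspan_ncev (Y : forall j : 'I_s, 'I_(k j) -> T -> 'M[C]_N) p a b :
  pspan (tagfam (ent X)) (tagfam (ent Y))
    (fun w => ncev (joint X w) p a b) (fun w => ncev (joint Y w) p a b).
Proof.
elim: p a b => [c|v|v|p ihp q ihq|p ihp q ihq] a b /=.
- exact: pspan_cst.
- have E (Z : forall j : 'I_s, 'I_(k j) -> T -> 'M[C]_N) :
      (fun w => joint Z w v a b) =
      (fun w => rc (tagfam (ent Z) (Tagged J (tagged v, a, b, true)) w) +
         Complex 0 1 * rc (tagfam (ent Z) (Tagged J (tagged v, a, b, false)) w)).
    by apply/funext => w; rewrite [LHS]complexE.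
  rewrite !E; apply: pspan_add; first exact: pspan_var.
  by apply: pspan_mul; [exact: pspan_cst|exact: pspan_var].
- have E (Z : forall j : 'I_s, 'I_(k j) -> T -> 'M[C]_N) :
      (fun w => (joint Z w v)^T a b) =
      (fun w => rc (tagfam (ent Z) (Tagged J (tagged v, b, a, true)) w) +
         Complex 0 1 * rc (tagfam (ent Z) (Tagged J (tagged v, b, a, false)) w)).
    by apply/funext => w; rewrite mxE [LHS]complexE.
  rewrite !E; apply: pspan_add; first exact: pspan_var.
  by apply: pspan_mul; [exact: pspan_cst|exact: pspan_var].
- have E (Z : T -> V -> 'M[C]_N) : (fun w => (ncev (Z w) p + ncev (Z w) q) a b) =
      (fun w => ncev (Z w) p a b + ncev (Z w) q a b).
    by apply/funext => w; rewrite mxE.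
  by rewrite !E; exact: pspan_add.
- have E (Z : T -> V -> 'M[C]_N) : (fun w => (ncev (Z w) p *m ncev (Z w) q) a b) =
      (fun w => \sum_c ncev (Z w) p a c * ncev (Z w) q c b).
    by apply/funext => w; rewrite mxE.
  by rewrite !E; apply: pspan_sum => c; exact: pspan_mul.
Qed.

Lemma all_momentsC_ncev p a b : L (fun w => ncev (joint X w) p a b).
Proof.
apply: (all_momentsC_pspan _ (pspan_ncev X p a b)) => e; exact: all_moments_entry.
Qed.

Lemma all_momentsC_tr p : L (fun w => \tr (ncev (joint X w) p)).
Proof. by apply: all_momentsC_sum => a; exact: all_momentsC_ncev. Qed.

Definition rotated (O : 'M[R]_N) (j i : 'I_s) (x : 'I_(k i)) (w : T) : 'M[C]_N :=
  if i == j then map_mx rc O *m X i x w *m (map_mx rc O)^T else X i x w.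

Arguments rotated : clear implicits.

(** As O is real, real and imaginary parts of the entries rotate separately, each into a linear
    combination of parts of the same kind. *)
Lemma pspan_rotated O j i e :
  let g w := rc (entry_rv (rotated O j i) e w) in pspan (ent X i) (ent X i) g g.
Proof.
rewrite /=; case: e => [[[x a] b] re].
rewrite /entry_rv /rotated; case: (i == j); last first.
  exact: (@pspan_var _ _ _ (ent X i) (ent X i) (x, a, b, re)).
have E : (fun w => rc (if re then complex.Re ((map_mx rc O *m X i x w *m (map_mx rc O)^T) a b)
     else complex.Im ((map_mx rc O *m X i x w *m (map_mx rc O)^T) a b))) =
   (fun w => \sum_c \sum_e rc (O a e) * rc (entry_rv (X i) (x, e, c, re) w) * rc (O b c)).
  apply/funext => w; rewrite mxE; case: re.
    rewrite Re_sum rmorph_sum; apply: eq_bigr => c _.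
    rewrite mxE big_distrl/= Re_sum rmorph_sum; apply: eq_bigr => e _.
    by rewrite -!rmorphM !mxE !ReM !ImM /= !mul0r !mulr0 !subr0.
  rewrite Im_sum rmorph_sum; apply: eq_bigr => c _.
  rewrite mxE big_distrl/= Im_sum rmorph_sum; apply: eq_bigr => e _.
  by rewrite -!rmorphM !mxE !ImM !ReM /= !mul0r !mulr0 addr0 add0r.
rewrite E; apply: pspan_sum => c; apply: pspan_sum => e.
apply: pspan_mul; last exact: pspan_cst.
apply: pspan_mul; first exact: pspan_cst.
exact: (@pspan_var _ _ _ (ent X i) (ent X i) (x, e, c, re)).
Qed.

(** Invariance concerns the law of family j alone. By independence the moments of that family can be
    exchanged inside a mixed moment, which gives invariance under rotating family j and nothing
    else. *)
Lemma EC_rotated j O Z U : orth_invariant P (X j) -> O *m O^T = 1%:M ->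
  pspan (tagfam (ent X)) (tagfam (ent (rotated O j))) Z U -> EC P Z = EC P U.
Proof.
move=> inv OO; apply: EC_pspan_same_law.
- by move=> i e; exact: all_moments_entry.
- exact: indX.
- move=> i; have [ij|nij] := eqVneq i j; last first.
    have -> : rotated O j i = X i.
      by apply/funext => x; apply/funext => w; rewrite /rotated (negbTE nij).
    by [].
  subst i; have -> : rotated O j j =
      (fun i w => map_mx rc O *m X j i w *m (map_mx rc O)^T).
    by apply/funext => x; apply/funext => w; rewrite /rotated eqxx.
  exact: inv.
- by move=> i e; exact: pspan_rotated.
Qed.

(** Leibniz derivative, in the direction H, of the product of the traces of [qs]. *)
Fixpoint dprod (Q : V -> bool) (H : 'M[C]_N) (qs : seq (ncpoly R V)) (w : T) : C :=
  if qs is q :: qs' then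
    \tr (ncder Q H (joint X w) q) * \prod_(q' <- qs') \tr (ncev (joint X w) q')
    + \tr (ncev (joint X w) q) * dprod Q H qs' w
  else 0.

Section derivative.
Variables (j : 'I_s) (a b : 'I_N).
Hypothesis ab : a != b.
Hypothesis inv : orth_invariant P (X j).
Let H : 'M[C]_N := rotgen (a, b).
Let Q (v : V) := tag v == j.
Let Xt (t : R) := rotated (plane_rot a b t) j.

Lemma rotgen_tr : H^T = - H.
Proof. by rewrite /H /rotgen/= linearB/= !trmx_delta opprB. Qed.

Lemma expands_plane_rot :
  expands_mx P (fun t (_ : T) => map_mx rc (plane_rot a b t)) (fun=> 1%:M) (fun=> H).
Proof.
move=> x y; split; [exact: all_momentsC_cst..|].
exists (fun t w => rc (- 2 / (4 + t ^+ 2)) * rc ((delta_mx a a + delta_mx b b : 'M[R]_N) x y) +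
   rc (- t / (4 + t ^+ 2)) * rc ((delta_mx a b - delta_mx b a : 'M[R]_N) x y)).
  have D t : 4 <= 4 + t ^+ 2 :> R by rewrite lerDl sqr_ge0.
  have D0 t : 0 < 4 + t ^+ 2 :> R by apply: lt_le_trans (D t).
  apply: remainder_add; apply: remainder_mul.
  - apply: remainder_scalar; exists 1 => t _.
    rewrite normrM normrN normr_nat normfV gtr0_norm// ler_pdivrMr// mul1r.
    by apply: le_trans (D t); rewrite ler_nat.
  - by apply: remainder_rv; exact: all_momentsC_cst.
  - apply: remainder_scalar; exists 1 => t t1.
    rewrite normrM normrN normfV (gtr0_norm (D0 t)) ler_pdivrMr// mul1r.
    by apply: le_trans (D t); apply: (le_trans t1); rewrite ler1n.
  - by apply: remainder_rv; exact: all_momentsC_cst.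
move=> t w; rewrite mxE plane_rot_expansion -!rmorphM -rmorphD.
have -> : H x y = rc ((delta_mx a b - delta_mx b a : 'M[R]_N) x y).
  by rewrite /H /rotgen !mxE rmorphB !rmorph_nat.
have -> : (1%:M : 'M[C]_N) x y = rc ((1%:M : 'M[R]_N) x y).
  by rewrite !mxE rmorph_nat.
by rewrite -!rmorphM -!rmorphD; congr (rc _); rewrite !mxE.
Qed.

Lemma expands_ncev p : expands_mx P (fun t w => ncev (joint (Xt t) w) p)
  (fun w => ncev (joint X w) p) (fun w => ncder Q H (joint X w) p).
Proof.
have LV (v : V) a' b' : L (fun w => joint X w v a' b') by exact: LX.
have EV (v : V) : expands_mx P (fun t w => joint (Xt t) w v)
    (fun w => joint X w v)
    (fun w => if Q v then H *m joint X w v - joint X w v *m H else 0).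
  have [qv|nqv] := boolP (Q v); last first.
    have -> : (fun t w => joint (Xt t) w v) = (fun (_ : R) w => joint X w v).
      apply/funext => t; apply/funext => w; rewrite /joint /Xt /rotated.
      by move: nqv; rewrite /Q => /negbTE ->.
    exact: (expands_mx_rv (LV v)).
  have := expands_mx_mul (expands_mx_mul expands_plane_rot (expands_mx_rv (LV v)))
    (expands_mx_tr expands_plane_rot).
  congr expands_mx.
  - apply/funext => t; apply/funext => w; rewrite /joint /Xt /rotated.
    by move: qv; rewrite /Q => ->.
  - by apply/funext => w; rewrite tr_scalar_mx mul1mx mulmx1.
  - apply/funext => w; rewrite tr_scalar_mx rotgen_tr !mul1mx !mulmx1 addr0.
    by rewrite mulmxN.
elim: p => [c|v|v|p ihp q ihq|p ihp q ihq] /=.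
- apply: (@expands_mx_rv _ _ _ P _ _ (fun=> c%:M)) => i j'; exact: all_momentsC_cst.
- exact: EV.
- have := expands_mx_tr (EV v); congr expands_mx; apply/funext => w.
  case: (Q v); last by rewrite trmx0.
  by rewrite linearB/= !trmx_mul rotgen_tr mulNmx mulmxN opprK addrC.
- exact: expands_mx_add.
- exact: expands_mx_mul.
Qed.


Lemma expands_prod_tr qs :
  expands P (fun t w => \prod_(q <- qs) \tr (ncev (joint (Xt t) w) q))
    (fun w => \prod_(q <- qs) \tr (ncev (joint X w) q)) (dprod Q H qs).
Proof.
elim: qs => [|q qs ih].
  have := @expands_rv _ _ _ P (fun=> 1) (all_momentsC_cst P 1).
  by congr expands; do ?[apply/funext => ?]; rewrite big_nil.
have := expands_mul (expands_tr (expands_ncev q)) ih.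
by congr expands; do ?[apply/funext => ?]; rewrite big_cons.
Qed.

(** The expectation of an entry times a product of traces is constant along the curve of plane
    rotations, so its first-order coefficient vanishes. *)
Lemma EC_derivative p qs : EC P (fun w =>
  ncder Q H (joint X w) p a b * \prod_(q <- qs) \tr (ncev (joint X w) q) +
  ncev (joint X w) p a b * dprod Q H qs w) = 0.
Proof.
apply: (EC_expands_const (expands_mul (expands_ncev p a b) (expands_prod_tr qs))) => t.
apply: (EC_rotated inv (plane_rot_orth ab t)).
apply: pspan_mul; first exact: pspan_ncev.
apply: pspan_prod => q _; apply: pspan_sum => i; exact: pspan_ncev.
Qed.

End derivative.

Lemma ncder0 (Q : V -> bool) f p : ncder Q (0 : 'M[C]_N) f p = 0.
Proof.
elim: p => //= [v|v|a -> b ->|a -> b ->].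
- by case: ifP => _ //; rewrite mul0mx mulmx0 subr0.
- by case: ifP => _ //; rewrite mul0mx mulmx0 subr0.
- by rewrite addr0.
- by rewrite mul0mx mulmx0 addr0.
Qed.

Lemma dprod0 (Q : V -> bool) qs w : dprod Q 0 qs w = 0.
Proof.
by elim: qs => //= q qs ->; rewrite ncder0 linear0 mul0r mulr0 addr0.
Qed.

Lemma all_momentsC_ncder (Q : V -> bool) H p a b : L (fun w => ncder Q H (joint X w) p a b).
Proof.
have Lm (A B : T -> 'M[C]_N) : (forall a b, L (fun w => A w a b)) ->
    (forall a b, L (fun w => B w a b)) -> forall a b, L (fun w => (A w *m B w) a b).
  move=> HA HB x y; have -> : (fun w => (A w *m B w) x y) = (fun w => \sum_z A w x z * B w z y).
    by apply/funext => w; rewrite mxE.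
  by apply: all_momentsC_sum => z; exact: all_momentsC_mul.
have Ld (A B : T -> 'M[C]_N) : (forall a b, L (fun w => A w a b)) ->
    (forall a b, L (fun w => B w a b)) -> forall a b, L (fun w => (A w + B w) a b).
  move=> HA HB x y; have -> : (fun w => (A w + B w) x y) = (fun w => A w x y + B w x y).
    by apply/funext => w; rewrite mxE.
  exact: all_momentsC_add.
have Lc (A : 'M[C]_N) x y : L (fun=> A x y) by exact: all_momentsC_cst.
have Lo (A : T -> 'M[C]_N) : (forall a b, L (fun w => A w a b)) ->
    forall a b, L (fun w => (- A w) a b).
  move=> HA x y; have -> : (fun w => (- A w) x y) = (fun w => cst (-1) w * A w x y).
    by apply/funext => w; rewrite mxE /= mulN1r.
  by apply: all_momentsC_mul => //; exact: all_momentsC_cst.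
elim: p a b => [c|v|v|p ihp q ihq|p ihp q ihq] /=.
- exact: Lc.
- case: (Q v); last exact: Lc.
  by apply: Ld; [|apply: Lo]; apply: Lm; [exact: Lc|exact: LX|exact: LX|exact: Lc].
- case: (Q v); last exact: Lc.
  have LT a b : L (fun w => (joint X w v)^T a b).
    have -> : (fun w => (joint X w v)^T a b) = (fun w => joint X w v b a).
      by apply/funext => w; rewrite mxE.
    exact: LX.
  by apply: Ld; [|apply: Lo]; apply: Lm; [exact: Lc|exact: LT|exact: LT|exact: Lc].
- exact: Ld.
- by apply: Ld; apply: Lm => // *; exact: all_momentsC_ncev.
Qed.

Lemma all_momentsC_prod_tr qs : L (fun w => \prod_(q <- qs) \tr (ncev (joint X w) q)).
Proof. by apply: all_momentsC_prod => q; exact: all_momentsC_tr. Qed.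

Lemma all_momentsC_dprod (Q : V -> bool) H qs : L (dprod Q H qs).
Proof.
elim: qs => [|q qs ih] /=; first exact: all_momentsC_cst.
apply: all_momentsC_add; apply: all_momentsC_mul => //.
- by apply: all_momentsC_sum => a; exact: all_momentsC_ncder.
- exact: all_momentsC_prod_tr.
- exact: all_momentsC_tr.
Qed.

Lemma EC_cut (Q : V -> bool) (g : T -> ncpoly R V -> ncpoly R V -> C) l p r :
  (forall l r, L (fun w => g w l r)) ->
  L (fun w => cut Q (g w) l p r) /\
  EC P (fun w => cut Q (g w) l p r) = cut Q (fun l r => EC P (fun w => g w l r)) l p r.
Proof.
move=> Lg.
have LB l1 r1 l2 r2 : L (fun w => g w l1 r1 - g w l2 r2) /\
    EC P (fun w => g w l1 r1 - g w l2 r2) = EC P (fun w => g w l1 r1) - EC P (fun w => g w l2 r2).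
  have Lo : L (fun w => - g w l2 r2).
    have -> : (fun w => - g w l2 r2) = (fun w => cst (-1) w * g w l2 r2).
      by apply/funext => w; rewrite /= mulN1r.
    by apply: all_momentsC_mul => //; exact: all_momentsC_cst.
  by split; [exact: all_momentsC_add|rewrite EC_add// EC_opp].
elim: p l r => [c|v|v|a iha b ihb|a iha b ihb] l r /=.
- by split; [exact: all_momentsC_cst|exact: EC_cst].
- case: (Q v); first exact: LB.
  by split; [exact: all_momentsC_cst|exact: EC_cst].
- case: (Q v); first exact: LB.
  by split; [exact: all_momentsC_cst|exact: EC_cst].
- have [[l1 e1] [l2 e2]] := (iha l r, ihb l r).
  by split; [exact: all_momentsC_add|rewrite EC_add// e1 e2].
- have [[l1 e1] [l2 e2]] := (iha l (NCmul b r), ihb (NCmul l a) r).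
  by split; [exact: all_momentsC_add|rewrite EC_add// e1 e2].
Qed.

Definition ET (c : seq (ncpoly R V)) : C :=
  EC P (fun w => \prod_(p <- c) \tr (ncev (joint X w) p)).

(** The terms in which the generator falls into one of the traces [qs]: that trace is opened at a
    letter, read cyclically as r l, and spliced into [p], directly or transposed. [pre] holds the
    traces already passed. *)
Fixpoint qloop (Q : V -> bool) p (pre qs : seq (ncpoly R V)) : C :=
  if qs is q :: qs' then
    cut Q (fun l r => ET (NCmul p (NCmul r l) :: pre ++ qs')
                    - ET (NCmul p (nct (NCmul r l)) :: pre ++ qs')) (NCconst 1) q (NCconst 1)
    + qloop Q p (q :: pre) qs'
  else 0.

Lemma ET_sub p q c : EC P (fun w => (\tr (ncev (joint X w) p) - \tr (ncev (joint X w) q)) *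
    \prod_(p <- c) \tr (ncev (joint X w) p)) = ET (p :: c) - ET (q :: c).
Proof.
have E p' : (fun w => \prod_(p <- p' :: c) \tr (ncev (joint X w) p)) =
   (fun w => \tr (ncev (joint X w) p') * \prod_(p <- c) \tr (ncev (joint X w) p)).
  by apply/funext => w; rewrite big_cons.
have Lp p' : L (fun w => \tr (ncev (joint X w) p') * \prod_(p <- c) \tr (ncev (joint X w) p)).
  by rewrite -E; exact: all_momentsC_prod_tr.
rewrite /ET !E -EC_opp// -EC_add//; last first.
  have := all_momentsC_mul (all_momentsC_cst P (-1)) (Lp q).
  by congr (L _); apply/funext => w /=; rewrite mulN1r.
by congr (EC _ _); apply/funext => w; rewrite mulrBl.
Qed.

Lemma qloopE (Q : V -> bool) p pre qs :
  EC P (fun w => (\prod_(q <- pre) \tr (ncev (joint X w) q)) *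
     \sum_ab ncev (joint X w) p ab.1 ab.2 * dprod Q (rotgen ab) qs w) = qloop Q p pre qs.
Proof.
elim: qs pre => [|q qs ih] pre /=.
  by rewrite -[RHS](EC_cst P); congr (EC _ _); apply/funext => w;
    rewrite [X in _ * X]big1 => [|ab _]; rewrite mulr0.
rewrite -ih.
have -> : cut Q (fun l r => ET (NCmul p (NCmul r l) :: pre ++ qs)
     - ET (NCmul p (nct (NCmul r l)) :: pre ++ qs)) (NCconst 1) q (NCconst 1) =
  EC P (fun w => cut Q (fun l r => (\tr (ncev (joint X w) (NCmul p (NCmul r l))) -
     \tr (ncev (joint X w) (NCmul p (nct (NCmul r l))))) *
     \prod_(p <- pre ++ qs) \tr (ncev (joint X w) p)) (NCconst 1) q (NCconst 1)).
  rewrite (EC_cut _ _ _ _ _).2; first by apply: eq_cut => l r; rewrite ET_sub.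
  move=> l r; apply: all_momentsC_mul; last exact: all_momentsC_prod_tr.
  have := all_momentsC_tr (NCadd (NCmul p (NCmul r l)) (NCmul (NCconst (-1)) (NCmul p (nct (NCmul r l))))).
  by congr (L _); apply/funext => w /=; rewrite linearD/= mul_scalar_mx scaleN1r linearN.
have cutE w : cut Q (fun l r => (\tr (ncev (joint X w) (NCmul p (NCmul r l))) -
     \tr (ncev (joint X w) (NCmul p (nct (NCmul r l))))) *
     \prod_(p <- pre ++ qs) \tr (ncev (joint X w) p)) (NCconst 1) q (NCconst 1) =
   \sum_ab ncev (joint X w) p ab.1 ab.2 * \tr (ncder Q (rotgen ab) (joint X w) q) *
     \prod_(p <- pre ++ qs) \tr (ncev (joint X w) p).
  set z := \prod_(p <- pre ++ qs) _.
  pose phi (ab : 'I_N * 'I_N) (A : 'M[C]_N) := ncev (joint X w) p ab.1 ab.2 * \tr A * z.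
  transitivity (cut Q (fun l r => \sum_ab phi ab (ncev (joint X w) l *m rotgen ab *m
      ncev (joint X w) r)) (NCconst 1) q (NCconst 1)).
    by apply: eq_cut => l r; rewrite /phi -big_distrl/= sum_rotgen_trace !ncev_nct trmx_mul.
  rewrite -cut_ncder; last by move=> ab A B; rewrite /phi linearB/= mulrBr mulrBl.
  by apply: eq_bigr => ab _; rewrite /phi /= mul1mx mulmx1.
rewrite -EC_add; last 2 first.
- under eq_fun do rewrite cutE.
  apply: all_momentsC_sum => ab; apply: all_momentsC_mul; last exact: all_momentsC_prod_tr.
  apply: all_momentsC_mul; first exact: all_momentsC_ncev.
  by apply: all_momentsC_sum => a; exact: all_momentsC_ncder.
- apply: all_momentsC_mul; first exact: all_momentsC_prod_tr.
  apply: all_momentsC_sum => ab; apply: all_momentsC_mul; first exact: all_momentsC_ncev.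
  exact: all_momentsC_dprod.
congr (EC _ _); apply/funext => w; rewrite cutE big_cons big_cat/=.
rewrite [X in _ * X = _](eq_bigr _ (fun ab _ => mulrDr _ _ _)) big_split/= mulrDr.
congr (_ + _).
  by rewrite big_distrr/=; apply: eq_bigr => ab _; ring.
rewrite -mulrA mulrCA; congr (_ * _); rewrite big_distrr/=.
by apply: eq_bigr => ab _; ring.
Qed.

(** The derivative identities for all pairs (a, b) are added: a generator inside [p] splits it by
    [sum_rotgen_entry], a generator inside a trace splices it by [sum_rotgen_trace]. Traces are not
    normalized here, so no powers of N are visible. *)
Theorem loop_equation j p qs : orth_invariant P (X j) ->
  let Q v := tag v == j in
  cut Q (fun l r => ET (l :: r :: qs) - ET (NCmul l (nct r) :: qs)) (NCconst 1) p (NCconst 1)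
  + qloop Q p [::] qs = 0.
Proof.
move=> inv Q.
have D ab : EC P (fun w =>
  ncder Q (rotgen ab) (joint X w) p ab.1 ab.2 * \prod_(q <- qs) \tr (ncev (joint X w) q) +
  ncev (joint X w) p ab.1 ab.2 * dprod Q (rotgen ab) qs w) = 0.
  (* A diagonal pair spans no plane, but its generator is 0. *)
  case: ab => a b; have [->|ab] := eqVneq a b; last exact: EC_derivative.
  rewrite -[RHS](EC_cst P 0); congr (EC _ _); apply/funext => w.
  by rewrite /rotgen subrr ncder0 dprod0 mxE mul0r mulr0 addr0.
have L1 ab : L (fun w => ncder Q (rotgen ab) (joint X w) p ab.1 ab.2 *
    \prod_(q <- qs) \tr (ncev (joint X w) q)).
  by apply: all_momentsC_mul; [exact: all_momentsC_ncder|exact: all_momentsC_prod_tr].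
have L2 ab : L (fun w => ncev (joint X w) p ab.1 ab.2 * dprod Q (rotgen ab) qs w).
  by apply: all_momentsC_mul; [exact: all_momentsC_ncev|exact: all_momentsC_dprod].
have : \sum_ab EC P (fun w =>
  ncder Q (rotgen ab) (joint X w) p ab.1 ab.2 * \prod_(q <- qs) \tr (ncev (joint X w) q) +
  ncev (joint X w) p ab.1 ab.2 * dprod Q (rotgen ab) qs w) = 0 by rewrite big1.
under eq_bigr => ab _ do rewrite EC_add//.
rewrite big_split/= => <-; congr (_ + _); last first.
  rewrite -qloopE -EC_sum//; congr (EC _ _); apply/funext => w.
  by rewrite big_nil mul1r.
rewrite -EC_sum//.
have -> : cut Q (fun l r => ET (l :: r :: qs) - ET (NCmul l (nct r) :: qs))
    (NCconst 1) p (NCconst 1) =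
  EC P (fun w => cut Q (fun l r => (\tr (ncev (joint X w) l) * \tr (ncev (joint X w) r) -
     \tr (ncev (joint X w) (NCmul l (nct r)))) *
     \prod_(p <- qs) \tr (ncev (joint X w) p)) (NCconst 1) p (NCconst 1)).
  have Lab l r : L (fun w => \tr (ncev (joint X w) l) * \tr (ncev (joint X w) r) *
      \prod_(p <- qs) \tr (ncev (joint X w) p)).
    apply: all_momentsC_mul; last exact: all_momentsC_prod_tr.
    by apply: all_momentsC_mul; exact: all_momentsC_tr.
  have Lc l r : L (fun w => - (\tr (ncev (joint X w) (NCmul l (nct r))) *
      \prod_(p <- qs) \tr (ncev (joint X w) p))).
    have := @all_momentsC_mul _ _ _ P _ _ (all_momentsC_cst P (-1))
      (all_momentsC_mul (all_momentsC_tr (NCmul l (nct r))) (all_momentsC_prod_tr qs)).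
    by congr (L _); apply/funext => w /=; rewrite mulN1r.
  have E l r : (fun w => (\tr (ncev (joint X w) l) * \tr (ncev (joint X w) r) -
     \tr (ncev (joint X w) (NCmul l (nct r)))) * \prod_(p <- qs) \tr (ncev (joint X w) p)) =
     (fun w => \tr (ncev (joint X w) l) * \tr (ncev (joint X w) r) *
      \prod_(p <- qs) \tr (ncev (joint X w) p) + - (\tr (ncev (joint X w) (NCmul l (nct r))) *
      \prod_(p <- qs) \tr (ncev (joint X w) p))).
    by apply/funext => w; rewrite mulrBl.
  rewrite (EC_cut _ _ _ _ _).2; last by move=> l r; rewrite E; exact: all_momentsC_add.
  apply: eq_cut => l r; rewrite E EC_add// EC_opp; last first.
    by apply: all_momentsC_mul; [exact: all_momentsC_tr|exact: all_momentsC_prod_tr].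
  by rewrite /ET; congr (_ - _); congr (EC _ _); apply/funext => w; rewrite !big_cons ?mulrA.
congr (EC _ _); apply/funext => w.
set z := \prod_(p <- qs) _.
pose phi (ab : 'I_N * 'I_N) (A : 'M[C]_N) := A ab.1 ab.2 * z.
transitivity (cut Q (fun l r => \sum_ab phi ab (ncev (joint X w) l *m rotgen ab *m
    ncev (joint X w) r)) (NCconst 1) p (NCconst 1)).
  by apply: eq_cut => l r; rewrite /phi -big_distrl/= sum_rotgen_entry /= ncev_nct.
rewrite -cut_ncder; last by move=> ab A B; rewrite /phi !mxE mulrBl.
by apply: eq_bigr => ab _; rewrite /phi /= mul1mx mulmx1.
Qed.

End loop_equation.

(** * Asymptotic expansions *)

Section asymptotics.
Context {R : realType}.
Local Notation C := R[i].
Local Notation nrm := (@ComplexField.Normc.normc R).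
Implicit Types (u v : nat -> C) (a b c : C).

Lemma nrm_ge0 (z : C) : 0 <= nrm z.
Proof. by case: z => *; exact: sqrtr_ge0. Qed.

Lemma Re_le_nrm (z : C) : `|complex.Re z| <= nrm z.
Proof.
by case: z => x y /=; rewrite -sqrtr_sqr ler_sqrt ?addr_ge0 ?sqr_ge0// lerDl sqr_ge0.
Qed.

Lemma Im_le_nrm (z : C) : `|complex.Im z| <= nrm z.
Proof.
by case: z => x y /=; rewrite -sqrtr_sqr ler_sqrt ?addr_ge0 ?sqr_ge0// lerDr sqr_ge0.
Qed.

Lemma nrm_le (z : C) : nrm z <= `|complex.Re z| + `|complex.Im z|.
Proof.
case: z => x y /=; rewrite -[leRHS]ger0_norm ?addr_ge0// -sqrtr_sqr.
rewrite ler_sqrt ?sqr_ge0// sqrrD !real_normK ?num_real// addrAC lerDl mulrn_wge0//.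
Qed.

Lemma nrm_nat (n : nat) : nrm n%:R = n%:R.
Proof. by rewrite -(rmorph_nat (real_complex R)) /= expr0n addr0 sqrtr_sqr normr_nat. Qed.

Lemma nrm_natX (N n : nat) : nrm (N%:R ^+ n) = N%:R ^+ n.
Proof. by rewrite -natrX nrm_nat natrX. Qed.

Lemma cvgC0P u : cvgC u 0 <->
  forall e : R, 0 < e -> exists N0, forall N, (N0 <= N)%N -> nrm (u N) <= e.
Proof.
split=> [[c1 c2] e e0|H].
  have e2 : 0 < e / 2 by rewrite divr_gt0.
  have /cvgr0Pnorm_le/(_ _ e2)[n1 _ h1] := c1.
  have /cvgr0Pnorm_le/(_ _ e2)[n2 _ h2] := c2.
  exists (maxn n1 n2) => N; rewrite geq_max => /andP[l1 l2].
  apply: (le_trans (nrm_le _)); rewrite [leRHS](splitr e) lerD//; [exact: h1|exact: h2].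
split; apply/cvgr0Pnorm_le => e e0; have [n0 h0] := H _ e0; exists n0 => // N /= lN.
  by apply: le_trans (h0 _ lN); exact: Re_le_nrm.
by apply: le_trans (h0 _ lN); exact: Im_le_nrm.
Qed.

Lemma cvgC_sub u c : cvgC u c <-> cvgC (fun N => u N - c) 0.
Proof.
have ReB (x y : C) : complex.Re (x - y) = complex.Re x - complex.Re y.
  by case: x; case: y.
have ImB (x y : C) : complex.Im (x - y) = complex.Im x - complex.Im y.
  by case: x; case: y.
rewrite /cvgC; under [X in _ <-> X @ _ --> _ /\ _]eq_fun do rewrite ReB.
under [X in _ <-> _ /\ (X @ _ --> _)]eq_fun do rewrite ImB.
split=> -[c1 c2]; split.
- have H := cvgB c1 (cvg_cst (complex.Re c)); rewrite subrr in H; exact: H.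
- have H := cvgB c2 (cvg_cst (complex.Im c)); rewrite subrr in H; exact: H.
- have H := cvgD c1 (cvg_cst (complex.Re c)); rewrite add0r in H.
  have -> : (fun n => complex.Re (u n)) = (fun n => complex.Re (u n) - complex.Re c + complex.Re c).
    by apply/funext => n; rewrite subrK.
  exact: H.
- have H := cvgD c2 (cvg_cst (complex.Im c)); rewrite add0r in H.
  have -> : (fun n => complex.Im (u n)) = (fun n => complex.Im (u n) - complex.Im c + complex.Im c).
    by apply/funext => n; rewrite subrK.
  exact: H.
Qed.

Definition bnd u := exists K N0, forall N, (N0 <= N)%N -> nrm (u N) <= K.

Definition eqk (k : nat) u v := cvgC (fun N => N%:R ^+ k * (u N - v N)) 0.

Lemma eqkP k u v : eqk k u v <-> forall e : R, 0 < e ->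
  exists N0, forall N, (N0 <= N)%N -> N%:R ^+ k * nrm (u N - v N) <= e.
Proof.
rewrite /eqk cvgC0P; have E N : nrm (N%:R ^+ k * (u N - v N)) = N%:R ^+ k * nrm (u N - v N).
  by rewrite ComplexField.Normc.normcM nrm_natX.
by split=> H e /H[N0 h]; exists N0 => N /h; rewrite E.
Qed.

(** Size 0 is excluded because there [N%:R^-1] is 0 and even the identity has normalized trace 0, so
    the identities at finite N fail. *)
Lemma eqk_eq k u v : (forall N, (0 < N)%N -> u N = v N) -> eqk k u v.
Proof.
move=> H; apply/eqkP => e e0; exists 1%N => N N1.
by rewrite H// subrr ComplexField.Normc.normc0 mulr0 ltW.
Qed.

Lemma eqk_refl k u : eqk k u u.
Proof. exact: eqk_eq. Qed.

Lemma eqk_sym k u v : eqk k u v -> eqk k v u.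
Proof.
by move=> /eqkP H; apply/eqkP => e /H[N0 h]; exists N0 => N /h; rewrite -normcN opprB.
Qed.

Lemma eqk_add k u v u' v' : eqk k u v -> eqk k u' v' ->
  eqk k (fun N => u N + u' N) (fun N => v N + v' N).
Proof.
move=> /eqkP H /eqkP H'; apply/eqkP => e e0; have e2 : 0 < e / 2 by rewrite divr_gt0.
have [n1 h1] := H _ e2; have [n2 h2] := H' _ e2.
exists (maxn n1 n2) => N; rewrite geq_max => /andP[l1 l2].
rewrite [leRHS](splitr e); apply: le_trans (lerD (h1 _ l1) (h2 _ l2)).
rewrite -mulrDr ler_wpM2l ?exprn_ge0// opprD addrACA; exact: le_normcD.
Qed.

Lemma eqk_trans k v u u' : eqk k u v -> eqk k v u' -> eqk k u u'.
Proof.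
move=> /eqk_add H /H{}H; apply/eqkP => e e0; move/eqkP : H => /(_ e e0)[N0 h].
exists N0 => N /h; rewrite (_ : u N + v N - (v N + u' N) = u N - u' N)//.
by rewrite opprD addrA addrK.
Qed.

Lemma bnd_eqk k u v : eqk k u v -> bnd v -> bnd u.
Proof.
move=> /eqkP/(_ 1 ltr01)[n1 h1] [K [n2 h2]].
exists (1 + K), (maxn 1 (maxn n1 n2)) => N; rewrite !geq_max => /and3P[l0 l1 l2].
rewrite -[u N](subrK (v N)); apply: (le_trans (le_normcD _ _)); apply: lerD; last exact: h2.
apply: le_trans (h1 _ l1); rewrite ler_peMl ?nrm_ge0// exprn_ege1// ler1n//.
Qed.

Lemma bnd_cst c : bnd (fun=> c).
Proof. by exists (nrm c), 0%N. Qed.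

Lemma bnd_add u v : bnd u -> bnd v -> bnd (fun N => u N + v N).
Proof.
move=> [K [n1 h1]] [K' [n2 h2]]; exists (K + K'), (maxn n1 n2) => N.
rewrite geq_max => /andP[l1 l2]; apply: (le_trans (le_normcD _ _)).
by apply: lerD; [exact: h1|exact: h2].
Qed.

Lemma bnd_mul u v : bnd u -> bnd v -> bnd (fun N => u N * v N).
Proof.
move=> [K [n1 h1]] [K' [n2 h2]]; exists (K * K'), (maxn n1 n2) => N.
rewrite geq_max => /andP[l1 l2]; rewrite ComplexField.Normc.normcM.
by apply: ler_pM; rewrite ?nrm_ge0//; [exact: h1|exact: h2].
Qed.

Lemma bnd_prod (I : Type) (r : seq I) (p : pred I) (F : I -> nat -> C) :
  (forall i, p i -> bnd (F i)) -> bnd (fun N => \prod_(i <- r | p i) F i N).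
Proof.
move=> H; elim: r => [|x r ih]; first by under eq_fun do rewrite big_nil; exact: bnd_cst.
case px : (p x); last by under eq_fun do rewrite big_cons px.
by under eq_fun do rewrite big_cons px; apply: bnd_mul => //; exact: H.
Qed.

Lemma bnd_sum (I : Type) (r : seq I) (p : pred I) (F : I -> nat -> C) :
  (forall i, p i -> bnd (F i)) -> bnd (fun N => \sum_(i <- r | p i) F i N).
Proof.
move=> H; elim: r => [|x r ih]; first by under eq_fun do rewrite big_nil; exact: bnd_cst.
case px : (p x); last by under eq_fun do rewrite big_cons px.
by under eq_fun do rewrite big_cons px; apply: bnd_add => //; exact: H.
Qed.

Lemma eqk_mul k u v u' v' : eqk k u v -> eqk k u' v' -> bnd v -> bnd v' ->
  eqk k (fun N => u N * u' N) (fun N => v N * v' N).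
Proof.
move=> H H' bv bv'; have [K [n1 h1]] := bv; have [K' [n2 h2]] := bnd_eqk H' bv'.
have K1 : 0 < `|K| + 1 by rewrite ltr_wpDl.
have K2 : 0 < `|K'| + 1 by rewrite ltr_wpDl.
apply/eqkP => e e0; move/eqkP : H => /(_ (e / 2 / (`|K'| + 1)))[|n3 h3].
  by rewrite !divr_gt0.
move/eqkP : H' => /(_ (e / 2 / (`|K| + 1)))[|n4 h4]; first by rewrite !divr_gt0.
exists (maxn (maxn n1 n2) (maxn n3 n4)) => N; rewrite !geq_max -!andbA => /and4P[l1 l2 l3 l4].
have -> : u N * u' N - v N * v' N = (u N - v N) * u' N + v N * (u' N - v' N) by ring.
rewrite [leRHS](splitr e).
apply: (@le_trans _ _ (N%:R ^+ k * (nrm (u N - v N) * (`|K'| + 1) + (`|K| + 1) * nrm (u' N - v' N)))).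
  rewrite ler_wpM2l ?exprn_ge0//; apply: (le_trans (le_normcD _ _)).
  rewrite !ComplexField.Normc.normcM; apply: lerD.
    rewrite ler_wpM2l ?nrm_ge0//; apply: (le_trans (h2 _ l2)).
    by rewrite (le_trans (ler_norm _))// lerDl.
  rewrite ler_wpM2r ?nrm_ge0//; apply: (le_trans (h1 _ l1)).
  by rewrite (le_trans (ler_norm _))// lerDl.
rewrite mulrDr; apply: lerD.
  by rewrite mulrA -ler_pdivlMr//; exact: h3.
by rewrite mulrCA mulrC -ler_pdivlMr//; exact: h4.
Qed.

Lemma eqk_scale k c u v : eqk k u v -> eqk k (fun N => c * u N) (fun N => c * v N).
Proof.
move=> H; apply/eqkP => e e0.
have K1 : 0 < nrm c + 1 by rewrite ltr_wpDl// nrm_ge0.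
move/eqkP : H => /(_ (e / (nrm c + 1)))[|N0 h]; first by rewrite divr_gt0.
exists N0 => N /h; rewrite ler_pdivlMr// -mulrBr ComplexField.Normc.normcM; apply: le_trans.
rewrite mulrA mulrAC ler_wpM2l ?mulr_ge0 ?exprn_ge0 ?nrm_ge0// lerDl ler01//.
Qed.

Lemma eqk_sub k u v u' v' : eqk k u v -> eqk k u' v' ->
  eqk k (fun N => u N - u' N) (fun N => v N - v' N).
Proof.
move=> H /(eqk_scale (-1)) H'; have := eqk_add H H'.
by under eq_fun do rewrite mulN1r; under [in X in eqk _ _ X]eq_fun do rewrite mulN1r.
Qed.

Lemma eqk_sum k (I : eqType) (r : seq I) (F G : I -> nat -> C) :
  (forall i, i \in r -> eqk k (F i) (G i)) ->
  eqk k (fun N => \sum_(i <- r) F i N) (fun N => \sum_(i <- r) G i N).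
Proof.
elim: r => [|x r ih] H; first by apply: eqk_eq => N _; rewrite !big_nil.
under eq_fun do rewrite big_cons; under [in X in eqk _ _ X]eq_fun do rewrite big_cons.
apply: eqk_add; first by apply: H; rewrite mem_head.
by apply: ih => i ir; apply: H; rewrite inE ir orbT.
Qed.

Lemma eqk_prod k (I : eqType) (r : seq I) (F G : I -> nat -> C) :
  (forall i, i \in r -> eqk k (F i) (G i) /\ bnd (G i)) ->
  eqk k (fun N => \prod_(i <- r) F i N) (fun N => \prod_(i <- r) G i N) /\
  bnd (fun N => \prod_(i <- r) G i N).
Proof.
elim: r => [|x r ih] H.
  split; first by apply: eqk_eq => N _; rewrite !big_nil.
  by under eq_fun do rewrite big_nil; exact: bnd_cst.
have [e1 b1] := H x (mem_head _ _).
have [|e2 b2] := ih; first by move=> i ir; apply: H; rewrite inE ir orbT.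
split; last by under eq_fun do rewrite big_cons; exact: bnd_mul.
under eq_fun do rewrite big_cons; under [in X in eqk _ _ X]eq_fun do rewrite big_cons.
exact: eqk_mul.
Qed.

Lemma eqkW u v : eqk 1 u v -> eqk 0 u v.
Proof.
move=> /eqkP H; apply/eqkP => e /H[N0 h]; exists (maxn 1 N0) => N.
rewrite geq_max => /andP[l1 /h]; apply: le_trans.
by rewrite expr0 expr1 ler_wpM2r ?nrm_ge0// ler1n.
Qed.

Lemma eqk_eps u v : eqk 0 u v -> eqk 1 (fun N => N%:R^-1 * u N) (fun N => N%:R^-1 * v N).
Proof.
move=> /eqkP H; apply/eqkP => e /H[N0 h]; exists (maxn 1 N0) => N.
rewrite geq_max => /andP[l1 /h]; apply: le_trans.
rewrite expr0 expr1 mul1r -mulrBr ComplexField.Normc.normcM ComplexField.Normc.normcV nrm_nat.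
by rewrite mulrA divff ?mul1r// pnatr_eq0 -lt0n.
Qed.

Lemma bnd_eps u : bnd u -> eqk 0 (fun N => N%:R^-1 * u N) (fun=> 0).
Proof.
move=> [K [n0 h]]; apply/eqkP => e e0.
pose n1 := (Num.truncn (`|K| / e)).+1; exists (maxn n1 n0) => N; rewrite geq_max => /andP[l1 /h l0].
rewrite expr0 mul1r subr0 ComplexField.Normc.normcM ComplexField.Normc.normcV nrm_nat.
have N0 : 0 < N%:R :> R by rewrite ltr0n; apply: leq_trans l1.
rewrite mulrC ler_pdivrMr//; apply: (le_trans l0); apply: (le_trans (ler_norm _)).
rewrite mulrC -ler_pdivrMr//; apply: ltW; apply: lt_le_trans (_ : n1%:R <= _).
  by rewrite /n1; apply: truncnS_gt.
by rewrite ler_nat.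
Qed.

Lemma bnd_inv : bnd (fun N => N%:R^-1).
Proof.
exists 1, 1%N => N N1; rewrite ComplexField.Normc.normcV nrm_nat invf_le1 ?ltr0n// ler1n//.
Qed.

Lemma bnd_eps2 k u : (k <= 1)%N -> bnd u -> eqk k (fun N => N%:R^-1 * (N%:R^-1 * u N)) (fun=> 0).
Proof.
move=> k1 bu.
have H : eqk 1 (fun N => N%:R^-1 * (N%:R^-1 * u N)) (fun=> 0).
  by have := eqk_eps (bnd_eps bu); under [in X in eqk _ _ X]eq_fun do rewrite mulr0.
by case: k k1 => [|[|//]] _; [exact: eqkW|].
Qed.

(** For k = 0 this is convergence to a, for k = 1 an expansion to first order; one definition for
    both lets the same induction run at k = 0 and then at k = 1. *)
Definition conv k u := exists a b, eqk k u (fun N => a + N%:R^-1 * b).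

Lemma bnd_affine a b : bnd (fun N => a + N%:R^-1 * b).
Proof. by apply: bnd_add; [exact: bnd_cst|apply: bnd_mul; [exact: bnd_inv|exact: bnd_cst]]. Qed.

Lemma conv_bnd k u : conv k u -> bnd u.
Proof. by move=> [a [b /bnd_eqk]]; apply; exact: bnd_affine. Qed.

Lemma conv_eqk k u v : eqk k u v -> conv k v -> conv k u.
Proof. by move=> H [a [b H']]; exists a, b; exact: eqk_trans H'. Qed.

Lemma conv_cst k c : conv k (fun=> c).
Proof. by exists c, 0; apply: eqk_eq => N _; rewrite mulr0 addr0. Qed.

Lemma conv_add k u v : conv k u -> conv k v -> conv k (fun N => u N + v N).
Proof.
move=> [a [b H]] [a' [b' H']]; exists (a + a'), (b + b').
apply: (eqk_trans (eqk_add H H')); apply: eqk_eq => N _; rewrite mulrDr; ring.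
Qed.

Lemma conv_mul k u v : (k <= 1)%N -> conv k u -> conv k v -> conv k (fun N => u N * v N).
Proof.
move=> k1 [a [b H]] [a' [b' H']]; exists (a * a'), (a * b' + b * a').
apply: (eqk_trans (eqk_mul H H' (bnd_affine _ _) (bnd_affine _ _))).
apply: (@eqk_trans k (fun N => a * a' + N%:R^-1 * (a * b' + b * a') +
   N%:R^-1 * (N%:R^-1 * (b * b')))); first by apply: eqk_eq => N _; ring.
apply: (@eqk_trans k (fun N => a * a' + N%:R^-1 * (a * b' + b * a') + 0)).
  by apply: eqk_add; [exact: eqk_refl|apply: bnd_eps2 => //; exact: bnd_cst].
by apply: eqk_eq => N _; rewrite addr0.
Qed.

Lemma conv_scale k c u : conv k u -> conv k (fun N => c * u N).
Proof.
move=> [a [b /(eqk_scale c) H]]; exists (c * a), (c * b); apply: (eqk_trans H).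
by apply: eqk_eq => N _; ring.
Qed.

Lemma conv_sum k (I : eqType) (r : seq I) (F : I -> nat -> C) :
  (forall i, i \in r -> conv k (F i)) -> conv k (fun N => \sum_(i <- r) F i N).
Proof.
elim: r => [|x r ih] H; first by under eq_fun do rewrite big_nil; exact: conv_cst.
under eq_fun do rewrite big_cons; apply: conv_add; first by apply: H; rewrite mem_head.
by apply: ih => i ir; apply: H; rewrite inE ir orbT.
Qed.

Lemma conv0_eps u : bnd u -> conv 0 (fun N => N%:R^-1 * u N).
Proof. by move=> bu; apply: (conv_eqk (bnd_eps bu)); exact: conv_cst. Qed.

Lemma conv1_eps u : conv 0 u -> conv 1 (fun N => N%:R^-1 * u N).
Proof.
move=> [a [b H]]; apply: (conv_eqk (eqk_eps H)); exists 0, a.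
apply: (@eqk_trans 1 (fun N => N%:R^-1 * a + N%:R^-1 * (N%:R^-1 * b))).
  by apply: eqk_eq => N _; ring.
apply: (@eqk_trans 1 (fun N => N%:R^-1 * a + 0)).
  by apply: eqk_add; [exact: eqk_refl|apply: bnd_eps2 => //; exact: bnd_cst].
by apply: eqk_eq => N _; ring.
Qed.

Lemma eqk0_cvgC u c : eqk 0 u (fun=> c) -> cvgC u c.
Proof. by rewrite /eqk => H; apply/cvgC_sub; under eq_fun do rewrite -[_ - _]mul1r. Qed.

Lemma cvgC_bnd u c : cvgC u c -> bnd u.
Proof.
move=> /cvgC_sub H; apply: (@bnd_eqk 0 _ (fun=> c)); last exact: bnd_cst.
by rewrite /eqk; under eq_fun do rewrite mul1r.
Qed.

Lemma cvgC_unique u a b : cvgC u a -> cvgC u b -> a = b.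
Proof.
move=> [a1 a2] [b1 b2]; apply/eqP; rewrite eq_complex.
by rewrite (cvg_unique _ a1 b1)// (cvg_unique _ a2 b2)// !eqxx.
Qed.

Lemma eqk1_affine0 u a b : eqk 1 u (fun N => a + N%:R^-1 * b) -> eqk 0 u (fun=> a).
Proof.
move=> /eqkW H; apply: (eqk_trans H); rewrite -[X in eqk _ _ (fun=> X)]addr0.
by apply: eqk_add; [exact: eqk_refl|apply: bnd_eps; exact: bnd_cst].
Qed.

Lemma eqk1_affineP u a b : eqk 1 u (fun N => a + N%:R^-1 * b) ->
  cvgC u a /\ cvgC (fun N => N%:R * (u N - a)) b.
Proof.
move=> H; split; first exact/eqk0_cvgC/(eqk1_affine0 H).
apply: eqk0_cvgC; apply/eqkP => e; move/eqkP: H => H /H[N0 h].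
exists (maxn 1 N0) => N; rewrite geq_max => /andP[l1 /h].
rewrite expr0 expr1 mul1r; apply: le_trans; rewrite -[X in _ <= X * _]nrm_nat.
rewrite -ComplexField.Normc.normcM.
rewrite (_ : N%:R * (u N - (a + N%:R^-1 * b)) = N%:R * (u N - a) - b)//.
by rewrite opprD addrA mulrBr mulrA divff ?mul1r// pnatr_eq0 -lt0n.
Qed.

(** This turns an identity between expansions into separate identities for the limit and for the 1/N
    coefficient. *)
Lemma eqk1_affine_unique a b a' b' :
  eqk 1 (fun N => a + N%:R^-1 * b) (fun N => a' + N%:R^-1 * b') -> a = a' /\ b = b'.
Proof.
move=> /eqk1_affineP[c1 c2].
have [c3 c4] := eqk1_affineP (eqk_refl 1 (fun N => a + N%:R^-1 * b)).
have aa : a = a' := cvgC_unique c3 c1.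
by split=> //; apply: (cvgC_unique c4); rewrite aa in c2 *.
Qed.

End asymptotics.

(** * Moments of words *)

Section word_moments.
Context {R : realType} {L : finType} {F : eqType} (fam : L -> F).
Local Notation C := R[i].
Local Notation nrm := (@ComplexField.Normc.normc R).
Local Notation word := (seq L).
Variable m : nat -> seq word -> C.
Implicit Types (w : word) (c Q : seq word).

Definition mono w := constant [seq fam x | x <- w].
Definition valid c := [::] \notin c.
Definition tlen c := size (flatten c).

(** [s1] and [s2] are fixed before [Q]; only the N^-2 part may depend on it. Comparing the expansion
    for a general [Q] with the one for the empty [Q] is what yields factorization. *)
Definition reducible w :=
  exists (s1 : seq (C * (word * word))) (s2 : seq (C * word)),
  [/\ forall x, x \in s1 ->
        [/\ x.2.1 != [::], x.2.2 != [::] & (size x.2.1 + size x.2.2 = size w)%N],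
      forall x, x \in s2 -> size x.2 = size w &
      forall Q, valid Q -> exists2 s3 : seq (C * seq word),
        forall x, x \in s3 -> valid x.2 /\ tlen x.2 = tlen (w :: Q) &
        forall N, (0 < N)%N -> m N (w :: Q) =
          \sum_(x <- s1) x.1 * m N (x.2.1 :: x.2.2 :: Q) +
          N%:R^-1 * (\sum_(x <- s2) x.1 * m N (x.2 :: Q)) +
          N%:R^-1 * (N%:R^-1 * \sum_(x <- s3) x.1 * m N x.2)].

Hypothesis m_perm : forall N c c', perm_eq c c' -> m N c = m N c'.
Hypothesis m_red : forall w, ~~ mono w -> reducible w.
Hypothesis m_mono_prod : forall c, valid c -> all mono c ->
  eqk 1 (m^~ c) (fun N => \prod_(w <- c) m N [:: w]).
Hypothesis m_mono_conv : forall w, w != [::] -> mono w -> conv 1 (m^~ [:: w]).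

Lemma size_valid c : valid c -> (size c <= tlen c)%N.
Proof.
rewrite /tlen; elim: c => //= w c ih; rewrite /valid inE negb_or eq_sym => /andP[w0 vc].
by rewrite size_cat -add1n leq_add ?ih// lt0n size_eq0.
Qed.

Lemma valid_cons w c : valid (w :: c) = (w != [::]) && valid c.
Proof. by rewrite /valid inE negb_or eq_sym. Qed.

Lemma tlen_cons w c : tlen (w :: c) = (size w + tlen c)%N.
Proof. by rewrite /tlen /= size_cat. Qed.

Lemma not_all_mono c : valid c -> ~~ all mono c -> exists w Q,
  [/\ ~~ mono w, w != [::], valid Q, perm_eq c (w :: Q) & tlen c = tlen (w :: Q)].
Proof.
move=> vc /allPn[w wc nw]; exists w, (rem w c).
have pe := perm_to_rem wc.
have := vc; rewrite /valid (perm_mem pe) -[_ \notin _]/(valid _) valid_cons => /andP[w0 vQ].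
by split=> //; rewrite /tlen (perm_size (perm_flatten pe)).
Qed.

Lemma mono_bnd c : valid c -> all mono c -> bnd (m^~ c).
Proof.
move=> vc mc; apply: (bnd_eqk (m_mono_prod vc mc)).
rewrite (_ : (fun N => _) = (fun N => \prod_(w <- c | (w != [::]) && mono w) m N [:: w])).
  by apply: bnd_prod => w /andP[w0 mw]; exact: (conv_bnd (m_mono_conv w0 mw)).
apply/funext => N; rewrite [in RHS]big_mkcond/=; apply: eq_big_seq => w wc.
rewrite (allP mc) // (_ : w != [::])//.
by apply: contraNneq vc => <-.
Qed.

Lemma insub_bseqK (T : Type) D (s : seq T) : (size s <= D)%N -> bseqval (insub_bseq D s) = s.
Proof. by move=> sD; rewrite /insub_bseq /insubd insubT. Qed.

(** A valid configuration of total length D has at most D words of at most D letters, so bounded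
    sequences enumerate all of them. *)
Definition configs D : seq (seq word) :=
  [seq c <- [seq [seq bseqval y | y <- bseqval x] | x <- enum {: {bseq D of {bseq D of L}}}]
       | valid c && (tlen c == D)].

Lemma mem_configs D c : valid c -> tlen c = D -> c \in configs D.
Proof.
move=> vc tc; rewrite mem_filter vc tc eqxx/=.
have sc : (size c <= D)%N by rewrite -tc size_valid.
have sw w : w \in c -> (size w <= D)%N.
  move=> wc; rewrite -tc /tlen size_flatten /shape sumnE.
  by rewrite big_map (big_rem w)//= leq_addr.
pose y := insub_bseq D [seq insub_bseq D w | w <- c].
apply/mapP; exists y; first by rewrite mem_enum.
rewrite /y insub_bseqK ?size_map// -map_comp map_id_in// => w wc /=.
by rewrite insub_bseqK// sw.
Qed.

(* The moments of all configurations with a given total length satisfy a linear system that is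
   triangular up to O(1/N): each is bounded by K (1 + M/N), where M is the sum of their moduli,
   hence M itself is bounded. *)
Lemma moments_bnd c : valid c -> bnd (m^~ c).
Proof.
move=> vc0; pose D := tlen c; pose M N := \sum_(c <- configs D) nrm (m N c).
have M0 N : 0 <= M N by apply: sumr_ge0 => *; exact: nrm_ge0.
have e0 N : 0 <= N%:R^-1 :> R by rewrite invr_ge0.
pose B u := exists2 K, 0 <= K & exists N0, forall N, (N0 <= N)%N -> (0 < N)%N ->
   nrm (u N) <= K * (1 + N%:R^-1 * M N).
have B1 N : 1 <= 1 + N%:R^-1 * M N by rewrite lerDl mulr_ge0.
have Badd u v : B u -> B v -> B (fun N => u N + v N).
  move=> [K K0 [n1 h1]] [K' K0' [n2 h2]]; exists (K + K'); first exact: addr_ge0.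
  exists (maxn n1 n2) => N; rewrite geq_max => /andP[l1 l2] N0.
  by apply: (le_trans (le_normcD _ _)); rewrite mulrDl lerD ?h1 ?h2.
have Bscale a u : B u -> B (fun N => a * u N).
  move=> [K K0 [n1 h1]]; exists (nrm a * K); first by rewrite mulr_ge0 ?nrm_ge0.
  exists n1 => N l1 N0; rewrite ComplexField.Normc.normcM -mulrA ler_wpM2l ?nrm_ge0//.
  exact: h1.
have Bsum (I : eqType) (r : seq I) (f : I -> nat -> C) :
    (forall i, i \in r -> B (f i)) -> B (fun N => \sum_(i <- r) f i N).
  elim: r => [|x r ih] H.
    exists 0 => //; exists 0%N => N _ _.
    by rewrite big_nil ComplexField.Normc.normc0 mul0r.
  under eq_fun do rewrite big_cons; apply: Badd; first by apply: H; rewrite mem_head.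
  by apply: ih => i ir; apply: H; rewrite inE ir orbT.
have Bbnd u : bnd u -> B u.
  move=> [K [n1 h1]]; exists `|K| => //; exists n1 => N l1 N0; apply: (le_trans (h1 _ l1)).
  by apply: (le_trans (ler_norm _)); rewrite ler_peMr.
have Bm c' : valid c' -> tlen c' = D -> B (fun N => N%:R^-1 * m N c').
  move=> vc tc; exists 1 => //; exists 0%N => N _ N0.
  rewrite mul1r ComplexField.Normc.normcM ComplexField.Normc.normcV nrm_nat.
  apply: (@le_trans _ _ (N%:R^-1 * M N)); last by rewrite lerDr.
  rewrite ler_wpM2l// /M (big_rem c')/= ?mem_configs// lerDl.
  by apply: sumr_ge0 => *; exact: nrm_ge0.
have Beps u : B u -> B (fun N => N%:R^-1 * u N).
  move=> [K K0 [n1 h1]]; exists K => //; exists n1 => N l1 N0.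
  rewrite ComplexField.Normc.normcM ComplexField.Normc.normcV nrm_nat.
  apply: le_trans (h1 _ l1 N0); rewrite ler_piMl ?nrm_ge0// invf_le1 ?ltr0n// ler1n//.
(* Here n bounds D minus the number of words, and splitting a word adds one. A configuration of D
   words has only one-letter words, which are [mono]. *)
have key n : forall c', valid c' -> tlen c' = D -> (D <= size c' + n)%N -> B (m^~ c').
  elim: n => [|n ih] c' vc tc sc.
    have [mc|] := boolP (all mono c'); first by apply: Bbnd; exact: mono_bnd.
    move=> /(not_all_mono vc)[w [Q [nw w0 vQ pe te]]].
    have [s1 [s2 [h1 _ _]]] := m_red nw; exfalso.
    move: sc; rewrite addn0 -tc te tlen_cons (perm_size pe)/= => sc.
    have sw : size w = 1%N.
      have := size_valid vQ; move: sc; rewrite -[(size Q).+1]add1n => sc sQ.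
      by apply/eqP; rewrite eqn_leq lt0n size_eq0 w0 andbT -(leq_add2r (tlen Q))
        (leq_trans sc)// leq_add2l.
    by case: w sw nw {te pe sc w0 h1} => // x [].
  have [mc|] := boolP (all mono c'); first by apply: Bbnd; exact: mono_bnd.
  move=> /(not_all_mono vc)[w [Q [nw w0 vQ pe te]]].
  have [s1 [s2 [h1 h2 /(_ _ vQ)[s3 h3 mE]]]] := m_red nw.
  pose f N := \sum_(x <- s1) x.1 * m N (x.2.1 :: x.2.2 :: Q) +
          (\sum_(x <- s2) x.1 * (N%:R^-1 * m N (x.2 :: Q))) +
          N%:R^-1 * (\sum_(x <- s3) x.1 * (N%:R^-1 * m N x.2)).
  have Bf : B f.
    apply: (Badd); [apply: (Badd)|].
    - apply: Bsum => x /h1[u0 v0 sx]; apply: Bscale; apply: ih.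
      + by rewrite !valid_cons u0 v0.
      + by rewrite !tlen_cons addnA sx -tlen_cons -te.
      + by move: sc; rewrite (perm_size pe) /= -addSnnS.
    - apply: Bsum => x /h2 sx; apply: Bscale; apply: Bm.
        by rewrite valid_cons vQ -size_eq0 sx size_eq0 w0.
      by rewrite tlen_cons sx -tlen_cons -te.
    - apply: Beps; apply: Bsum => x /h3[v3 t3]; apply: Bscale; apply: Bm => //.
      by rewrite t3 -te.
  have [K K0 [n1 h]] := Bf; exists K => //; exists n1 => N l1 N0.
  rewrite (m_perm N pe) mE//; have := h _ l1 N0; rewrite /f.
  congr (nrm (_ + _ + _ * _) <= _); rewrite big_distrr/=;
    by apply: eq_bigr => x _; rewrite mulrCA.
have [K K0 [n0 hM]] : exists2 K, 0 <= K & exists N0, forall N, (N0 <= N)%N -> (0 < N)%N ->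
    M N <= K * (1 + N%:R^-1 * M N).
  rewrite /M; have : {subset configs D <= configs D} by [].
  elim: {1 3}(configs D) => [|c' r ih] sub.
    by exists 0 => //; exists 0%N => N _ _; rewrite big_nil mul0r.
  have [|K K0 [n1 h1]] := ih; first by move=> x xr; apply: sub; rewrite inE xr orbT.
  have : c' \in configs D by apply: sub; rewrite mem_head.
  rewrite mem_filter => /andP[/andP[v' /eqP t'] _].
  have [K' K0' [n2 h2]] := key D c' v' t' (leq_addl _ _).
  exists (K' + K); first exact: addr_ge0.
  exists (maxn n1 n2) => N; rewrite geq_max => /andP[l1 l2] N0.
  by rewrite big_cons mulrDl lerD ?h1 ?h2.
(* From this index on K / N <= 1/2, so M <= K + (K / N) M gives M <= 2 K. *)
pose n1 := (Num.truncn (2 * K)).+1.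
exists (2 * K), (maxn n1 n0) => N; rewrite geq_max => /andP[l1 l0].
have N0 : (0 < N)%N by apply: leq_trans l1.
apply: (@le_trans _ _ (M N)).
  rewrite /M (big_rem c)/= ?mem_configs// lerDl.
  by apply: sumr_ge0 => *; exact: nrm_ge0.
have := hM N l0 N0; rewrite mulrDr mulr1 mulrA.
have : K * N%:R^-1 <= 1 / 2.
  rewrite ler_pdivrMr ?ltr0n// mulrC mulrA mulr1 ler_pdivlMr// mulrC ltW//.
  by apply: lt_le_trans (_ : n1%:R <= _); [exact: truncnS_gt|rewrite ler_nat].
by have := M0 N; set x := K * _; set y := M N; nra.
Qed.

Lemma prod_cons2 (u v : word) Q : (fun N => \prod_(w <- u :: v :: Q) m N [:: w]) =
  (fun N => m N [:: u] * (m N [:: v] * \prod_(w <- Q) m N [:: w])).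
Proof. by apply/funext => N; rewrite !big_cons. Qed.

(** The N^-2 terms disappear because all moments are already bounded, and the 1/N terms factor by
    [Heps]; only the split terms need factorization at full precision k. *)
Lemma reducible_expansion k w : (k <= 1)%N -> ~~ mono w -> w != [::] ->
  (forall c, valid c -> eqk k (fun N => N%:R^-1 * m N c)
     (fun N => N%:R^-1 * \prod_(w <- c) m N [:: w])) ->
  exists (s1 : seq (C * (word * word))) (s2 : seq (C * word)),
  [/\ forall x, x \in s1 ->
        [/\ x.2.1 != [::], x.2.2 != [::] & (size x.2.1 + size x.2.2 = size w)%N],
      forall x, x \in s2 -> size x.2 = size w &
   forall Q, valid Q ->
    (forall x, x \in s1 -> eqk k (m^~ (x.2.1 :: x.2.2 :: Q))
       (fun N => m N [:: x.2.1] * (m N [:: x.2.2] * \prod_(w <- Q) m N [:: w]))) ->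
    eqk k (m^~ (w :: Q)) (fun N => (\sum_(x <- s1) x.1 * (m N [:: x.2.1] * m N [:: x.2.2]) +
          \sum_(x <- s2) x.1 * (N%:R^-1 * m N [:: x.2])) * \prod_(w <- Q) m N [:: w])].
Proof.
move=> k1 nw w0 Heps; have [s1 [s2 [h1 h2 H]]] := m_red nw; exists s1, s2; split=> // Q vQ HQ.
have [s3 h3 mE] := H Q vQ.
apply: (@eqk_trans _ _ (fun N => \sum_(x <- s1) x.1 * m N (x.2.1 :: x.2.2 :: Q) +
          \sum_(x <- s2) x.1 * (N%:R^-1 * m N (x.2 :: Q)) +
          N%:R^-1 * (N%:R^-1 * \sum_(x <- s3) x.1 * m N x.2))).
  apply: eqk_eq => N N0; rewrite mE//; congr (_ + _ + _); rewrite big_distrr/=.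
  by apply: eq_bigr => x _; rewrite mulrCA.
apply: (@eqk_trans _ _ (fun N => \sum_(x <- s1) x.1 * (m N [:: x.2.1] * (m N [:: x.2.2] *
       \prod_(w <- Q) m N [:: w])) + \sum_(x <- s2) x.1 * (N%:R^-1 * (m N [:: x.2] *
        \prod_(w <- Q) m N [:: w])) + 0)); last first.
  apply: eqk_eq => N _; rewrite addr0 mulrDl !big_distrl/=.
  by congr (_ + _); apply: eq_bigr => x _; rewrite !mulrA.
apply: eqk_add; first apply: eqk_add.
- by apply: eqk_sum => x /HQ h; exact: eqk_scale.
- apply: eqk_sum => x /h2 sx; apply: eqk_scale.
  have v2 : valid (x.2 :: Q) by rewrite valid_cons vQ -size_eq0 sx size_eq0 w0.
  by have := Heps _ v2; under [in X in eqk _ _ X]eq_fun do rewrite big_cons.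
- apply: bnd_eps2 => //.
  rewrite (_ : (fun N => _) = (fun N => \sum_(x <- s3 | x \in s3) x.1 * m N x.2)); last first.
    by apply/funext => N; rewrite -big_seq.
  apply: bnd_sum => x /h3[v3 _].
  by apply: bnd_mul; [exact: bnd_cst|exact: moments_bnd].
Qed.

Lemma bnd_prod_words c : valid c -> bnd (fun N => \prod_(w <- c) m N [:: w]).
Proof.
move=> vc.
rewrite (_ : (fun N => _) = (fun N => \prod_(w <- c | w != [::]) m N [:: w])); last first.
  apply/funext => N; rewrite [in RHS]big_mkcond/=; apply: eq_big_seq => q qQ.
  by case: eqP => // q0; move: vc; rewrite /valid -q0 qQ.
by apply: bnd_prod => q q0; apply: moments_bnd; rewrite valid_cons q0.
Qed.

(** Induction on the excess of the total length over the number of words, which a split lowers by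
    one. The hypothesis on moments carrying a factor 1/N follows from boundedness when k = 0, and
    from the case k = 0 when k = 1. *)
Lemma moments_prod_step k : (k <= 1)%N ->
  (forall c, valid c -> eqk k (fun N => N%:R^-1 * m N c)
     (fun N => N%:R^-1 * \prod_(w <- c) m N [:: w])) ->
  forall c, valid c -> eqk k (m^~ c) (fun N => \prod_(w <- c) m N [:: w]).
Proof.
move=> k1 Heps c vc.
have [n] : exists n, (tlen c <= size c + n)%N by exists (tlen c); exact: leq_addl.
elim: n c vc => [|n ih] c vc sc.
  have [mc|] := boolP (all mono c).
    by have := m_mono_prod vc mc; case: k k1 {Heps} => [|[|//]] _; [exact: eqkW|].
  move=> /(not_all_mono vc)[w [Q [nw w0 vQ pe te]]]; exfalso.
  move: sc; rewrite addn0 te tlen_cons (perm_size pe)/= => sc.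
  have sw : size w = 1%N.
    have := size_valid vQ; move: sc; rewrite -[(size Q).+1]add1n => sc sQ.
    by apply/eqP; rewrite eqn_leq lt0n size_eq0 w0 andbT -(leq_add2r (tlen Q))
      (leq_trans sc)// leq_add2l.
  by case: w sw nw {te pe sc w0} => // x [].
have [mc|] := boolP (all mono c).
  by have := m_mono_prod vc mc; case: k k1 {Heps ih} => [|[|//]] _; [exact: eqkW|].
move=> /(not_all_mono vc)[w [Q [nw w0 vQ pe te]]].
have [s1 [s2 [h1 h2 H]]] := reducible_expansion k1 nw w0 Heps.
have sz : (tlen (w :: Q) <= (size Q).+1 + n.+1)%N.
  by rewrite -te; move: sc; rewrite (perm_size pe).
have eQ : eqk k (m^~ (w :: Q)) (fun N => (\sum_(x <- s1) x.1 * (m N [:: x.2.1] * m N [:: x.2.2]) +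
          \sum_(x <- s2) x.1 * (N%:R^-1 * m N [:: x.2])) * \prod_(w <- Q) m N [:: w]).
  apply: H => // x /h1[u0 v0 sx].
  rewrite -prod_cons2; apply: ih; first by rewrite !valid_cons u0 v0.
  by rewrite !tlen_cons addnA sx -tlen_cons (leq_trans sz)//= -addSnnS.
(* The same expansion with [Q] empty: its right-hand side is exactly the first factor in [eQ]. *)
have e1 : eqk k (m^~ [:: w]) (fun N => (\sum_(x <- s1) x.1 * (m N [:: x.2.1] * m N [:: x.2.2]) +
          \sum_(x <- s2) x.1 * (N%:R^-1 * m N [:: x.2]))).
  apply: (eqk_trans (H [::] isT _)) => [x /h1[u0 v0 sx]|]; last first.
    by apply: eqk_eq => N _; rewrite big_nil mulr1.
  rewrite -prod_cons2; apply: ih; first by rewrite !valid_cons u0 v0.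
  have := size_valid vQ; move: sz; rewrite !tlen_cons addnA sx /= /tlen /=; lia.
apply: (@eqk_trans _ _ (m^~ (w :: Q))); first by apply: eqk_eq => N _; exact: m_perm.
apply: (eqk_trans eQ); apply: eqk_sym.
under eq_fun do rewrite (perm_big _ pe) big_cons.
have bQ := bnd_prod_words vQ.
apply: eqk_mul => //; first exact: eqk_refl.
apply: (bnd_eqk (eqk_sym e1)); apply: moments_bnd; rewrite valid_cons w0//.
Qed.

Lemma moments_prod0_eps c : valid c -> eqk 0 (fun N => N%:R^-1 * m N c)
     (fun N => N%:R^-1 * \prod_(w <- c) m N [:: w]).
Proof.
move=> vc; apply: (eqk_trans (bnd_eps (moments_bnd vc))); apply: eqk_sym.
by apply: bnd_eps; exact: bnd_prod_words.
Qed.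

Lemma moments_prod1_eps c : valid c -> eqk 1 (fun N => N%:R^-1 * m N c)
     (fun N => N%:R^-1 * \prod_(w <- c) m N [:: w]).
Proof.
move=> vc; apply: eqk_eps; apply: moments_prod_step => // c'; exact: moments_prod0_eps.
Qed.

Theorem moments_prod c : valid c -> eqk 1 (m^~ c) (fun N => \prod_(w <- c) m N [:: w]).
Proof. by apply: moments_prod_step => // c'; exact: moments_prod1_eps. Qed.

(** Induction on the length of w: split terms are products of moments of strictly shorter words. The
    1/N terms have full length, out of reach of the induction, so their expansion is a hypothesis,
    supplied by the next lower order. *)
Lemma moments_conv_step k : (k <= 1)%N ->
  (forall w, w != [::] -> conv k (fun N => N%:R^-1 * m N [:: w])) ->
  forall w, w != [::] -> conv k (m^~ [:: w]).
Proof.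
move=> k1 Heps w; have [n] := ubnP (size w); elim: n w => // n ih w sw w0.
have [mw|nw] := boolP (mono w).
  have [a [b H]] := m_mono_conv w0 mw; exists a, b.
  by case: k k1 {Heps ih} => [|[|//]] _; [exact: eqkW|].
have He : forall c, valid c -> eqk k (fun N => N%:R^-1 * m N c)
     (fun N => N%:R^-1 * \prod_(w <- c) m N [:: w]).
  case: k k1 {Heps ih} => [|[|//]] _; [exact: moments_prod0_eps|exact: moments_prod1_eps].
have [s1 [s2 [h1 h2 H]]] := reducible_expansion k1 nw w0 He.
apply: (conv_eqk (H [::] isT _)) => [x /h1[u0 v0 _]|].
  by rewrite -prod_cons2; apply: moments_prod_step; rewrite ?valid_cons ?u0 ?v0.
under eq_fun do rewrite big_nil mulr1.
apply: conv_add; apply: conv_sum => x.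
  move=> /h1[u0 v0 sx]; apply: conv_scale; apply: conv_mul => //; apply: ih => //.
    rewrite (leq_trans _ (_ : size w <= n)%N)// -sx -addn1 leq_add2l lt0n size_eq0//.
  rewrite (leq_trans _ (_ : size w <= n)%N)// -sx -add1n leq_add2r lt0n size_eq0//.
move=> /h2 sx; apply: conv_scale; apply: Heps.
by rewrite -size_eq0 sx size_eq0.
Qed.

Theorem moments_conv w : w != [::] -> conv 1 (m^~ [:: w]).
Proof.
apply: moments_conv_step => // w' w0'; apply: conv1_eps; apply: moments_conv_step => // w'' w0''.
by apply: conv0_eps; apply: moments_bnd; rewrite valid_cons w0''.
Qed.

End word_moments.

(** * Factorization for a single family *)

Lemma all_momentsC_ncev_gen (R : realType) (d : measure_display) (T : measurableType d)
    (P : probability T R) (W : Type) N (f : T -> W -> 'M[R[i]]_N) p a b :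
  (forall v a b, all_momentsC P (fun w => f w v a b)) ->
  all_momentsC P (fun w => ncev (f w) p a b).
Proof.
move=> H; elim: p a b => [c|v|v|p ihp q ihq|p ihp q ihq] a b /=.
- exact: all_momentsC_cst.
- exact: H.
- have := H v b a; congr (all_momentsC P _); apply/funext => w; by rewrite mxE.
- have := all_momentsC_add (ihp a b) (ihq a b).
  by congr (all_momentsC P _); apply/funext => w; rewrite mxE.
- have := @all_momentsC_sum _ _ _ P _ (index_enum 'I_N) xpredT _
    (fun c => all_momentsC_mul (ihp a c) (ihq c b)).
  by congr (all_momentsC P _); apply/funext => w; rewrite mxE.
Qed.

Lemma all_momentsC_trRV (R : realType) (d : measure_display) (T : measurableType d)
    (P : probability T R) (W : Type) N (Y : W -> T -> 'M[R[i]]_N) p :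
  (forall v a b, all_momentsC P (fun w => Y v w a b)) -> all_momentsC P (trRV Y p).
Proof.
move=> H; rewrite /trRV /ntr; apply: (@all_momentsC_mul _ _ _ P (cst _)).
  exact: all_momentsC_cst.
apply: all_momentsC_sum => i.
exact: (@all_momentsC_ncev_gen _ _ _ P _ _ (fun w v => Y v w)).
Qed.

Lemma partition_full (T : finType) (pi : {set {set T}}) :
  finset.partition pi [set: T]%SET -> [set: T]%SET \in pi -> pi = [set [set: T]%SET]%SET.
Proof.
move=> /and3P[_ tri n0] Tpi; apply/setP => B; rewrite finset.in_set1.
apply/idP/eqP => [Bpi|-> //]; apply/eqP; apply: contraNT n0 => BT.
have := finset.trivIsetP tri _ _ Bpi Tpi BT.
by rewrite -setI_eq0 finset.setIT => /eqP B0; rewrite -B0.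
Qed.

Section one_family.
Context {R : realType} {d : measure_display} {T : measurableType d}.
Variable P : probability T R.
Context {W : Type}.
Variable Y : forall N : nat, W -> T -> 'M[R[i]]_N.
Local Notation C := R[i].
Arguments Y : clear implicits.
Hypothesis LY : forall N v a b, all_momentsC P (fun w => Y N v w a b).
Hypothesis Y1 : propP1 P Y.
Hypothesis Y2 : propP2 P Y.
Hypothesis Y3 : propP3 P Y.

(** Moebius function of the partition lattice from pi to the one-block partition. *)
Definition mobius r (pi : {set {set 'I_r}}) : C := (-1) ^+ (#|pi|.-1) * ((#|pi|.-1)`!)%:R.

Lemma trRV_conv p : conv 1 (fun N => EC P (trRV (Y N) p)).
Proof.
have [t [t' [_ [_ H]]]] := Y1; exists (t p), (t' p); rewrite /eqk.
by have := H p; under eq_fun do rewrite -addrA -opprD.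
Qed.

Lemma cumulant_TrRV N r (ps : 'I_r -> ncpoly R W) : (0 < N)%N ->
  cumulant P (fun i => TrRV (Y N) (ps i)) =
  N%:R ^+ r * \sum_(pi : {set {set 'I_r}} | finset.partition pi [set: 'I_r]%SET)
    mobius pi * \prod_(B in pi) EC P (fun w => \prod_(i in B) trRV (Y N) (ps i) w).
Proof.
move=> N0; rewrite /cumulant big_distrr/=; apply: eq_bigr => pi ppi.
rewrite mulrCA; congr (_ * _).
have -> : N%:R ^+ r = \prod_(B in pi) \prod_(i in B) (N%:R : C).
  rewrite -(set_partition_big _ ppi)/= prodr_const; congr (_ ^+ _).
  by rewrite cardsT card_ord.
rewrite -big_split/=; apply: eq_bigr => B _.
rewrite prodr_const -EC_scale; last first.
  by apply: all_momentsC_prod => i; exact: all_momentsC_trRV.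
congr (EC _ _); apply/funext => w; rewrite -prodr_const -big_split/=; apply: eq_bigr => i _.
by rewrite /TrRV /trRV /ntr mulrA divff ?mul1r// pnatr_eq0 -lt0n.
Qed.

(** The sum is the joint cumulant of the normalized traces, that is, N^-r times the cumulant of the
    traces, which (P2) or (P3) keeps bounded. As r >= 2, it is O(N^-2). *)
Lemma cumulant_small r (ps : 'I_r -> ncpoly R W) : (2 <= r)%N ->
  eqk 1 (fun N => \sum_(pi : {set {set 'I_r}} | finset.partition pi [set: 'I_r]%SET)
    mobius pi * \prod_(B in pi) EC P (fun w => \prod_(i in B) trRV (Y N) (ps i) w)) (fun=> 0).
Proof.
set S := (X in eqk _ X _) => r2.
have SE N : (0 < N)%N -> S N = N%:R ^- r * cumulant P (fun i => TrRV (Y N) (ps i)).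
  by move=> N0; rewrite cumulant_TrRV// mulKf// expf_neq0// pnatr_eq0 -lt0n.
have bk : bnd (fun N => cumulant P (fun i => TrRV (Y N) (ps i))).
  have [r3|r3] := leqP 3 r.
    have [K [n0 h]] := cvgC_bnd (Y3 r3 ps); exists K, (maxn 1 n0) => N.
    rewrite geq_max => /andP[N0 /h]; apply: le_trans.
    by rewrite ComplexField.Normc.normcM nrm_natX ler_peMl ?nrm_ge0// exprn_ege1// ler1n.
  have r2' : r = 2%N by apply/eqP; rewrite eqn_leq r2 -ltnS r3.
  by subst r; have [l /cvgC_bnd] := Y2 ps.
apply: (@eqk_trans _ _ (fun N => N%:R^-1 * (N%:R^-1 *
    (N%:R ^- (r - 2) * cumulant P (fun i => TrRV (Y N) (ps i)))))).
  apply: eqk_eq => N N0; rewrite SE// !mulrA -!invfM; congr (_^-1 * _).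
  by rewrite -expr2 -exprD subnKC.
apply: bnd_eps2 => //; have [K [n0 h]] := bk; exists K, (maxn 1 n0) => N.
rewrite geq_max => /andP[N0 /h]; apply: le_trans.
rewrite ComplexField.Normc.normcM ComplexField.Normc.normcV nrm_natX ler_piMl ?nrm_ge0//.
by rewrite invf_le1 ?exprn_ege1 ?ler1n// exprn_gt0// ltr0n.
Qed.

(* The vanishing of the sum of the Moebius function over the partition lattice is read off from
   (P2) and (P3) for constant polynomials, whose cumulants must be zero. *)
Lemma sum_mobius r : (2 <= r)%N ->
  \sum_(pi : {set {set 'I_r}} | finset.partition pi [set: 'I_r]%SET) mobius pi = 0.
Proof.
move=> r2; set S := LHS.
have H := @cumulant_small r (fun=> NCconst 1) r2.
have : eqk 1 (fun=> S) (fun=> 0).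
  apply: eqk_trans H; apply: eqk_eq => N N0; apply: eq_bigr => pi _.
  rewrite big1 ?mulr1// => B _; rewrite -[RHS](EC_cst P); congr (EC _ _); apply/funext => w.
  rewrite big1// => i _; rewrite /trRV /ntr /= mxtrace1 mulVf// pnatr_eq0 -lt0n//.
have -> : (fun=> S) = (fun N => S + N%:R^-1 * 0) :> (nat -> C).
  by apply/funext => N; rewrite mulr0 addr0.
have -> : (fun=> 0) = (fun N => 0 + N%:R^-1 * 0) :> (nat -> C).
  by apply/funext => N; rewrite mulr0 addr0.
by move=> /eqk1_affine_unique[].
Qed.

(** Strong induction on r through the moment-cumulant sum. Every partition but the top one has
    blocks smaller than r, so its product of moments may be replaced by [E]. The weights of these
    partitions add up to -1 by [sum_mobius], and the whole sum is negligible by [cumulant_small];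
    hence the top moment agrees with [E]. *)
Lemma trRV_prod r (ps : 'I_r -> ncpoly R W) :
  eqk 1 (fun N => EC P (fun w => \prod_i trRV (Y N) (ps i) w))
        (fun N => \prod_i EC P (trRV (Y N) (ps i))).
Proof.
have [n] := ubnP r; elim: n r ps => // n ih r ps rn.
have [r2|r1] := leqP 2 r; last first.
  case: r ps r1 {rn} => [|[|//]] ps _.
    apply: eqk_eq => N _; rewrite big_ord0 -[RHS](EC_cst P); congr (EC _ _).
    by apply/funext => w; rewrite big_ord0.
  apply: eqk_eq => N _; rewrite big_ord1; congr (EC _ _); apply/funext => w.
  by rewrite big_ord1.
pose e N (B : {set 'I_r}) := EC P (fun w => \prod_(i in B) trRV (Y N) (ps i) w).
pose E N := \prod_i EC P (trRV (Y N) (ps i)).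
have b1 i : bnd (fun N => EC P (trRV (Y N) (ps i))) by exact: conv_bnd (trRV_conv _).
have bE : bnd E by apply: bnd_prod => i _.
have eB (B : {set 'I_r}) : B != [set: 'I_r]%SET ->
    eqk 1 (e^~ B) (fun N => \prod_(i in B) EC P (trRV (Y N) (ps i))).
  move=> BT; have cB : (#|B| < n)%N.
    apply: (@leq_trans #|[set: 'I_r]%SET|); last by rewrite cardsT card_ord.
    by apply: proper_card; rewrite finset.properEneq BT finset.subsetT.
  have := ih #|B| (fun i => ps (enum_val i)) cB.
  rewrite /e; under [in X in _ -> eqk _ X _]eq_fun do
    (under eq_fun do rewrite (big_enum_val (fun i => trRV (Y _) (ps i) _))).
  by under [in X in _ -> eqk _ _ X]eq_fun do rewrite (big_enum_val (fun i => EC P (trRV (Y _) (ps i)))).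
have epi (pi : {set {set 'I_r}}) : finset.partition pi [set: 'I_r]%SET ->
    pi != [set [set: 'I_r]%SET]%SET ->
    eqk 1 (fun N => \prod_(B in pi) e N B) E.
  move=> ppi npi.
  apply: (@eqk_trans _ _ (fun N => \prod_(B <- enum pi) \prod_(i in B) EC P (trRV (Y N) (ps i)))).
    apply: (@eqk_trans _ _ (fun N => \prod_(B <- enum pi) e N B)).
      by apply: eqk_eq => N _; rewrite big_enum.
    apply: (proj1 (eqk_prod _)) => B; rewrite mem_enum => Bpi; split; last exact: bnd_prod.
    apply: eB; apply: contraNneq npi => BT; apply/eqP; apply: partition_full => //.
    by rewrite -BT.
  apply: eqk_eq => N _; rewrite big_enum/= /E -(set_partition_big _ ppi)/=.
  by apply: eq_bigl => i; rewrite finset.in_setT.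
pose top : {set {set 'I_r}} := [set [set: 'I_r]%SET]%SET.
have ptop : finset.partition top [set: 'I_r]%SET.
  apply/and3P; split.
  - by rewrite /finset.cover finset.big_set1.
  - by apply/finset.trivIsetP => A B; rewrite !finset.in_set1 => /eqP-> /eqP->; rewrite eqxx.
  - rewrite finset.in_set1 eq_sym -card_gt0 cardsT card_ord; exact: leq_trans r2.
have m1 : mobius top = 1 by rewrite /mobius cards1 expr0 fact0 mulr1.
have := cumulant_small ps r2; have := sum_mobius r2.
rewrite (bigD1 top)//= m1 => Sm H.
have H' : eqk 1 (fun N => EC P (fun w => \prod_i trRV (Y N) (ps i) w) +
    \sum_(pi : {set {set 'I_r}} | finset.partition pi [set: 'I_r]%SET && (pi != top))
      mobius pi * \prod_(B in pi) e N B) (fun=> 0).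
  apply: eqk_trans H; apply: eqk_eq => N _; rewrite [RHS](bigD1 top)//= m1 mul1r.
  congr (_ + _); rewrite finset.big_set1; congr (EC _ _); apply/funext => w.
  by apply: eq_bigl => i; rewrite finset.in_setT.
have H2 : eqk 1 (fun N => \sum_(pi : {set {set 'I_r}} | finset.partition pi [set: 'I_r]%SET && (pi != top))
      mobius pi * \prod_(B in pi) e N B)
    (fun N => \sum_(pi : {set {set 'I_r}} | finset.partition pi [set: 'I_r]%SET && (pi != top))
      mobius pi * E N).
  have mk (f : nat -> {set {set 'I_r}} -> C) :
    (fun N => \sum_(pi : {set {set 'I_r}} | finset.partition pi [set: 'I_r]%SET && (pi != top)) f N pi) =
    (fun N => \sum_(pi <- [seq pi <- index_enum _ |
        finset.partition pi [set: 'I_r]%SET && (pi != top)]) f N pi).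
    by apply/funext => N; rewrite big_filter.
  rewrite !mk; apply: eqk_sum => pi; rewrite mem_filter => /andP[/andP[p1 p2] _].
  by apply: eqk_scale; exact: epi.
apply: (eqk_trans _ (eqk_trans (eqk_sub H' H2) _)); apply: eqk_eq => N _.
  by rewrite addrK.
rewrite sub0r -big_distrl/= -mulNr -[RHS]mul1r; congr (_ * _).
by apply/eqP; rewrite eq_sym -addr_eq0 Sm.
Qed.

End one_family.

(** * Words in the generators and their transposes *)

Section words.
Context {R : realType} {V : finType}.
Local Notation C := R[i].
Local Notation word := (seq (V * bool)).
Implicit Types (p q l r : ncpoly R V) (u v w : word) (Q : V -> bool).

(* Equality in C<x, x^t>, tested on matrices of all sizes. *)
Definition nceq p q := forall N (f : V -> 'M[C]_N), ncev f p = ncev f q.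

(** The functionals in play are expectations or limits of traces, so this is the equivalence they
    respect; it contains the cyclic shifts. *)
Definition treq p q := forall N (f : V -> 'M[C]_N), \tr (ncev f p) = \tr (ncev f q).

Lemma nceq_treq p q : nceq p q -> treq p q.
Proof. by move=> H N f; rewrite H. Qed.

Definition letter (x : V * bool) : ncpoly R V := if x.2 then NCvarT x.1 else NCvar x.1.
Definition wp w : ncpoly R V := foldr NCmul (NCconst 1) [seq letter x | x <- w].
Definition tw w : word := rev [seq (x.1, ~~ x.2) | x <- w].

Lemma ncev_wp_cat N (f : V -> 'M[C]_N) u v :
  ncev f (wp (u ++ v)) = ncev f (wp u) *m ncev f (wp v).
Proof.
elim: u => [|x u ih] /=; first by rewrite mul1mx.
by rewrite [LHS]/= ih mulmxA.
Qed.

Lemma ncev_wp1 N (f : V -> 'M[C]_N) x : ncev f (wp [:: x]) = ncev f (letter x).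
Proof. by rewrite /wp /= mulmx1. Qed.

Lemma ncev_tw N (f : V -> 'M[C]_N) w : ncev f (wp (tw w)) = (ncev f (wp w))^T.
Proof.
elim: w => [|x w ih]; first by rewrite /= tr_scalar_mx.
rewrite /tw map_cons rev_cons -cats1 ncev_wp_cat -/(tw w) ih ncev_wp1 [in RHS]/= trmx_mul.
by congr (_ *m _); case: x => v [] /=; rewrite ?trmxK.
Qed.

Lemma size_tw w : size (tw w) = size w.
Proof. by rewrite /tw size_rev size_map. Qed.

(** List form of [cut] for a word: signed pairs of factors, with [u] the part already read. Lists
    are used because [reducible] asks for finite data that do not depend on N. *)
Fixpoint cutl Q u w : seq (C * (word * word)) :=
  if w is x :: w1 then
    (if Q x.1 then [:: (1, (u, w)); (-1, (rcons u x, w1))] else [::]) ++ cutl Q (rcons u x) w1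
  else [::].

Lemma cut_wp Q (g : ncpoly R V -> ncpoly R V -> C) l u w r :
  (forall l l' r r', nceq l l' -> nceq r r' -> g l r = g l' r') ->
  nceq l (wp u) -> nceq r (NCconst 1) ->
  cut Q g l (wp w) r = \sum_(t <- cutl Q u w) t.1 * g (wp t.2.1) (wp t.2.2).
Proof.
move=> gE; elim: w l u r => [|x w ih] l u r lu r1; first by rewrite /= big_nil.
have e1 : nceq (NCmul l (letter x)) (wp (rcons u x)).
  by move=> N f /=; rewrite lu -cats1 ncev_wp_cat ncev_wp1.
rewrite [wp _]/= [LHS]/= -/(wp w) (ih _ _ _ e1 r1) [cutl _ _ _]/= big_cat/=; congr (_ + _).
have e2 : nceq (NCmul (wp w) r) (wp w) by move=> N f /=; rewrite r1 /= mulmx1.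
have e3 : nceq (NCmul (letter x) (NCmul (wp w) r)) (wp (x :: w)).
  by move=> N f /=; rewrite r1 /= mulmx1.
case: x e1 e3 => v [] e1 e3 /=; case: (Q v); rewrite ?big_nil// !big_cons big_nil /= addr0.
  by rewrite mul1r mulN1r (gE _ _ _ _ lu e3) (gE _ _ _ _ e1 e2).
by rewrite mul1r mulN1r (gE _ _ _ _ lu e3) (gE _ _ _ _ e1 e2).
Qed.

Lemma cutl_size Q u w t : t \in cutl Q u w ->
  (size t.2.1 + size t.2.2 = size u + size w)%N.
Proof.
elim: w u => //= x w ih u; rewrite mem_cat => /orP[|/ih ->]; last first.
  by rewrite size_rcons addSnnS.
case: ifP => //= _; rewrite !inE => /orP[/eqP->//|/eqP->] /=.
by rewrite size_rcons addSnnS.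
Qed.

Lemma cutl_left Q u w t : u != [::] -> t \in cutl Q u w -> t.2.1 != [::].
Proof.
elim: w u => //= x w ih u u0; rewrite mem_cat => /orP[|/ih]; last first.
  by apply; case: (u).
case: ifP => //= _; rewrite !inE => /orP[/eqP->//|/eqP->] /=.
by case: (u).
Qed.

(** An empty right factor can only arise from the cut after the last letter, which is absent when
    that letter is not selected. *)
Lemma cutl_right Q u w t : (if w is x :: w1 then ~~ Q (last x w1).1 else true) ->
  t \in cutl Q u w -> t.2.2 != [::].
Proof.
elim: w u => //= x w ih u lw; rewrite mem_cat => /orP[|]; last first.
  by apply: (ih); case: w lw {ih}.
case: ifP => //= qx; rewrite !inE => /orP[/eqP->//|/eqP->] /=.
by case: w lw {ih} => //=; rewrite qx.
Qed.

Fixpoint qcutl Q w (pre qs : seq word) : seq (C * seq word) :=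
  if qs is q :: qs' then
    [seq (t.1, (w ++ (t.2.2 ++ t.2.1)) :: pre ++ qs') | t <- cutl Q [::] q] ++
    [seq (- t.1, (w ++ tw (t.2.2 ++ t.2.1)) :: pre ++ qs') | t <- cutl Q [::] q] ++
    qcutl Q w (q :: pre) qs'
  else [::].

Lemma qcutl_valid Q w pre qs t : w != [::] -> valid pre -> valid qs ->
  t \in qcutl Q w pre qs ->
  valid t.2 /\ tlen t.2 = (size w + tlen pre + tlen qs)%N.
Proof.
move=> w0; elim: qs pre => //= q qs ih pre vp vq.
have [q0 vqs] : q != [::] /\ valid qs by apply/andP; rewrite -valid_cons.
have vpq : valid (pre ++ qs) by rewrite /valid mem_cat negb_or; apply/andP.
have tpq : tlen (pre ++ qs) = (tlen pre + tlen qs)%N by rewrite /tlen flatten_cat size_cat.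
have w0' z : w ++ z != [::] by case: (w) w0.
rewrite !mem_cat => /or3P[/mapP[t' /cutl_size st ->]|/mapP[t' /cutl_size st ->]|/ih].
- split; first by rewrite /= valid_cons w0'.
  rewrite /= !tlen_cons !size_cat tpq; move: st => /=; lia.
- split; first by rewrite /= valid_cons w0'.
  rewrite /= !tlen_cons !size_cat size_tw size_cat tpq; move: st => /=; lia.
- case=> //; first by rewrite valid_cons q0.
  by move=> -> ->; rewrite !tlen_cons; split=> //; lia.
Qed.

Lemma ncpoly_words p : exists s : seq (C * word), forall N (f : V -> 'M[C]_N),
  ncev f p = \sum_(t <- s) t.1 *: ncev f (wp t.2).
Proof.
elim: p => [c|v|v|p [s hs] q [s' hs']|p [s hs] q [s' hs']].
- by exists [:: (c, [::])] => N f; rewrite big_seq1 /= scalemx1.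
- by exists [:: (1, [:: (v, false)])] => N f; rewrite big_seq1 ncev_wp1 scale1r.
- by exists [:: (1, [:: (v, true)])] => N f; rewrite big_seq1 ncev_wp1 scale1r.
- by exists (s ++ s') => N f; rewrite big_cat/= -hs -hs'.
- exists [seq (x.1 * y.1, x.2 ++ y.2) | x <- s, y <- s'] => N f.
  rewrite big_allpairs_dep/= hs hs' mulmx_suml; apply: eq_bigr => x _.
  rewrite mulmx_sumr; apply: eq_bigr => y _.
  by rewrite ncev_wp_cat -scalemxAl -scalemxAr scalerA.
Qed.

End words.

Lemma has_first (A : Type) (a : pred A) (w : seq A) : has a w ->
  exists w1 x w2, [/\ w = w1 ++ x :: w2, a x & all (predC a) w1].
Proof.
elim: w => //= x w ih; have [ax|nax] := boolP (a x); first by exists [::], x, w.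
by move=> /ih[w1 [y [w2 [-> ay aw]]]]; exists (x :: w1), y, w2; rewrite /= nax.
Qed.

(** A letter y outside [a] is rotated to the end, and then the word is rotated up to its first
    letter in [a]. What ends up last is y or one of the letters skipped, all outside [a]. *)
Lemma cyclic_start (A : eqType) (a : pred A) (w : seq A) : has a w -> ~~ all a w ->
  exists n x z, [/\ rot n w = x :: z, a x & ~~ a (last x z)].
Proof.
move=> hw /allPn[y yw nay]; case/splitPr: yw hw => p q hw.
set w' := p ++ y :: q in hw *.
have r1 : rot (size p).+1 w' = rcons (q ++ p) y.
  by rewrite /w' -cat_rcons -(size_rcons p y) rot_size_cat -rcons_cat.
have := hw; rewrite -(has_rot (size p).+1) r1 => /has_first[u1 [x [u2 [E ax au1]]]].
have sw : ((size p).+1 <= size w')%N by rewrite /w' size_cat /= addnS ltnS leq_addr.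
have su : (size u1 <= size w')%N.
  by rewrite -(size_rot (size p).+1 w') r1 E size_cat leq_addr.
have r2 : rot (size u1) (rot (size p).+1 w') = x :: (u2 ++ u1).
  by rewrite r1 E rot_size_cat.
rewrite rot_add_mod// in r2.
eexists; exists x, (u2 ++ u1); split; [exact: r2|by []|].
rewrite last_cat; case: u1 au1 E {su r2} => [_ E|z u1 au1 _] /=.
  have := congr1 (last y) E; rewrite last_rcons /= => <-.
  exact: nay.
have /allP/(_ (last z u1)) := au1; apply; exact: mem_last.
Qed.

Lemma cut_scale (R : realType) (V : Type) (Q : V -> bool) (g : ncpoly R V -> ncpoly R V -> R[i])
    c l p r : cut Q (fun l r => c * g l r) l p r = c * cut Q g l p r.
Proof.
elim: p l r => /= [a|v|v|a iha b ihb|a iha b ihb] l r.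
- by rewrite mulr0.
- by case: ifP => _; rewrite ?mulr0 ?mulrBr.
- by case: ifP => _; rewrite ?mulr0 ?mulrBr.
- by rewrite iha ihb mulrDr.
- by rewrite iha ihb mulrDr.
Qed.

(** * Normalized loop equations for words in all families *)

Section joint_moments.
Context {R : realType} {d : measure_display} {T : measurableType d}.
Variable P : probability T R.
Context {s : nat} {k : 'I_s -> nat}.
Variable X : forall (N : nat) (j : 'I_s), 'I_(k j) -> T -> 'M[R[i]]_N.
Arguments X : clear implicits.
Local Notation C := R[i].
Local Notation V := {j : 'I_s & 'I_(k j)}.
Local Notation word := (seq (V * bool)).
Hypothesis LX : forall N j i a b, all_momentsC P (fun w => X N j i w a b).
Hypothesis indX : forall N, indep_families P (fun j => entry_rv (X N j)).

Definition jtr N (p : ncpoly R V) : T -> C := trRV (fun v w => X N (tag v) (tagged v) w) p.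

Definition EN N (c : seq (ncpoly R V)) : C := EC P (fun w => \prod_(p <- c) jtr N p w).

Lemma all_momentsC_jtr N p : all_momentsC P (jtr N p).
Proof. by apply: all_momentsC_trRV => v a b; exact: LX. Qed.

Lemma all_momentsC_jtr_prod N c : all_momentsC P (fun w => \prod_(p <- c) jtr N p w).
Proof. by apply: all_momentsC_prod => p; exact: all_momentsC_jtr. Qed.

Lemma jtr_treq N p q : treq p q -> jtr N p = jtr N q.
Proof. by move=> H; apply/funext => w; rewrite /jtr /trRV /ntr H. Qed.

Lemma EN_treq N p q c : treq p q -> EN N (p :: c) = EN N (q :: c).
Proof.
by move=> H; congr (EC _ _); apply/funext => w; rewrite !big_cons (jtr_treq N H).
Qed.

Lemma EN_treq2 N p q p' q' c : treq p p' -> treq q q' ->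
  EN N (p :: q :: c) = EN N (p' :: q' :: c).
Proof.
move=> H H'; congr (EC _ _); apply/funext => w.
by rewrite !big_cons (jtr_treq N H) (jtr_treq N H').
Qed.

Lemma EN_seq1 N p : EN N [:: p] = EC P (jtr N p).
Proof. by congr (EC _ _); apply/funext => w; rewrite big_seq1. Qed.

Lemma EN_one N c : (0 < N)%N -> EN N (NCconst 1 :: c) = EN N c.
Proof.
move=> N0; congr (EC _ _); apply/funext => w; rewrite big_cons /jtr /trRV /ntr /= mxtrace1.
by rewrite mulVf ?mul1r// pnatr_eq0 -lt0n.
Qed.

Lemma EN_lincomb N (I : Type) (r : seq I) (a : I -> C) (f : I -> ncpoly R V) p c :
  (forall (g : V -> 'M[C]_N), \tr (ncev g p) = \sum_(i <- r) a i * \tr (ncev g (f i))) ->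
  EN N (p :: c) = \sum_(i <- r) a i * EN N (f i :: c).
Proof.
move=> H; transitivity (EC P (fun w => \sum_(i <- r) a i * \prod_(q <- f i :: c) jtr N q w)).
  congr (EC _ _); apply/funext => w; rewrite big_cons {1}/jtr /trRV /ntr H big_distrr/= big_distrl/=.
  by apply: eq_bigr => i _; rewrite big_cons {2}/jtr /trRV /ntr; ring.
rewrite EC_sum => [|i]; last first.
  by apply: (@all_momentsC_mul _ _ _ P (cst _)); [exact: all_momentsC_cst|exact: all_momentsC_jtr_prod].
by apply: eq_bigr => i _; rewrite EC_scale//; exact: all_momentsC_jtr_prod.
Qed.

Lemma EN_ET N c : (0 < N)%N -> ET P (X N) c = N%:R ^+ size c * EN N c.
Proof.
move=> N0; rewrite /EN -EC_scale; last exact: all_momentsC_jtr_prod.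
congr (EC _ _); apply/funext => w; elim: c => [|p c ih]; first by rewrite !big_nil mulr1.
rewrite !big_cons ih exprS /jtr /trRV /ntr.
rewrite mulrACA; congr (_ * _); rewrite mulrA divff ?mul1r// pnatr_eq0 -lt0n//.
Qed.

Definition mN N (c : seq word) : C := EN N [seq wp w | w <- c].

Lemma mN_perm N c c' : perm_eq c c' -> mN N c = mN N c'.
Proof.
move=> pe; congr (EC _ _); apply/funext => w; rewrite !big_map.
exact: perm_big.
Qed.

Lemma treq_wp_catC (u v : word) : treq (wp (u ++ v) : ncpoly R V) (wp (v ++ u)).
Proof. by move=> N f; rewrite !ncev_wp_cat mxtrace_mulC. Qed.

Section invariant_family.
Variable j : 'I_s.
Hypothesis inv : forall N, orth_invariant P (X N j).
Let Q (v : V) := tag v == j.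

Lemma EN_loop N p : (0 < N)%N ->
  cut Q (fun l r => EN N [:: l; r] - N%:R^-1 * EN N [:: NCmul l (nct r)])
    (NCconst 1) p (NCconst 1) = 0.
Proof.
move=> N0; have NZ : N%:R != 0 :> C by rewrite pnatr_eq0 -lt0n.
have := @loop_equation R d T P s k N (X N) (@LX N) (@indX N) j p [::] (@inv N).
rewrite /= addr0.
rewrite (@eq_cut _ _ _ _ _ (fun l r => N%:R ^+ 2 *
   (EN N [:: l; r] - N%:R^-1 * EN N [:: NCmul l (nct r)]))); last first.
  by move=> l r; rewrite !EN_ET//= expr1 mulrBr mulrA expr2 mulfK.
by rewrite cut_scale => /eqP; rewrite mulf_eq0 expf_eq0 (negbTE NZ)/= => /eqP.
Qed.

Lemma qloop_words N w pre qs : (0 < N)%N ->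
  qloop P (X N) Q (wp w) [seq wp u | u <- pre] [seq wp u | u <- qs] =
  N%:R ^+ (size pre + size qs) * \sum_(t <- qcutl Q w pre qs) t.1 * mN N t.2.
Proof.
move=> N0; elim: qs pre => [|q qs ih] pre /=; first by rewrite big_nil mulr0.
rewrite -map_cons ih /= !big_cat/= !mulrDr addrA addSnnS; congr (_ + _).
rewrite !big_map/= -mulrDr -big_split/=.
rewrite (@cut_wp _ _ _ _ _ [::]); last 2 first.
- by [].
- by [].
  rewrite big_distrr/=; apply: eq_bigr => t _.
  rewrite !EN_ET//= size_cat !size_map -addnS -mulrBr mulrCA; congr (_ * _).
  rewrite mulNr -mulrBr; congr (_ * (_ - _)).
    rewrite /mN /= map_cat; apply: EN_treq; apply: nceq_treq => M f /=.
    by rewrite !ncev_wp_cat.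
  rewrite /mN /= map_cat; apply: EN_treq; apply: nceq_treq => M f /=.
  by rewrite !ncev_nct ncev_wp_cat ncev_tw ncev_wp_cat trmx_mul.
move=> l l' r r' el er; congr (_ - _); rewrite !EN_ET//=; congr (_ * _);
  apply: EN_treq; apply: nceq_treq => M f /=; rewrite ?ncev_nct !el !er//.
Qed.

(** A split has |qs| + 2 traces, a gluing one fewer, a splice two fewer; division by N^(|qs| + 2)
    gives the weights 1, 1/N and 1/N^2. *)
Lemma mN_loop N w qs : (0 < N)%N ->
  \sum_(t <- cutl Q [::] w) t.1 * (mN N (t.2.1 :: t.2.2 :: qs) -
      N%:R^-1 * mN N ((t.2.1 ++ tw t.2.2) :: qs)) +
  N%:R^-1 * (N%:R^-1 * \sum_(t <- qcutl Q w [::] qs) t.1 * mN N t.2) = 0.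
Proof.
move=> N0; have NZ : N%:R != 0 :> C by rewrite pnatr_eq0 -lt0n.
have := @loop_equation R d T P s k N (X N) (@LX N) (@indX N) j (wp w) [seq wp u | u <- qs] (@inv N).
rewrite /= (@qloop_words N w [::] qs)//= add0n.
rewrite (@cut_wp _ _ _ _ _ [::]) => //; last first.
  move=> l l' r r' el er; congr (_ - _); rewrite !EN_ET//=; congr (_ * _).
    by apply: EN_treq2; exact: nceq_treq.
  by apply: EN_treq; apply: nceq_treq => M f /=; rewrite ?ncev_nct !el !er.
have -> : \sum_(t <- cutl Q [::] w) t.1 * (ET P (X N) (wp t.2.1 :: wp t.2.2 :: [seq wp u | u <- qs])
    - ET P (X N) (NCmul (wp t.2.1) (nct (wp t.2.2)) :: [seq wp u | u <- qs])) =
  N%:R ^+ (size qs).+2 * \sum_(t <- cutl Q [::] w) t.1 * (mN N (t.2.1 :: t.2.2 :: qs) -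
      N%:R^-1 * mN N ((t.2.1 ++ tw t.2.2) :: qs)).
  rewrite big_distrr/=; apply: eq_bigr => t _; rewrite mulrCA; congr (_ * _).
  rewrite !EN_ET//= size_map mulrBr; congr (_ - _).
  rewrite mulrA [N%:R ^+ _.+2]exprSr mulfK//; congr (_ * _).
  by apply: EN_treq; apply: nceq_treq => M f /=; rewrite ncev_nct ncev_wp_cat ncev_tw.
set A := (X in N%:R ^+ _ * X + _); set B := (X in _ + _ * X) => H.
have /eqP : N%:R ^+ (size qs).+2 * (A + N%:R^-1 * (N%:R^-1 * B)) = 0.
  rewrite mulrDr -[RHS]H; congr (_ + _).
  by rewrite !exprSr !mulrA !mulfK.
by rewrite mulf_eq0 expf_eq0 (negbTE NZ) andbF/= => /eqP.
Qed.

End invariant_family.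

Definition fam (x : V * bool) : 'I_s := tag x.1.

Hypothesis almost_all_invariant : forall j1 j2 : 'I_s, j1 != j2 ->
  (forall N, orth_invariant P (X N j1)) \/ (forall N, orth_invariant P (X N j2)).

Lemma mN_reducible w : ~~ mono fam w -> reducible mN w.
Proof.
move=> nm.
(* A mixed word has letters in two different families, one of which is invariant; that one occurs in
   the word without exhausting it. *)
have [j inv [hj nj]] : exists2 j, (forall N, orth_invariant P (X N j)) &
    has (fun x => fam x == j) w /\ ~~ all (fun x => fam x == j) w.
  case: w nm => // x w; rewrite /mono [constant _]/= all_map => /allPn[y yw nxy].
  have {}nxy : fam y != fam x by [].
  have [iy|ix] := almost_all_invariant nxy.
    exists (fam y) => //; split.
      by apply/hasP; exists y; rewrite ?inE ?yw ?orbT.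
    by apply/allPn; exists x; rewrite ?mem_head// eq_sym.
  exists (fam x) => //; split; first by rewrite /= eqxx.
  by apply/allPn; exists y; rewrite ?inE ?yw ?orbT.
have [n [x [z [rw xj lj]]]] := cyclic_start hj nj.
pose Q (v : V) := tag v == j.
have z0 : z != [::] by case: z rw lj => //= _; rewrite xj.
have sw : size w = (size z).+1 by rewrite -(size_rot n w) rw.
(* The cut before the first letter has an empty left factor and returns the whole word; every other
   cut has two non-empty factors. *)
have [tl tlE tlP] : exists2 tl, cutl Q [::] (x :: z) = (1, ([::], x :: z)) :: tl &
    forall t : C * (word * word), t \in tl ->
      [/\ t.2.1 != [::], t.2.2 != [::] & (size t.2.1 + size t.2.2 = size w)%N].
  exists ((-1, ([:: x], z)) :: cutl Q [:: x] z) => [|t].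
    by rewrite /= (_ : Q x.1 = true).
  rewrite inE => /orP[/eqP->|ht] /=; first by rewrite sw.
  split; [exact: cutl_left ht|apply: cutl_right ht|by rewrite (cutl_size ht) sw].
  by case: (z) lj.
(* Solving for the word reverses the sign of the splits and keeps that of the gluings; the first
   cut, glued, contributes the transposed word to [s2]. *)
exists [seq (- t.1, t.2) | t <- tl], ((1, tw (x :: z)) :: [seq (t.1, t.2.1 ++ tw t.2.2) | t <- tl]).
split.
- by move=> t /mapP[t' /tlP h ->].
- move=> t; rewrite in_cons => /orP[/eqP->|/mapP[t' /tlP[_ _ h] ->]] /=.
    by rewrite size_tw sw.
  by rewrite size_cat size_tw h.
move=> qs vqs; exists [seq (- t.1, t.2) | t <- qcutl Q (x :: z) [::] qs].
  move=> t /mapP[t' ht ->] /=; have [|//||v e] := qcutl_valid _ _ _ ht => //.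
  by split=> //; rewrite e tlen_cons /= sw /tlen /= addn0.
move=> N N0; have -> : mN N (w :: qs) = mN N ((x :: z) :: qs).
  by rewrite -rw; apply: EN_treq; rewrite /rot -{1}(cat_take_drop n w); exact: treq_wp_catC.
have := mN_loop inv (x :: z) qs N0.
rewrite -/Q tlE.
set S3 := \sum_(t <- qcutl _ _ _ _) _.
rewrite big_cons /= mul1r.
have -> : mN N ([::] :: (x :: z) :: qs) = mN N ((x :: z) :: qs) by exact: EN_one.
have E1 : \sum_(t <- tl) t.1 * (mN N (t.2.1 :: t.2.2 :: qs) -
      N%:R^-1 * mN N ((t.2.1 ++ tw t.2.2) :: qs)) =
   \sum_(t <- tl) t.1 * mN N (t.2.1 :: t.2.2 :: qs) -
   N%:R^-1 * \sum_(t <- tl) t.1 * mN N ((t.2.1 ++ tw t.2.2) :: qs).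
  by rewrite big_distrr/= -sumrB; apply: eq_bigr => t _; rewrite mulrBr [in X in _ - X]mulrCA.
rewrite E1 big_cons !big_map/= mul1r.
have -> : \sum_(t <- tl) - t.1 * mN N (t.2.1 :: t.2.2 :: qs) =
   - \sum_(t <- tl) t.1 * mN N (t.2.1 :: t.2.2 :: qs).
  by rewrite -sumrN; apply: eq_bigr => t _; rewrite mulNr.
have -> : \sum_(t <- qcutl Q (x :: z) [::] qs) - t.1 * mN N t.2 = - S3.
  by rewrite -sumrN; apply: eq_bigr => t _; rewrite mulNr.
move=> H; apply/eqP; rewrite -subr_eq0 -[X in _ == X]H; apply/eqP; ring.
Qed.

End joint_moments.

(** * Expansion and factorization of the joint moments *)

Section joint_asymptotics.
Context {R : realType} {d : measure_display} {T : measurableType d}.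
Variable P : probability T R.
Context {s : nat} {k : 'I_s -> nat}.
Variable X : forall (N : nat) (j : 'I_s), 'I_(k j) -> T -> 'M[R[i]]_N.
Arguments X : clear implicits.
Local Notation C := R[i].
Local Notation V := {j : 'I_s & 'I_(k j)}.
Local Notation word := (seq (V * bool)).
Local Notation rc := (real_complex R).
Local Notation mN := (mN P X).
Local Notation EN := (EN P X).
Local Notation jtr := (jtr X).
Hypothesis LX : forall N j i a b, all_momentsC P (fun w => X N j i w a b).
Hypothesis indX : forall N, indep_families P (fun j => entry_rv (X N j)).
Hypothesis almost_all_invariant : forall j1 j2 : 'I_s, j1 != j2 ->
  (forall N, orth_invariant P (X N j1)) \/ (forall N, orth_invariant P (X N j2)).
Hypothesis X1 : forall j, propP1 P (fun N => X N j).
Hypothesis X2 : forall j, propP2 P (fun N => X N j).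
Hypothesis X3 : forall j, propP3 P (fun N => X N j).
Local Notation J N := (fun j : 'I_s => ('I_(k j) * 'I_N * 'I_N * bool)%type : finType).
Local Notation ent N j := (entry_rv (X N j) : J N j -> T -> R).

Lemma word_one_family j (w : word) : all (fun x => fam x == j) w ->
  exists q : ncpoly R 'I_(k j), forall N o,
    ncev (fun v : V => X N (tag v) (tagged v) o) (wp w) = ncev (fun i => X N j i o) q.
Proof.
elim: w => [_|[[i x] b] w ih]; first by exists (NCconst 1).
rewrite [all _ _]/= => /andP[/eqP ij /ih[q hq]]; rewrite /fam /= in ij; subst i.
exists (NCmul (if b then NCvarT x else NCvar x) q) => N o.
by rewrite [wp _]/= /= -hq; case: b.
Qed.

Lemma pspan_word N j (w : word) a b : all (fun x => fam x == j) w ->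
  let Z o := ncev (fun v : V => X N (tag v) (tagged v) o) (wp w) a b in
  pspan (ent N j) (ent N j) Z Z.
Proof.
elim: w a b => [|[[i x] b'] w ih] a b /=; first by move=> _; exact: pspan_cst.
move=> /andP[/eqP ij hw]; rewrite /fam /= in ij; subst i.
have xe c e : pspan (ent N j) (ent N j) (fun o => X N j x o c e) (fun o => X N j x o c e).
  have -> : (fun o => X N j x o c e) = (fun o => rc (ent N j (x, c, e, true) o) +
     Complex 0 1 * rc (ent N j (x, c, e, false) o)).
    by apply/funext => o; rewrite [LHS]complexE.
  apply: pspan_add; first exact: pspan_var.
  by apply: pspan_mul; [exact: pspan_cst|exact: pspan_var].
have E : (fun o => (ncev (fun v : V => X N (tag v) (tagged v) o) (letter (existT _ j x, b')) *m
     ncev (fun v : V => X N (tag v) (tagged v) o) (wp w)) a b) =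
   (fun o => \sum_c (if b' then X N j x o c a else X N j x o a c) *
     ncev (fun v : V => X N (tag v) (tagged v) o) (wp w) c b).
  by apply/funext => o; rewrite mxE; apply: eq_bigr => c _; case: (b'); rewrite /= ?mxE.
rewrite E; apply: pspan_sum => c; apply: pspan_mul; last exact: ih.
by case: (b').
Qed.

(** Each non-empty word goes to the family of its first letter and the empty word to none, so that a
    product over non-empty words regroups by family. *)
Definition inj_fam j (w : word) := ohead [seq fam x | x <- w] == Some j.

Lemma mono_inj_fam j w : mono fam w -> inj_fam j w -> all (fun x => fam x == j) w.
Proof.
case: w => // x w; rewrite /mono /= all_map /inj_fam /= => h /eqP[<-]; rewrite eqxx.
exact: h.
Qed.

Lemma prod_inj_fam (c : seq word) (F : word -> C) : valid c ->
  \prod_j \prod_(w <- c | inj_fam j w) F w = \prod_(w <- c) F w.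
Proof.
elim: c => [_|w c ih]; first by rewrite big_nil big1// => j _; rewrite big_nil.
rewrite valid_cons => /andP[w0 /ih{}ih]; rewrite big_cons -ih.
case: w w0 => // x w _.
rewrite (bigD1 (fam x))//= [in RHS](bigD1 (fam x))//= mulrA; congr (_ * _).
  by rewrite big_cons /inj_fam /= eqxx.
apply: eq_bigr => j jx; rewrite big_cons /inj_fam /=.
by case: eqP => // -[E]; rewrite E eqxx in jx.
Qed.

Lemma mN_mono_indep N c : valid c -> all (mono fam) c ->
  mN N c = \prod_j EC P (fun o => \prod_(w <- c | inj_fam j w) jtr N (wp w) o).
Proof.
move=> vc mc.
have mF j (e : J N j) : all_moments P (ent N j e).
  by case: e => [[[i a] b] []]; case: (@LX N j i a b).
rewrite -(@EC_indep _ _ _ P _ _ _ (fun j o => \prod_(w <- c | inj_fam j w) jtr N (wp w) o)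
  mF (@indX N)).
  congr (EC _ _); apply/funext => o; rewrite big_map.
  by rewrite (prod_inj_fam (fun w => jtr N (wp w) o)).
move=> j.
have -> : (fun o => \prod_(w <- c | inj_fam j w) jtr N (wp w) o) =
   (fun o => \prod_(w <- c | (w \in c) && inj_fam j w) jtr N (wp w) o).
  by apply/funext => o; rewrite big_seq_cond.
apply: pspan_prod => w /andP[wc wj]; apply: pspan_mul; first exact: pspan_cst.
apply: pspan_sum => a; apply: pspan_word; apply: mono_inj_fam => //.
exact: (allP mc).
Qed.

Lemma jtr_one_family j : exists q : word -> ncpoly R 'I_(k j),
  forall w, mono fam w -> inj_fam j w -> forall N, jtr N (wp w) = trRV (X N j) (q w).
Proof.
have [q qP] : {q : word -> ncpoly R 'I_(k j) & forall w, mono fam w -> inj_fam j w ->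
    forall N, jtr N (wp w) = trRV (X N j) (q w)}.
  apply: (@choice _ _ (fun w (q : ncpoly R 'I_(k j)) => mono fam w -> inj_fam j w ->
    forall N, jtr N (wp w) = trRV (X N j) q)) => w.
  have [mw|] := boolP (mono fam w); last by exists (NCconst 0).
  have [jw|] := boolP (inj_fam j w); last by exists (NCconst 0).
  have [q hq] := word_one_family (mono_inj_fam mw jw); exists q => _ _ N.
  by apply/funext => o; rewrite /jtr /trRV /ntr hq.
by exists q.
Qed.

Lemma mN_seq1 N w : mN N [:: w] = EC P (jtr N (wp w)).
Proof. exact: EN_seq1. Qed.

Lemma mN_mono_conv w : w != [::] -> mono fam w -> conv 1 (mN^~ [:: w]).
Proof.
case: w => // x w _ mw; have [q qP] := jtr_one_family (fam x).
under eq_fun do rewrite mN_seq1 (qP _ mw (eqxx _)).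
exact: (trRV_conv (X1 (fam x))).
Qed.

(** Independence factors the expectation exactly over the families; inside each family [trRV_prod]
    factors it up to o(1/N). *)
Lemma mN_mono_prod c : valid c -> all (mono fam) c ->
  eqk 1 (mN^~ c) (fun N => \prod_(w <- c) mN N [:: w]).
Proof.
move=> vc mc.
apply: (@eqk_trans _ _ (fun N => \prod_(j <- index_enum 'I_s)
    EC P (fun o => \prod_(w <- c | inj_fam j w) jtr N (wp w) o))).
  by apply: eqk_eq => N _; exact: mN_mono_indep.
apply: (@eqk_trans _ _ (fun N => \prod_(j <- index_enum 'I_s)
    \prod_(w <- c | inj_fam j w) mN N [:: w])); last first.
  by apply: eqk_eq => N _; exact: prod_inj_fam.
apply: (proj1 (eqk_prod _)) => j _; split; last first.
  have -> : (fun N => \prod_(w <- c | inj_fam j w) mN N [:: w]) =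
      (fun N => \prod_(w <- c | (w \in c) && inj_fam j w) mN N [:: w]).
    by apply/funext => N; rewrite big_seq_cond.
  apply: bnd_prod => w /andP[wc jw]; apply: (conv_bnd (mN_mono_conv _ _)).
    by apply: contraNneq vc => <-.
  exact: (allP mc).
have [q qP] := jtr_one_family j.
pose cj := [seq w <- c | inj_fam j w].
have cjE i : (i < size cj)%N -> mono fam (nth [::] cj i) /\ inj_fam j (nth [::] cj i).
  by move=> /(mem_nth [::]); rewrite mem_filter => /andP[h /(allP mc)].
have := @trRV_prod _ _ _ P _ (fun N => X N j) (fun N v a b => @LX N j v a b) (X1 j) (@X2 j) (@X3 j)
  (size cj) (fun i => q (nth [::] cj i)).
congr eqk; apply/funext => N.
  congr (EC _ _); apply/funext => o; rewrite -[RHS]big_filter -/cj (big_nth [::]) big_mkord.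
  by apply: eq_bigr => i _; have [h1 h2] := cjE i (ltn_ord i); rewrite qP.
rewrite -[RHS]big_filter -/cj (big_nth [::]) big_mkord.
by apply: eq_bigr => i _; have [h1 h2] := cjE i (ltn_ord i); rewrite mN_seq1 qP.
Qed.

(** The general result concerns non-empty words; the empty one has normalized trace 1 as soon as N >
    0. *)
Lemma mN_conv w : conv 1 (mN^~ [:: w]).
Proof.
have [->|w0] := eqVneq w [::].
  apply: (conv_eqk _ (conv_cst 1 1)); apply: eqk_eq => N N0.
  have -> : mN N [:: [::]] = EN N [::] by exact: EN_one.
  by rewrite -[RHS](EC_cst P); congr (EC _ _); apply/funext => o; rewrite big_nil.
apply: (@moments_conv _ _ _ fam mN) => //.
- exact: mN_perm.
- by move=> w' /mN_reducible; apply.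
- exact: mN_mono_prod.
- exact: mN_mono_conv.
Qed.

Lemma mN_prod2 u v : eqk 1 (mN^~ [:: u; v]) (fun N => mN N [:: u] * mN N [:: v]).
Proof.
have E0 N c : (0 < N)%N -> mN N ([::] :: c) = mN N c by move=> N0; exact: EN_one.
have E1 N : mN N [::] = 1.
  by rewrite -[RHS](EC_cst P); congr (EC _ _); apply/funext => o; rewrite big_nil.
have [->|u0] := eqVneq u [::].
  by apply: eqk_eq => N N0; rewrite !E0// E1 mul1r.
have [->|v0] := eqVneq v [::].
  apply: eqk_eq => N N0; rewrite !E0// E1 mulr1.
  by rewrite (@mN_perm _ _ _ _ _ _ _ _ _ [:: [::]; u]) ?E0// (perm_catC [:: u] [:: [::]]).
have := @moments_prod _ _ _ fam mN (@mN_perm _ _ _ _ _ _ _) _ mN_mono_prod mN_mono_conv [:: u; v].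
under [in X in _ -> _ -> eqk _ _ X]eq_fun do rewrite !big_cons big_nil mulr1.
apply; last by rewrite !valid_cons u0 v0.
by move=> w' /mN_reducible; apply.
Qed.

Lemma EN_conv p : conv 1 (EN^~ [:: p]).
Proof.
have [q hq] := ncpoly_words p.
apply: (@conv_eqk _ _ _ (fun N => \sum_(t <- q) t.1 * mN N [:: t.2])).
  apply: eqk_eq => N _; rewrite (@EN_lincomb _ _ _ P _ _ X LX N _ q (fun t => t.1) (fun t => wp t.2))//.
  by move=> g; rewrite hq raddf_sum/=; apply: eq_bigr => t _; rewrite mxtraceZ.
by apply: conv_sum => t _; apply: conv_scale; exact: mN_conv.
Qed.

Lemma EN_prod2 p q : eqk 1 (EN^~ [:: p; q]) (fun N => EN N [:: p] * EN N [:: q]).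
Proof.
have lc p' (sp : seq (C * word)) : (forall N (f : V -> 'M[C]_N),
   ncev f p' = \sum_(t <- sp) t.1 *: ncev f (wp t.2)) -> forall N c,
   EN N (p' :: c) = \sum_(t <- sp) t.1 * EN N (wp t.2 :: c).
  move=> hp N c; apply: (@EN_lincomb _ _ _ P _ _ X LX N _ sp (fun t => t.1) (fun t => wp t.2)).
  by move=> g; rewrite hp raddf_sum/=; apply: eq_bigr => t _; rewrite mxtraceZ.
have [sp hp] := ncpoly_words p; have [sq hq] := ncpoly_words q.
have ENC N p' q' : EN N [:: p'; q'] = EN N [:: q'; p'].
  by congr (EC _ _); apply/funext => o; rewrite !big_cons big_nil !mulr1 mulrC.
apply: (@eqk_trans _ _ (fun N => \sum_(t <- sp) t.1 * \sum_(t' <- sq) t'.1 * mN N [:: t.2; t'.2])).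
  apply: eqk_eq => N _; rewrite (lc _ _ hp); apply: eq_bigr => t _; congr (_ * _).
  by rewrite ENC (lc _ _ hq); apply: eq_bigr => t' _; rewrite ENC.
apply: (@eqk_trans _ _ (fun N => \sum_(t <- sp) t.1 * \sum_(t' <- sq) t'.1 *
    (mN N [:: t.2] * mN N [:: t'.2]))).
  apply: eqk_sum => t _; apply: eqk_scale; apply: eqk_sum => t' _; apply: eqk_scale.
  exact: mN_prod2.
apply: eqk_eq => N _; rewrite (lc _ _ hp) (lc _ _ hq) big_distrl/=; apply: eq_bigr => t _.
rewrite -mulrA; congr (_ * _); rewrite big_distrr/=; apply: eq_bigr => t' _.
by rewrite mulrCA.
Qed.

End joint_asymptotics.

(** * Freeness from the limiting loop equations *)

Section cut_balanced.
Context {R : realType} {V : finType}.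
Local Notation C := R[i].
Implicit Types (p l r : ncpoly R V) (Q : V -> bool).

(* g factors through the tensor square of C<x, x^t> over C. *)
Record balanced (g : ncpoly R V -> ncpoly R V -> C) : Prop := Balanced {
  balanced_nceq : forall l l' r r', nceq l l' -> nceq r r' -> g l r = g l' r';
  balanced_addl : forall l l' r, g (NCadd l l') r = g l r + g l' r;
  balanced_addr : forall l r r', g l (NCadd r r') = g l r + g l r';
  balanced_const : forall c l r, g l (NCmul (NCconst c) r) = g (NCmul l (NCconst c)) r }.

(** When every letter is selected, consecutive cuts telescope and only the two ends remain; a
    constant moves across the cut because g is balanced. *)
Lemma cut_over Q g l p r : balanced g -> nc_over Q p ->
  cut Q g l p r = g l (NCmul p r) - g (NCmul l p) r.
Proof.
move=> [gE gD gD' gC]; elim: p l r => [c|v|v|a iha b ihb|a iha b ihb] l r /=.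
- by rewrite gC subrr.
- by move=> ->.
- by move=> ->.
- move=> [/iha-> /ihb->].
  have -> : g l (NCmul (NCadd a b) r) = g l (NCadd (NCmul a r) (NCmul b r)).
    by apply: gE => // N f /=; rewrite mulmxDl.
  have -> : g (NCmul l (NCadd a b)) r = g (NCadd (NCmul l a) (NCmul l b)) r.
    by apply: gE => // N f /=; rewrite mulmxDr.
  by rewrite gD gD' opprD addrACA.
- move=> [/iha-> /ihb->]; rewrite addrA subrK; congr (_ - _); apply: gE => // N f /=.
    by rewrite mulmxA.
  by rewrite mulmxA.
Qed.

Lemma cut_not_over Q (g : ncpoly R V -> ncpoly R V -> C) l p r :
  nc_over (fun v => ~~ Q v) p -> cut Q g l p r = 0.
Proof.
elim: p l r => [c|v|v|a iha b ihb|a iha b ihb] l r //=.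
- by move=> /negbTE ->.
- by move=> /negbTE ->.
- by move=> [/iha-> /ihb->]; rewrite addr0.
- by move=> [/iha-> /ihb->]; rewrite addr0.
Qed.

Lemma nc_over_sub Q Q' p : (forall v, Q v -> Q' v) -> nc_over Q p -> nc_over Q' p.
Proof.
move=> H; elim: p => //= [a iha b ihb [/iha ? /ihb ?]|a iha b ihb [/iha ? /ihb ?]] //.
Qed.

Lemma sum_cut s (fam : V -> 'I_s) (g : ncpoly R V -> ncpoly R V -> C) l p r :
  \sum_j cut (fun v : V => fam v == j) g l p r = cut xpredT g l p r.
Proof.
elim: p l r => [c|v|v|a iha b ihb|a iha b ihb] l r /=.
- by rewrite big1.
- by rewrite (bigD1 (fam v))//= eqxx big1 ?addr0// => j /negbTE h; rewrite eq_sym h.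
- by rewrite (bigD1 (fam v))//= eqxx big1 ?addr0// => j /negbTE h; rewrite eq_sym h.
- by rewrite big_split/= iha ihb.
- by rewrite big_split/= iha ihb.
Qed.

Lemma nc_over_true p : nc_over xpredT p.
Proof. by elim: p. Qed.

End cut_balanced.

(** Summation by parts gives [a i] the coefficient f i - f (i - 1), so only places where selected
    and unselected letters meet count. As the last letter is unselected, [a n] does not appear. *)
Lemma abel_sum_sparse (R : realType) (n k : nat) (f : nat -> bool) (a : nat -> R[i]) :
  (0 < k < n)%N -> f 0%N -> ~~ f n.-1 ->
  (forall i, (0 < i < n)%N -> i != k -> a i = 0) ->
  \sum_(i < n) (if f i then a i - a i.+1 else 0) =
  a 0%N + (f k)%:R * a k - (f k.-1)%:R * a k.
Proof.
move=> /andP[k0 kn] f0 fn a0.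
transitivity (\sum_(i < n) (f i)%:R * a i - \sum_(i < n) (f i)%:R * a i.+1).
  rewrite -sumrB; apply: eq_bigr => i _.
  by case: (f i); rewrite ?mul1r ?mul0r ?subr0.
have n0 : (0 < n)%N by apply: leq_trans kn.
congr (_ - _).
  rewrite (bigD1 (Ordinal n0))//= f0 mul1r; congr (_ + _).
  rewrite (bigD1 (Ordinal kn))/=; last by rewrite -val_eqE /= -lt0n.
  rewrite big1 ?addr0// => i /andP[i0 ik]; rewrite a0 ?mulr0//.
  by rewrite ltn_ord andbT lt0n; exact: i0.
have k1n : (k.-1 < n)%N by apply: leq_ltn_trans kn; exact: leq_pred.
rewrite (bigD1 (Ordinal k1n))//= prednK// big1 ?addr0// => i ik.
have [i1n|i1n] := ltnP i.+1 n.
  rewrite a0 ?mulr0//; apply: contraNneq ik => ik; apply/eqP; apply: val_inj => /=.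
  by rewrite -ik.
have -> : (i : nat) = n.-1 by apply/eqP; rewrite eqn_leq -ltnS prednK// ltn_ord -ltnS prednK.
by rewrite (negbTE fn) mul0r.
Qed.

Lemma big_prod_rev (R : realType) (I : Type) (r : seq I) (F : I -> R[i]) :
  \prod_(i <- rev r) F i = \prod_(i <- r) F i.
Proof.
by elim: r => //= x r ih; rewrite rev_cons -cats1 big_cat big_seq1 big_cons ih mulrC.
Qed.

Section freeness.
Context {R : realType} {V : finType} {s : nat} (fam : V -> 'I_s).
Local Notation C := R[i].
Local Notation poly := (ncpoly R V).
Local Notation item := ('I_s * poly)%type.
Variables tau tau' : poly -> C.
Hypothesis tau_lin : is_lin tau.
Hypothesis tau'_lin : is_lin tau'.
Hypothesis tau_1 : tau (NCconst 1) = 1.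
Hypothesis tau'_1 : tau' (NCconst 1) = 0.
Hypothesis tau_treq : forall p q, treq p q -> tau p = tau q.
Hypothesis tau'_treq : forall p q, treq p q -> tau' p = tau' q.

(** [loop0] and [loop1] are the coefficients of 1 and 1/N in (tau l + tau' l / N) (tau r + tau' r /
    N) - tau(l r^t) / N, the limiting form of the summand of the loop equation. *)
Definition loop0 l r := tau l * tau r.
Definition loop1 l r := tau' l * tau r + tau l * tau' r - tau (NCmul l (nct r)).

Variable invariant : 'I_s -> Prop.
Hypothesis invariant_but_one : forall j1 j2, j1 != j2 -> invariant j1 \/ invariant j2.
Hypothesis loop0_eq : forall j p, invariant j ->
  cut (fun v : V => fam v == j) loop0 (NCconst 1) p (NCconst 1) = 0.
Hypothesis loop1_eq : forall j p, invariant j ->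
  cut (fun v : V => fam v == j) loop1 (NCconst 1) p (NCconst 1) = 0.

Lemma lincomb_treq (f : poly -> C) p q c r : is_lin f ->
  (forall p q, treq p q -> f p = f q) ->
  (forall N (g : V -> 'M[C]_N), \tr (ncev g p) = \tr (ncev g q) + c * \tr (ncev g r)) ->
  f p = f q + c * f r.
Proof.
move=> [fD fZ] fE H; rewrite -fZ -fD; apply: fE => N g /=.
by rewrite H linearD/= mul_scalar_mx mxtraceZ.
Qed.

Lemma tauD p q : tau (NCadd p q) = tau p + tau q. Proof. by case: tau_lin. Qed.
Lemma tauZ c p : tau (NCmul (NCconst c) p) = c * tau p. Proof. by case: tau_lin. Qed.
Lemma tau'D p q : tau' (NCadd p q) = tau' p + tau' q. Proof. by case: tau'_lin. Qed.
Lemma tau'Z c p : tau' (NCmul (NCconst c) p) = c * tau' p. Proof. by case: tau'_lin. Qed.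

Lemma nceq_refl (p : poly) : nceq p p. Proof. by []. Qed.

Lemma loop0_balanced : balanced loop0.
Proof.
split=> [l l' r r' el er|l l' r|l r r'|c l r]; rewrite /loop0.
- by rewrite (tau_treq (nceq_treq el)) (tau_treq (nceq_treq er)).
- by rewrite tauD mulrDl.
- by rewrite tauD mulrDr.
- rewrite tauZ (tau_treq (_ : treq (NCmul l (NCconst c)) (NCmul (NCconst c) l))) ?tauZ; first by ring.
  by move=> N f /=; rewrite mxtrace_mulC.
Qed.

Lemma loop1_balanced : balanced loop1.
Proof.
split=> [l l' r r' el er|l l' r|l r r'|c l r]; rewrite /loop1.
- rewrite (tau_treq (nceq_treq el)) (tau_treq (nceq_treq er)).
  rewrite (tau'_treq (nceq_treq el)) (tau'_treq (nceq_treq er)); congr (_ - _).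
  by apply: tau_treq => N f /=; rewrite !ncev_nct el er.
- rewrite tauD tau'D.
  rewrite (tau_treq (_ : treq (NCmul (NCadd l l') (nct r))
    (NCadd (NCmul l (nct r)) (NCmul l' (nct r))))) ?tauD; first by ring.
  by move=> N f /=; rewrite mulmxDl.
- rewrite tauD tau'D.
  rewrite (tau_treq (_ : treq (NCmul l (nct (NCadd r r')))
    (NCadd (NCmul l (nct r)) (NCmul l (nct r'))))) ?tauD; first by ring.
  by move=> N f /=; rewrite mulmxDr.
- have e : treq (NCmul l (NCconst c)) (NCmul (NCconst c) l).
    by move=> N f /=; rewrite mxtrace_mulC.
  rewrite (tau_treq e) (tau'_treq e) !tauZ !tau'Z.
  rewrite (tau_treq (_ : treq (NCmul (NCmul l (NCconst c)) (nct r))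
    (NCmul l (nct (NCmul (NCconst c) r))))); first by ring.
  by move=> N f /=; rewrite -mulmxA !mul_scalar_mx mul_mx_scalar.
Qed.

(* The sum of the loop equations over all families is a tautology, so the equation of a single
   missing family follows from the others. *)
Lemma loop_all (g : poly -> poly -> C) j p : balanced g ->
  (forall j p, invariant j -> cut (fun v : V => fam v == j) g (NCconst 1) p (NCconst 1) = 0) ->
  g (NCconst 1) p = g p (NCconst 1) ->
  cut (fun v : V => fam v == j) g (NCconst 1) p (NCconst 1) = 0.
Proof.
move=> bg ginv gp; have := sum_cut fam g (NCconst 1) p (NCconst 1).
rewrite (cut_over _ _ bg (nc_over_true p)).
rewrite (balanced_nceq bg (nceq_refl _) (_ : nceq (NCmul p (NCconst 1) : poly) p)); last first.
  by move=> N f /=; rewrite mulmx1.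
rewrite [g (NCmul _ _) _](balanced_nceq bg (_ : nceq (NCmul (NCconst 1) p) p) (nceq_refl _)); last first.
  by move=> N f /=; rewrite mul1mx.
rewrite gp subrr (bigD1 j)//=.
have [ij|nij] := pselect (invariant j); first by rewrite ginv.
rewrite big1 ?addr0// => j' jj; rewrite ginv//.
by have [|//] := invariant_but_one jj.
Qed.

Lemma loop0_all j p : cut (fun v : V => fam v == j) loop0 (NCconst 1) p (NCconst 1) = 0.
Proof. by apply: loop_all; [exact: loop0_balanced|exact: loop0_eq|rewrite /loop0 mulrC]. Qed.

Lemma tau_nct p : tau (nct p) = tau p.
Proof. by apply: tau_treq => N f; rewrite ncev_nct mxtrace_tr. Qed.

Lemma loop1_all j p : cut (fun v : V => fam v == j) loop1 (NCconst 1) p (NCconst 1) = 0.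
Proof.
apply: loop_all; [exact: loop1_balanced|exact: loop1_eq|rewrite /loop1].
rewrite (tau_treq (_ : treq (NCmul (NCconst 1) (nct p)) (nct p))); last first.
  by move=> N f /=; rewrite mul1mx.
rewrite (tau_treq (_ : treq (NCmul p (nct (NCconst 1))) p)); last first.
  by move=> N f /=; rewrite mulmx1.
by rewrite tau_nct tau_1 tau'_1; ring.
Qed.

Implicit Types (L u v : seq item) (x y : item).

Definition PL L : poly := foldr NCmul (NCconst 1) [seq x.2 | x <- L].

Lemma ncev_PL_cat N (f : V -> 'M[C]_N) u v : ncev f (PL (u ++ v)) = ncev f (PL u) *m ncev f (PL v).
Proof.
elim: u => [|x u ih] /=; first by rewrite mul1mx.
by rewrite [LHS]/= ih mulmxA.
Qed.

Definition over x := nc_over (fun v : V => fam v == x.1) x.2.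

Fixpoint all_over L := if L is x :: L' then over x /\ all_over L' else True.

(** Each factor lies in a single family, so the cuts inside it telescope and only those between
    factors are left. *)
Lemma cut_PL (g : poly -> poly -> C) j (l : poly) u L (r : poly) x0 :
  balanced g -> nceq l (PL u) -> nceq r (NCconst 1) -> all_over L ->
  cut (fun v : V => fam v == j) g l (PL L) r =
  \sum_(i < size L) if (nth x0 L i).1 == j then
     g (PL (u ++ take i L)) (PL (drop i L)) - g (PL (u ++ take i.+1 L)) (PL (drop i.+1 L)) else 0.
Proof.
move=> bg; elim: L l u r => [|x L ih] l u r lu r1 /=; first by rewrite big_ord0.
move=> [ox oL].
have e1 : nceq (NCmul l x.2) (PL (rcons u x)).
  by move=> N f; rewrite -cats1 ncev_PL_cat /= lu mulmx1.
rewrite -/(PL L) (ih _ _ _ e1 r1 oL) big_ord_recl/= cats0; congr (_ + _); last first.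
  by apply: eq_bigr => i _; rewrite /bump /= !cat_rcons.
have e2 : nceq (NCmul (PL L) r) (PL L) by move=> N f /=; rewrite r1 /= mulmx1.
have e3 : nceq (NCmul x.2 (NCmul (PL L) r)) (PL (x :: L)).
  by move=> N f /=; rewrite r1 /= mulmx1.
have [xj|xj] := eqVneq x.1 j.
  rewrite cut_over//; last by rewrite -xj.
  rewrite (balanced_nceq bg lu e3) (balanced_nceq bg e1 e2) take0 drop0 cats1//.
rewrite cut_not_over//; move: ox; apply: nc_over_sub => v /eqP->; exact: xj.
Qed.

Definition alt L := sorted (fun x y => x.1 != y.1) L.

Fixpoint good L := if L is x :: L' then [/\ over x, tau x.2 = 0 & good L'] else True.

Lemma good_over L : good L -> all_over L.
Proof. by elim: L => //= x L ih [ox _ /ih]. Qed.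

Lemma good_cat u v : good (u ++ v) <-> good u /\ good v.
Proof.
elim: u => [|x u ih] /=; first by split=> [|[]].
split=> [[ox tx /ih[gu gv]]|[[ox tx gu] gv]]; first by split.
by split=> //; apply/ih.
Qed.

Lemma good_take i L : good L -> good (take i L).
Proof. by rewrite -{1}(cat_take_drop i L) good_cat => -[]. Qed.

Lemma good_drop i L : good L -> good (drop i L).
Proof. by rewrite -{1}(cat_take_drop i L) good_cat => -[]. Qed.

Lemma good_nth L x0 i : good L -> (i < size L)%N -> over (nth x0 L i) /\ tau (nth x0 L i).2 = 0.
Proof. by elim: L i => //= x L ih [|i] [ox tx gx] //=; exact: ih. Qed.

Lemma good_rev L : good L -> good (rev L).
Proof.
elim: L => //= x L ih [ox tx gx]; rewrite rev_cons -cats1; apply/good_cat; split; first exact: ih.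
by [].
Qed.

Lemma alt_rev L : alt (rev L) = alt L.
Proof.
rewrite /alt rev_sorted; case: L => //= x L; by apply: eq_path => a b; rewrite /= eq_sym.
Qed.

Lemma alt_take i L : alt L -> alt (take i L).
Proof. exact: take_sorted. Qed.

Lemma alt_drop i L : alt L -> alt (drop i L).
Proof. exact: drop_sorted. Qed.

Lemma alt_glue u z v : alt (rcons u z) -> alt (z :: v) -> alt (u ++ z :: v).
Proof.
case: u => //= x u h1 h2; rewrite /alt /= -cat_rcons cat_path h1 last_rcons; exact: h2.
Qed.

Definition center j (p : poly) : item := (j, NCadd p (NCconst (- tau p))).

Lemma tau_const c : tau (NCconst c) = c.
Proof.
rewrite -[RHS]mulr1 -tau_1 -tauZ; apply: tau_treq => N f /=.
by rewrite mulmx1.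
Qed.

Lemma center_tau j p : tau (center j p).2 = 0.
Proof. by rewrite /= tauD tau_const subrr. Qed.

Lemma merge (f : poly -> C) u x y v : is_lin f -> (forall p q, treq p q -> f p = f q) ->
  f (PL (u ++ x :: y :: v)) =
  f (PL (u ++ center x.1 (NCmul x.2 y.2) :: v)) + tau (NCmul x.2 y.2) * f (PL (u ++ v)).
Proof.
move=> fl fE; apply: lincomb_treq => // N g; rewrite !ncev_PL_cat /=.
rewrite mulmxDl mulmxDr linearD/= mul_scalar_mx -scalemxAr mxtraceZ mulNr subrK.
by rewrite !mulmxA.
Qed.

Lemma tau_PL_catC u v : tau (PL (u ++ v)) = tau (PL (v ++ u)).
Proof. by apply: tau_treq => N f; rewrite !ncev_PL_cat mxtrace_mulC. Qed.

Lemma tau_PL1 x : tau (PL [:: x]) = tau x.2.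
Proof. by apply: tau_treq => N f /=; rewrite mulmx1. Qed.

Lemma over_mul j (p q : poly) : over (j, p) -> over (j, q) -> over (center j (NCmul p q)).
Proof. by move=> op oq. Qed.

(** Induction on the length. If the outer families differ, the loop equation for the first one
    retains only the uncut product, proper prefixes being null by induction. If they agree,
    traciality makes the outer factors neighbours and merging shortens the product. *)
Theorem tau_alt L : (0 < size L)%N -> alt L -> good L -> tau (PL L) = 0.
Proof.
have [n] := ubnP (size L); elim: n L => // n ih [//|x z] sn _ aL gL.
have [z0|z0] := eqVneq (size z) 0%N; first by rewrite (size0nil z0) tau_PL1; case: gL.
have [xy|xy] := eqVneq x.1 (last x z).1; last first.
  have := loop0_all x.1 (PL (x :: z)).
  rewrite (@cut_PL _ _ _ [::] _ _ x loop0_balanced)//; last exact: good_over.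
  set L := x :: z in sn aL gL *; set a := fun i => loop0 (PL (take i L)) (PL (drop i L)).
  have sz : (0 < 1 < size L)%N by rewrite /L /= ltnS lt0n z0.
  have a0 i : (0 < i < size L)%N -> a i = 0.
    move=> /andP[i0 iL]; rewrite /a /loop0 ih ?mul0r//.
    - by rewrite size_take iL (leq_trans iL).
    - by rewrite size_take iL.
    - exact: alt_take.
    - exact: good_take.
  (* All inner terms vanish, so any index could serve as the exceptional one; 1 is taken. *)
  rewrite -/(a _) (@abel_sum_sparse _ (size L) 1 (fun i => (nth x L i).1 == x.1) a)//.
  - rewrite [a 1%N]a0// !mulr0 addr0 subr0 /a take0 drop0 /loop0.
    by rewrite -/(PL L) [PL [::]]/= tau_1 mul1r.
  - by rewrite nth_last /L /= eq_sym.
  - by move=> i iL _; exact: a0.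
case/lastP: z z0 sn aL gL xy => // z y _ sn aL gL; rewrite last_rcons => xy.
have -> : tau (PL (x :: rcons z y)) = tau (PL ([::] ++ y :: x :: z)).
  by rewrite -rcons_cons -cats1 tau_PL_catC.
rewrite merge//= -/(PL _).
move: aL; rewrite /alt /= rcons_path => /andP[pz lz].
have [ox tx gzy] : [/\ over x, tau x.2 = 0 & good (rcons z y)] := gL.
move: gzy; rewrite -cats1 => /good_cat[gz [oy ty _]].
(* If z were empty, x and y would be neighbours in the same family. *)
have z0 : (0 < size z)%N by case: (z) lz => //=; rewrite xy eqxx.
have sz : (size z < n)%N by move: sn; rewrite /= size_rcons ltnS => /ltnW.
rewrite [tau (PL z)]ih//; last exact: path_sorted pz.
rewrite mulr0 addr0; apply: (ih (center y.1 (NCmul y.2 x.2) :: z)) => //=.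
- by move: sn; rewrite /= size_rcons.
- by move: pz; rewrite /alt; case: (z) => //= w z'; rewrite xy.
- split=> //; last exact: (center_tau y.1).
  apply: over_mul => //; move: ox; rewrite /over /= xy//.
Qed.

Fixpoint pairing u v : C :=
  match u, v with
  | [::], [::] => 1
  | x :: u', y :: v' => tau (NCmul x.2 y.2) * pairing u' v'
  | _, _ => 0
  end.

Lemma tau_mul_ne x y : over x -> over y -> tau x.2 = 0 -> tau y.2 = 0 -> x.1 != y.1 ->
  tau (NCmul x.2 y.2) = 0.
Proof.
move=> ox oy tx ty xy; rewrite -(@tau_alt [:: x; y])//; last by rewrite /alt /= xy.
by apply: tau_treq => N f /=; rewrite mulmx1.
Qed.

(** Evaluation starts at the junction, where x meets y. If their families differ, both sides vanish.
    If not, they are merged: the centred part is again alternating and vanishes, and the scalar part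
    leaves the shorter lists. *)
Lemma tau_pairing u v : alt u -> alt v -> good u -> good v ->
  tau (PL (rev u ++ v)) = pairing u v.
Proof.
elim: u v => [|x u ih] [|y v] au av gu gv.
- exact: tau_1.
- by rewrite [LHS]tau_alt.
- rewrite cats0 [LHS]tau_alt//; [|by rewrite alt_rev|exact: good_rev].
  by rewrite size_rev.
have [ox tx gu'] := gu; have [oy ty gv'] := gv.
have au' : alt u by exact: path_sorted au.
have av' : alt v by exact: path_sorted av.
rewrite [pairing _ _]/= rev_cons cat_rcons.
have [xy|xy] := eqVneq x.1 y.1; last first.
  rewrite (tau_mul_ne ox oy tx ty xy) mul0r; apply: tau_alt.
  - by rewrite size_cat addnS.
  - rewrite -cat_rcons -rev_cons; case E : (rev (x :: u)) => [|a b].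
      by have := size_rev (x :: u); rewrite E.
    rewrite /alt /= cat_path; move: au; rewrite -alt_rev E /alt /= => ->.
    have : last a b = x by rewrite -[LHS]/(last a (a :: b)) -E rev_cons last_rcons.
    by move=> -> /=; rewrite xy.
  - by apply/good_cat; split; [exact: good_rev|].
rewrite merge// -ih// [X in X + _]tau_alt ?add0r//.
- by rewrite size_cat addnS.
- apply: alt_glue.
    rewrite -rev_cons alt_rev; move: au; rewrite /alt; case: (u) => //.
  by move: av; rewrite /alt; case: (v) => //= w v'; rewrite xy.
- apply/good_cat; split; first exact: good_rev.
  split=> //; last exact: center_tau.
  by apply: over_mul => //; move: oy; rewrite /over /= -xy.
Qed.

Definition nctI x : item := (x.1, nct x.2).

Lemma over_nct x : over x -> over (nctI x).
Proof.
rewrite /over /=; elim: x.2 => //= [a iha b ihb|a iha b ihb] [/iha ? /ihb ?]; by split.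
Qed.

Lemma good_nct L : good L -> good (map nctI L).
Proof.
elim: L => //= x L ih [ox tx gx]; split; [exact: over_nct|by rewrite tau_nct|exact: ih].
Qed.

Lemma alt_nct L : alt (map nctI L) = alt L.
Proof. by case: L => //= x L; rewrite /alt /= path_map. Qed.

Lemma ncev_nct_PL N (f : V -> 'M[C]_N) L : ncev f (nct (PL L)) = ncev f (PL (rev (map nctI L))).
Proof.
elim: L => //= x L ih; rewrite rev_cons -cats1 ncev_PL_cat -ih /= mulmx1//.
Qed.

Lemma pairing_size u v : size u != size v -> pairing u v = 0.
Proof.
by elim: u v => [|x u ih] [|y v] //= h; rewrite ih ?mulr0.
Qed.

Lemma pairing_zip u v : size u = size v ->
  pairing u v = \prod_(xy <- zip u v) tau (NCmul xy.1.2 xy.2.2).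
Proof.
elim: u v => [|x u ih] [|y v] //=; first by rewrite big_nil.
by move=> [/ih->]; rewrite big_cons.
Qed.

(** At an inner cut the term l r^t joins the last factor of l to the transposed last factor of r,
    which is why both lists are reversed before [tau_pairing]. Factors are counted from 0 here. *)
Theorem tau'_cyclic_alt L x0 : alt L -> good L -> (1 < size L)%N ->
  (head x0 L).1 != (last x0 L).1 ->
  (forall k, size L = (2 * k)%N -> tau' (PL L) =
     \prod_(i < k) tau (NCmul (nth x0 L i).2 (nct (nth x0 L (i + k)).2))) /\
  (odd (size L) -> tau' (PL L) = 0).
Proof.
move=> aL gL sL hl.
set j := (head x0 L).1 in hl.
have := loop1_all j (PL L).
rewrite (@cut_PL _ _ _ [::] _ _ x0 loop1_balanced)//; last exact: good_over.
set a := fun i => loop1 (PL (take i L)) (PL (drop i L)).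
have tL : tau (PL L) = 0 by rewrite tau_alt// (leq_trans _ sL).
have a0 : a 0%N = tau' (PL L).
  rewrite /a take0 drop0 /loop1 [PL [::]]/= tau_1 tau'_1 tL mulr0 add0r mul1r.
  rewrite (tau_treq (_ : treq (NCmul (NCconst 1) (nct (PL L))) (nct (PL L)))); last first.
    by move=> N f /=; rewrite mul1mx.
  by rewrite tau_nct tL subr0.
have ai i : (0 < i < size L)%N ->
    a i = - pairing (rev (take i L)) (rev (map nctI (drop i L))).
  move=> /andP[i0 iL]; rewrite /a /loop1.
  rewrite [tau (PL (take i L))]tau_alt; last 3 first.
  - by rewrite size_take iL.
  - exact: alt_take.
  - exact: good_take.
  rewrite [tau (PL (drop i L))]tau_alt; last 3 first.
  - by rewrite size_drop subn_gt0.
  - exact: alt_drop.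
  - exact: good_drop.
  rewrite mulr0 mul0r addr0 sub0r -tau_pairing.
  - rewrite revK; congr (- _); apply: tau_treq => N f /=.
    by rewrite ncev_nct_PL ncev_PL_cat.
  - by rewrite alt_rev; exact: alt_take.
  - by rewrite alt_rev alt_nct; exact: alt_drop.
  - by apply: good_rev; exact: good_take.
  - by apply: good_rev; apply: good_nct; exact: good_drop.
have az i : (0 < i < size L)%N -> (2 * i)%N != size L -> a i = 0.
  move=> iL i2; rewrite ai// pairing_size ?oppr0// !size_rev size_map size_take size_drop.
  by case/andP: iL => _ ->; lia.
rewrite -/(a _).
have f0 : (nth x0 L 0).1 == j by rewrite nth0.
have fn : ~~ ((nth x0 L (size L).-1).1 == j) by rewrite nth_last eq_sym.
move=> loopS; split=> [k sk|oddL]; last first.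
  have o2 i : (2 * i)%N != size L.
    by apply: contraTneq oddL => <-; rewrite mul2n odd_double.
  move: loopS; rewrite (@abel_sum_sparse _ (size L) 1 (fun i => (nth x0 L i).1 == j) a)//.
    by rewrite (az 1%N)// !mulr0 addr0 subr0 a0.
  by move=> i iL _; exact: az.
have kL : (0 < k < size L)%N by rewrite sk; move: sL; rewrite sk; lia.
have [k0 kn] := andP kL.
move: loopS; rewrite (@abel_sum_sparse _ (size L) k (fun i => (nth x0 L i).1 == j) a)//; last first.
  by move=> i iL ik; apply: az => //; rewrite sk; move: ik; lia.
rewrite a0; set h := \prod_(i < k) _ => loopS.
have szt : size (take k L) = size (map nctI (drop k L)).
  by rewrite size_map size_take size_drop kn sk; lia.
have hE : a k = - h.
  rewrite ai//; congr (- _); rewrite pairing_zip ?size_rev// -rev_zip// big_prod_rev.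
  rewrite (big_nth (x0, nctI x0)) size_zip -szt minnn size_take kn big_mkord.
  apply: eq_bigr => i _; rewrite nth_zip// nth_take ?ltn_ord//= (nth_map x0) ?nth_drop//.
    by rewrite /= addnC.
  by rewrite size_drop sk; have := ltn_ord i; lia.
(* If h is nonzero, its factor of index 0 puts factors 0 and k into the same family j. Factor k - 1
   is then outside j, so exactly one copy of [a k] survives in the loop equation. *)
have [h0|h0] := eqVneq h 0; first by move: loopS; rewrite hE h0 oppr0 !mulr0 addr0 subr0.
have fk : (nth x0 L k).1 == j.
  apply: contraNT h0 => fk; rewrite /h (bigD1 (Ordinal k0))//= add0n.
  have [ov1 t1] := good_nth x0 gL (ltn_trans k0 kn).
  have [ov2 t2] := good_nth x0 gL kn.
  rewrite (tau_mul_ne (y := nctI (nth x0 L k))) ?mul0r//.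
  - exact: over_nct.
  - by rewrite tau_nct.
  - by rewrite /= (eqP f0) eq_sym.
have fk1 : ((nth x0 L k.-1).1 == j) = false.
  apply/negbTE; rewrite -(eqP fk).
  by have /(sortedP x0)/(_ k.-1) := aL; rewrite prednK//; exact.
move: loopS; rewrite fk fk1 hE mul1r mul0r subr0 => /eqP.
by rewrite addr_eq0 opprK => /eqP.
Qed.

Lemma ncev_ncprod N (f : V -> 'M[C]_N) ps :
  ncev f (ncprod ps) = ncev f (foldr NCmul (NCconst 1) ps).
Proof.
elim: ps => //= p [|q ps] ih; first by rewrite /= mulmx1.
by rewrite [LHS]/= -/(ncprod (q :: ps)) ih.
Qed.

Lemma tau_mul_center j1 j2 (p q : poly) : over (j1, p) -> over (j2, q) -> j1 != j2 ->
  tau q = 0 -> tau (NCmul p q) = 0.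
Proof.
move=> op oq jj tq.
rewrite (@lincomb_treq tau _ (NCmul (center j1 p).2 q) (tau p) q)//.
  by rewrite tq mulr0 addr0 (@tau_mul_ne (center j1 p) (j2, q))//; exact: (center_tau j1).
move=> N g /=; rewrite mulmxDl linearD/= mul_scalar_mx mxtraceZ mulNr subrK//.
Qed.

(** Merging the outer factors shortens the product by one and so reverses parity: with equal outer
    families the pairing formula serves odd n and the vanishing serves even n; with distinct ones it
    is the other way round. In each case the remaining terms of the required formula have to be
    shown to vanish. *)
Theorem real_inf_free_of_loop :
  real_inf_free tau tau' (fun j p => nc_over (fun v : V => fam v == j) p).
Proof.
move=> n a j n1 aB at0 aj.
pose it i : item := (j i, a i); pose L l m := [seq it i | i <- iota l m].
have PLE l m : nceq (ncprodr a l m) (PL (L l (m.+1 - l)%N)).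
  by move=> N f; rewrite ncev_ncprod /PL -map_comp.
have gI l m : (forall i, (l <= i < l + m)%N -> (1 <= i <= n)%N) -> good (L l m).
  elim: m l => //= m ih l h; split.
  - by apply: aB; apply: h; lia.
  - by apply: at0; apply: h; lia.
  - by apply: ih => i hi; apply: h; lia.
have nthL l m i x0 : (i < m)%N -> nth x0 (L l m) i = it (l + i)%N.
  by move=> im; rewrite (nth_map 0%N) ?size_iota// nth_iota.
have szL l m : size (L l m) = m by rewrite size_map size_iota.
have aI l m : (forall i, (l <= i < l + m)%N -> (1 <= i <= n)%N) -> alt (L l m).
  move=> h; apply/(sortedP (it 0%N)) => i; rewrite szL => im.
  rewrite !nthL ?(ltnW im)//= addnS; apply: aj.
  by have := h (l + i)%N; have := h (l + i.+1)%N; lia.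
have tt i i' : (1 <= i <= n)%N -> (1 <= i' <= n)%N -> j i != j i' ->
    tau (NCmul (a i) (nct (a i'))) = 0.
  move=> hi hi' jj; apply: (@tau_mul_ne (it i) (nctI (it i'))) => //.
  - exact: aB.
  - by apply: over_nct; exact: aB.
  - exact: at0.
  - by rewrite /= tau_nct; exact: at0.
have t1n : j 1%N != j n -> tau (NCmul (a 1%N) (a n)) = 0.
  move=> jj; apply: (@tau_mul_ne (it 1%N) (it n)) => //; try (by apply: aB; lia);
    by apply: at0; lia.
have cyc : (2 <= n)%N -> j 1%N != j n ->
  (forall k, n = (2 * k)%N -> tau' (ncprodr a 1 n) =
     \prod_(1 <= i < k.+1) tau (NCmul (a i) (nct (a (i + k)%N)))) /\
  (odd n -> tau' (ncprodr a 1 n) = 0).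
  move=> n2 jj.
  have [||||H1 H2] := @tau'_cyclic_alt (L 1%N n) (it 0%N).
  - by apply: aI => i; lia.
  - by apply: gI => i; lia.
  - by rewrite szL.
  - rewrite -nth0 -nth_last szL !nthL; [|lia|lia].
    by rewrite addn0 (_ : (1 + n.-1)%N = n)//; lia.
  rewrite szL in H1 H2.
  rewrite (tau'_treq (nceq_treq (PLE 1%N n))) subn1 /=; split=> // k nk.
  rewrite (H1 k nk) big_add1/= big_mkord; apply: eq_bigr => i _.
  have ik := ltn_ord i.
  rewrite !nthL /=; [|lia|lia]; by rewrite addnA.
have fold m : n = m.+2 -> (0 < m)%N -> j 1%N = j n ->
    let L' := center (j n) (NCmul (a n) (a 1%N)) :: L 2%N m in
  [/\ tau' (ncprodr a 1 n) = tau (NCmul (a 1%N) (a n)) * tau' (ncprodr a 2 n.-1) + tau' (PL L'),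
      alt L', good L' & (head (it 0%N) L').1 != (last (it 0%N) L').1].
  move=> nm m0 jj L'; split.
  - rewrite (tau'_treq (_ : treq (ncprodr a 1 n) (PL ([::] ++ it n :: it 1%N :: L 2%N m)))); last first.
      move=> N f; rewrite PLE nm subn1 [_.-1]/= /L -[m.+2]addn1 iotaD map_cat ncev_PL_cat.
      by rewrite mxtrace_mulC -ncev_PL_cat /= add1n addn1.
    rewrite merge// addrC; congr (_ * _ + _).
      by apply: tau_treq => N f /=; rewrite mxtrace_mulC.
    rewrite (tau'_treq (nceq_treq (PLE 2%N n.-1))) nm /= subn2//.
  - have : alt (L 1%N m.+1) by apply: aI => i; lia.
    rewrite /L' /alt /L /=; case: (iota 2 m) => //= i r /andP[h ->]; rewrite andbT.
    by rewrite -jj.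
  - split; [|exact: (center_tau (j n))|by apply: gI => i; lia].
    split=> //; split; first by apply: aB; lia.
    by rewrite /= -jj; apply: aB; lia.
  - case: m m0 nm @L' => // m _ nm.
    have -> : L 2%N m.+1 = rcons (L 2%N m) (it m.+2).
      by rewrite /L -[X in iota 2 X]addn1 iotaD map_cat cats1 add2n.
    rewrite /= last_rcons eq_sym nm.
    by apply: (aj m.+2); lia.
split.
- rewrite (tau_treq (nceq_treq (PLE 1%N n))) subn1/=; apply: tau_alt.
  + by rewrite szL.
  + by apply: aI => i; lia.
  + by apply: gI => i; lia.
- move=> n2; subst n; have [//|H _] := cyc isT; first by apply: (aj 1%N).
  have := H 1%N erefl; rewrite big_nat1 tt//; exact: (aj 1%N).
- move=> k nk n3.
  have [j1n|j1n] := eqVneq (j 1%N) (j n); last first.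
    have [|//|_ H] := cyc; first by lia.
    rewrite H; last by rewrite nk -subn1 oddB ?mul2n ?odd_double//; lia.
    rewrite t1n// mul0r add0r.
    (* If a_k shares the family of a_1 or of a_n, its transpose joins that factor, cyclically in the
       second case, and the remaining centred factor is free from the product; otherwise the three
       factors alternate. *)
    suff -> : tau (ncprod [:: a 1%N; nct (a k); a n]) = 0 by rewrite mul0r.
    have kn : (1 <= k <= n)%N by lia.
    have ok' : over (nctI (it k)) by apply: over_nct; exact: aB.
    have o1' : over (it 1%N) by apply: aB; lia.
    have on' : over (it n) by apply: aB; lia.
    have tk' : tau (nct (a k)) = 0 by rewrite tau_nct; exact: at0.
    have t1' : tau (a 1%N) = 0 by apply: at0; lia.
    have tn' : tau (a n) = 0 by apply: at0; lia.
    have [jk1|jk1] := eqVneq (j k) (j 1%N).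
      rewrite (tau_treq (_ : treq _ (NCmul (NCmul (a 1%N) (nct (a k))) (a n)))); last first.
        by move=> N f /=; rewrite mulmxA.
      apply: (@tau_mul_center (j 1%N) (j n)) => //; split=> //.
      by move: ok'; rewrite /over /= jk1.
    have [jkn|jkn] := eqVneq (j k) (j n).
      rewrite (tau_treq (_ : treq _ (NCmul (NCmul (nct (a k)) (a n)) (a 1%N)))); last first.
        by move=> N f /=; rewrite mxtrace_mulC.
      apply: (@tau_mul_center (j n) (j 1%N)) => //; last by rewrite eq_sym.
      by split=> //; move: ok'; rewrite /over /= jkn.
    rewrite (tau_treq (_ : treq _ (PL [:: it 1%N; nctI (it k); it n]))); last first.
      by move=> N f /=; rewrite mulmx1.
    by apply: tau_alt => //=; rewrite /alt /= jkn eq_sym jk1.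
  have [k' kk] : exists k', k = k'.+2 by exists (k - 2)%N; lia.
  (* m = n - 2 factors lie strictly between the outer two; with the merged one they number 2 (k' +
     1), and the merged factor is paired with a_k. *)
  pose m := (2 * k').+1.
  have [||//|-> aL gL hl] := fold m; [by rewrite nk kk /m; lia|by []|].
  congr (_ + _).
  have [|H _] := tau'_cyclic_alt aL gL _ hl; first by rewrite /= szL.
  rewrite (H k'.+1) /=; last by rewrite szL /m; lia.
  rewrite big_ord_recl; congr (_ * _).
    rewrite /= nthL; last by rewrite /m; lia.
    rewrite (_ : (2 + k')%N = k) ?kk// -kk.
    rewrite (tau_treq (_ : treq (ncprod [:: a 1%N; nct (a k); a n])
       (NCmul (NCmul (a n) (a 1%N)) (nct (a k))))); last first.
      by move=> N f /=; rewrite mulmxA mxtrace_mulC mulmxA.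
    (* Centring a_n a_1 does not change this value, since tau(a_k^t) = 0. *)
    rewrite (@lincomb_treq tau (NCmul (NCmul (a n) (a 1%N)) (nct (a k)))
      (NCmul (center (j n) (NCmul (a n) (a 1%N))).2 (nct (a k))) (tau (NCmul (a n) (a 1%N))) (nct (a k)))//.
      by rewrite tau_nct at0 ?mulr0 ?addr0//; lia.
    by move=> N g /=; rewrite mulmxDl linearD/= mul_scalar_mx mxtraceZ mulNr subrK.
  rewrite kk (big_addn 0 _ 2) subn2 /= big_mkord; apply: eq_bigr => i _.
  have ik := ltn_ord i.
  rewrite /= /bump /= !nthL; [|rewrite /m; lia|rewrite /m; lia].
  by rewrite /=; congr (tau (NCmul (a _) (nct (a _)))); lia.
- move=> k nk n4.
  have [j1n|j1n] := eqVneq (j 1%N) (j n); last first.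
    have [|//|H _] := cyc; first by lia.
    by rewrite (H k nk) t1n// mul0r add0r.
  pose m := (n - 2)%N.
  have [||//|-> aL gL hl] := fold m; [by rewrite /m; lia|by rewrite /m; lia|].
  congr (_ + _).
  have [|_ H] := tau'_cyclic_alt aL gL _ hl; first by rewrite /= szL /m; lia.
  rewrite H; last first.
    by rewrite /= szL /m nk oddB ?mul2n ?odd_double//; lia.
  (* The product must vanish. Its first factor pairs a_1 with a_(k+1) and its last one a_k with a_n;
     as a_1 and a_n share a family, both being nonzero would put the neighbours a_k and a_(k+1) into
     the same family. *)
  apply/esym; have [jk|jk] := eqVneq (j 1%N) (j k.+1); last first.
    rewrite big_ltn; last by lia.
    by rewrite tt ?mul0r// ?add1n//; lia.
  rewrite big_nat_recr/=; last by lia.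
  rewrite tt ?mulr0//; [lia|lia|].
  rewrite (_ : (k + k)%N = n) -?j1n ?jk; last by lia.
  by apply: aj; lia.
Qed.

End freeness.

(** * The limiting functionals *)

Lemma cut_eqk (R : realType) (V : Type) (Q : V -> bool)
    (g : nat -> ncpoly R V -> ncpoly R V -> R[i]) (g0 g1 : ncpoly R V -> ncpoly R V -> R[i]) l p r :
  (forall l r, eqk 1 (fun N => g N l r) (fun N => g0 l r + N%:R^-1 * g1 l r)) ->
  eqk 1 (fun N => cut Q (g N) l p r) (fun N => cut Q g0 l p r + N%:R^-1 * cut Q g1 l p r).
Proof.
move=> H.
have z0 : eqk 1 (fun=> 0 : R[i]) (fun N => 0 + N%:R^-1 * 0).
  by apply: eqk_eq => N _; rewrite mulr0 addr0.
have zB l1 r1 l2 r2 : eqk 1 (fun N => g N l1 r1 - g N l2 r2)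
    (fun N => (g0 l1 r1 - g0 l2 r2) + N%:R^-1 * (g1 l1 r1 - g1 l2 r2)).
  apply: (eqk_trans (eqk_sub (H l1 r1) (H l2 r2))); apply: eqk_eq => N _; ring.
elim: p l r => [c|v|v|a iha b ihb|a iha b ihb] l r /=.
- exact: z0.
- by case: (Q v).
- by case: (Q v).
- by apply: (eqk_trans (eqk_add (iha _ _) (ihb _ _))); apply: eqk_eq => N _; ring.
- by apply: (eqk_trans (eqk_add (iha _ _) (ihb _ _))); apply: eqk_eq => N _; ring.
Qed.

Theorem theorem5p7 (R : realType) (d : measure_display) (T : measurableType d)
  (P : probability T R) (s : nat) (k : 'I_s -> nat)
  (X : forall (N : nat) (j : 'I_s), 'I_(k j) -> T -> 'M[R[i]]_N) :
  (* entries lie in L^{infty-} *)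
  (forall N j i (a b : 'I_N), Linfm P (fun w => X N j i w a b)) ->
  (* entries of matrices from different subalgebras form independent sets *)
  (forall N, indep_families P (fun j => entry_rv (X N j))) ->
  (* all, or all but one, families are orthogonally invariant *)
  ((forall j N, orth_invariant P (X N j)) \/
   (exists j0 : 'I_s, forall j, j != j0 -> forall N, orth_invariant P (X N j))) ->
  (* each family satisfies (P1), (P2), (P3) *)
  (forall j, propP1 P (fun N => X N j)) ->
  (forall j, propP2 P (fun N => X N j)) ->
  (forall j, propP3 P (fun N => X N j)) ->
  exists tau tau' : ncpoly R {j : 'I_s & 'I_(k j)} -> R[i],
    (forall p, cvgC (fun N => EC P (trRV (fun v w => X N (tag v) (tagged v) w) p)) (tau p)) /\
    (forall p, cvgC (fun N => N%:R *
        (EC P (trRV (fun v w => X N (tag v) (tagged v) w) p) - tau p)) (tau' p)) /\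
    real_inf_space tau tau' /\
    real_inf_free tau tau' (fun j p => nc_over (fun v => tag v == j) p).
Proof.
move=> HL Hind Hinv H1 H2 H3.
have LX N j i a b : all_momentsC P (fun w => X N j i w a b) by exact: Linfm_all_momentsC.
(* Of two distinct families at most one is the exception; this pairwise form covers both
   alternatives of the hypothesis. *)
have almost_all (j1 j2 : 'I_s) : j1 != j2 ->
    (forall N, orth_invariant P (X N j1)) \/ (forall N, orth_invariant P (X N j2)).
  move=> jj; case: Hinv => [h|[j0 h]]; first by left; exact: h.
  have [E|n1] := eqVneq j1 j0; last by left; exact: h.
  by right; apply: h; rewrite -E eq_sym.
pose V := {j : 'I_s & 'I_(k j)}.
have [t tP] : {t : ncpoly R V -> R[i] * R[i] & forall p,
    eqk 1 (fun N => EN P X N [:: p]) (fun N => (t p).1 + N%:R^-1 * (t p).2)}.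
  apply: (@choice _ _ (fun p (ab : R[i] * R[i]) =>
    eqk 1 (fun N => EN P X N [:: p]) (fun N => ab.1 + N%:R^-1 * ab.2))) => p.
  by have [a [b H]] := EN_conv LX Hind almost_all H1 H2 H3 p; exists (a, b).
pose tau p := (t p).1; pose tau' p := (t p).2; exists tau, tau'.
(* The values were picked by choice, but uniqueness of the expansion transfers identities between
   moments to [tau] and [tau']. *)
have tuniq p a b : eqk 1 (fun N => EN P X N [:: p]) (fun N => a + N%:R^-1 * b) ->
    tau p = a /\ tau' p = b.
  by move=> H; apply: eqk1_affine_unique; exact: eqk_trans (eqk_sym (tP p)) H.
have tlin p q r a b : (forall N (g : V -> 'M[R[i]]_N),
    \tr (ncev g p) = a * \tr (ncev g q) + b * \tr (ncev g r)) ->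
    tau p = a * tau q + b * tau r /\ tau' p = a * tau' q + b * tau' r.
  move=> H; apply: tuniq.
  apply: (@eqk_trans _ _ (fun N => a * EN P X N [:: q] + b * EN P X N [:: r])).
    apply: eqk_eq => N _; rewrite (@EN_lincomb _ _ _ P _ _ X LX N _ [:: true; false]
      (fun i => if i then a else b) (fun i => if i then q else r)).
      by rewrite !big_cons big_nil addr0.
    by move=> g; rewrite H !big_cons big_nil addr0.
  apply: (eqk_trans (eqk_add (eqk_scale a (tP q)) (eqk_scale b (tP r)))).
  by apply: eqk_eq => N _; rewrite /tau /tau'; ring.
have ttreq p q : treq p q -> tau p = tau q /\ tau' p = tau' q.
  move=> H; have [] := tlin p q q 1 0; last by rewrite !mul1r !mul0r !addr0.
  by move=> N g; rewrite H mul1r mul0r addr0.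
have lin0 : is_lin tau.
  split=> [a b|c a].
    have [|-> _] := tlin (NCadd a b) a b 1 1; last by rewrite !mul1r.
    by move=> N g /=; rewrite linearD !mul1r.
  have [|-> _] := tlin (NCmul (NCconst c) a) a a c 0; last by rewrite mul0r addr0.
  by move=> N g /=; rewrite mul_scalar_mx mxtraceZ mul0r addr0.
have lin1 : is_lin tau'.
  split=> [a b|c a].
    have [|_ ->] := tlin (NCadd a b) a b 1 1; last by rewrite !mul1r.
    by move=> N g /=; rewrite linearD !mul1r.
  have [|_ ->] := tlin (NCmul (NCconst c) a) a a c 0; last by rewrite mul0r addr0.
  by move=> N g /=; rewrite mul_scalar_mx mxtraceZ mul0r addr0.
have [t1 t1'] : tau (NCconst 1) = 1 /\ tau' (NCconst 1) = 0.
  apply: tuniq; apply: eqk_eq => N N0; rewrite EN_one// mulr0 addr0 -[RHS](EC_cst P).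
  by congr (EC _ _); apply/funext => w; rewrite big_nil.
have loops j p : (forall N, orth_invariant P (X N j)) ->
    cut (fun v : V => tag v == j) (loop0 tau) (NCconst 1) p (NCconst 1) = 0 /\
    cut (fun v : V => tag v == j) (loop1 tau tau') (NCconst 1) p (NCconst 1) = 0.
  (* At every size N > 0 the loop sum is exactly 0, so both coefficients of its expansion vanish. *)
  move=> inv; apply: eqk1_affine_unique.
  apply: eqk_trans (eqk_sym (cut_eqk (g := fun N l r => EN P X N [:: l; r] -
    N%:R^-1 * EN P X N [:: NCmul l (nct r)]) _ _ _ _ _)) _ => [l r|].
    apply: (@eqk_trans _ _ (fun N => (tau l + N%:R^-1 * tau' l) * (tau r + N%:R^-1 * tau' r) -
       N%:R^-1 * tau (NCmul l (nct r)))).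
      apply: eqk_sub; last by apply: eqk_eps; exact: eqk1_affine0 (tP _).
      apply: (eqk_trans (EN_prod2 LX Hind almost_all H1 H2 H3 l r)).
      by apply: eqk_mul; [exact: tP|exact: tP|exact: bnd_affine|exact: bnd_affine].
    apply: (@eqk_trans _ _ (fun N => (loop0 tau l r + N%:R^-1 * loop1 tau tau' l r) +
        N%:R^-1 * (N%:R^-1 * (tau' l * tau' r)))).
      by apply: eqk_eq => N _; rewrite /loop0 /loop1; ring.
    apply: (@eqk_trans _ _ (fun N => (loop0 tau l r + N%:R^-1 * loop1 tau tau' l r) + 0)).
      by apply: eqk_add; [exact: eqk_refl|apply: bnd_eps2 => //; exact: bnd_cst].
    by apply: eqk_eq => N _; rewrite addr0.
  by apply: eqk_eq => N N0; rewrite (EN_loop LX Hind inv)// mulr0 addr0.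
have lims p : cvgC (fun N => EC P (trRV (fun v w => X N (tag v) (tagged v) w) p)) (tau p) /\
    cvgC (fun N => N%:R * (EC P (trRV (fun v w => X N (tag v) (tagged v) w) p) - tau p)) (tau' p).
  by have := eqk1_affineP (tP p); under eq_fun do rewrite EN_seq1;
    under [X in _ /\ cvgC X _ -> _]eq_fun do rewrite EN_seq1.
split; first by move=> p; case: (lims p).
split; first by move=> p; case: (lims p).
split.
  split=> //; split=> //; split=> // p; apply: (proj1 (ttreq _ _ _)) => N f.
  by rewrite ncev_nct mxtrace_tr.
apply: (@real_inf_free_of_loop R V s (fun v => tag v) tau tau' lin0 lin1 t1 t1' _ _
  (fun j => forall N, orth_invariant P (X N j)) almost_all).
- by move=> p q /ttreq[].
- by move=> p q /ttreq[].
- by move=> j p /loops-/(_ p)[].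
- by move=> j p /loops-/(_ p)[].
Qed.
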